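(* Let $M$ be a compact connected complex manifold, $G$ a connected reductive complex affine algebraic group, and $E_G$ a holomorphic principal $G$-bundle over $M$. Let $T\subset G$ be a complex torus containing the identity component $Z_0(G)$ of the center of $G$, let $N$ be the normalizer of $T$ in $G$, and let $\mathbb T\subset\mathrm{Ad}(E_G)$ be a torus subbundle whose fibers lie in the conjugacy class of tori determined by $T$. Let $E_N=\{y\in E_G:[y,t]\in\mathbb T\ \text{for all } t\in T\}\subset E_G$ be the corresponding holomorphic reduction of structure group of $E_G$ to $N$. Let $D_0$ be a complex connection on $E_G$ and let $D_1$ be the complex connection on $\mathrm{Ad}(E_G)$ induced by $D_0$. Then $D_0$ is induced by a complex connection on the principal $N$-bundle $E_N$ if and only if $D_1$ preserves the torus subbundle $\mathbb T\subset\mathrm{Ad}(E_G)$. Moreover, when $D_1$ preserves $\mathbb T$, the connection $D_0$ is holomorphic if and only if the connection on $E_N$ inducing $D_0$ is holomorphic.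
   Context: Principal bundles carry right actions. $\mathrm{Ad}(E_G)=(E_G\times G)/\!\sim$, where $(y,z)\sim(yg,g^{-1}zg)$; the class of $(y,z)$ is $[y,z]$. Each fiber $\mathrm{Ad}(E_G)_x$ is a group isomorphic to $G$ via $z\mapsto[y,z]$ ($y\in(E_G)_x$), canonically up to inner automorphisms, so a torus in $\mathrm{Ad}(E_G)_x$ determines a conjugacy class of tori in $G$. A torus subbundle is a holomorphic sub-fiber bundle $\mathbb T\subset\mathrm{Ad}(E_G)$, containing $M\times Z_0(G)$, whose fibers are (not necessarily maximal) algebraic tori. Connections: for a complex Lie group $H$ and a holomorphic principal $H$-bundle $E_H\to M$, the Atiyah bundle is $\mathrm{At}(E_H)=(TE_H)/H$ ($T$ denoting holomorphic tangent bundles here), fitting in the Atiyah exact sequence $0\to\mathrm{ad}(E_H)\to\mathrm{At}(E_H)\to TM\to0$. A complex connection on $E_H$ is a $C^\infty$ homomorphism $D:TM\to\mathrm{At}(E_H)$ splitting the projection to $TM$; it is a holomorphic connection if $D$ is holomorphic. For a holomorphic homomorphism $\eta:H\to H'$ with associated extension of structure group $E_{H'}$, there is a natural homomorphism $\eta_1:\mathrm{At}(E_H)\to\mathrm{At}(E_{H'})$, and the connection on $E_{H'}$ induced by $D$ is $\eta_1\circ D$. A complex connection on $E_H$ also induces a complex connection (a $C^\infty$ horizontal distribution in the holomorphic tangent bundle) on every fiber bundle associated to $E_H$ for a holomorphic action of $H$ on a complex manifold, in particular on $\mathrm{Ad}(E_H)$. Such a connection preserves a holomorphic sub-fiber bundle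 if its horizontal distribution is tangent to that sub-fiber bundle at its points. *)

(* Defs.v *)
From HB Require Import structures.
From mathcomp Require Import all_boot all_order all_algebra.
From mathcomp Require Import complex.
From mathcomp Require Import all_classical all_reals all_analysis.
Import numFieldNormedType.Exports.

Set Implicit Arguments.
Unset Strict Implicit.
Unset Printing Implicit Defensive.

Import Order.TTheory GRing.Theory Num.Theory.
Local Open Scope classical_set_scope.
Local Open Scope ring_scope.

(* [R[i]] is repackaged as a numFieldType so that the topology and the norm of
   matrices over it, hence [differentiable] and ['d f x], are inferred. *)
Definition Cx (R : realType) : numFieldType := R[i].
Definition CofR (R : realType) (t : R) : Cx R := (t%:C)%C.

Section Maps.
Context {R : realType}.
Local Notation C := (Cx R).

Definition holo_at n m (f : 'rV[C]_n -> 'rV[C]_m) (x : 'rV[C]_n) : Prop :=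
  \forall y \near x, differentiable f y.

(* Derivative along v for a *real* parameter: [differentiable] above is with
   respect to the complex scalars and would only see holomorphic maps. *)
Definition real_deriv n m (f : 'rV[C]_n -> 'rV[C]_m) (v x : 'rV[C]_n)
    (l : 'rV[C]_m) : Prop :=
  (fun t : R => (CofR t)^-1 *: (f (x + CofR t *: v) - f x)) @ (0 : R)^' --> l.

Fixpoint Ck (k : nat) n m (U : set 'rV[C]_n) (f : 'rV[C]_n -> 'rV[C]_m) : Prop :=
  (forall x, U x -> {for x, continuous f}) /\
  if k is k'.+1 then
    forall v, exists2 g, (forall x, U x -> real_deriv f v x (g x)) & Ck k' U g
  else True.

Definition smooth_fun_at n m (f : 'rV[C]_n -> 'rV[C]_m) (x : 'rV[C]_n) : Prop :=
  exists2 U, open_nbhs x U & forall k, Ck k U f.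

End Maps.

Lemma sval_eq (T : Type) (P : T -> Prop) (a b : {x | P x}) :
  sval a = sval b -> a = b.
Proof. by apply: eq_sig_hprop => x p q; exact: Prop_irrelevance. Qed.

(* A chart is a partial map: only the values of [cmap] on [cdom] and those of
   [cinv] on the image of [cdom] are meaningful. *)
Record chart (R : realType) (X : Type) (n : nat) := Chart {
  cdom : set X;
  cmap : X -> 'rV[Cx R]_n;
  cinv : 'rV[Cx R]_n -> X }.

(* A set with a family of charts.  Atlases of derived spaces (products, tangent
   bundles, quotients, subsets) are given without any side condition; the
   axioms of complex manifolds are gathered in [is_complex_manifold]. *)
Record premanifold (R : realType) := PreManifold {
  pt :> Type;
  mdim : nat;
  atlas : set (chart R pt mdim) }.
Arguments atlas {R} p.

Section Topology.
Context {R : realType} (X : premanifold R).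

(* The atlas topology: O is open iff its trace on each chart domain is open in
   that chart. *)
Definition mopen (O : set X) : Prop := forall c, atlas X c ->
  exists2 W, open W & O `&` cdom c = cdom c `&` cmap c @^-1` W.

Lemma mopenT : mopen [set: X].
Proof. by move=> c _; exists setT; [exact: openT | rewrite setTI preimage_setT setIT]. Qed.

Lemma mopenI : setI_closed mopen.
Proof.
move=> A B oA oB c Xc; have [V oV AV] := oA c Xc; have [W oW BW] := oB c Xc.
exists (V `&` W); first exact: openI.
by rewrite preimage_setI setIIr -AV -BW setIIl.
Qed.

Lemma mopen_bigU (I : Type) (F : I -> set X) :
  (forall i, mopen (F i)) -> mopen (\bigcup_i F i).
Proof.
move=> oF c Xc; have /choice[W hW] : forall i, exists V,
    open V /\ F i `&` cdom c = cdom c `&` cmap c @^-1` V.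
  by move=> i; have [V oV FV] := oF i c Xc; exists V.
exists (\bigcup_i W i); first by apply: bigcup_open => i _; have [] := hW i.
rewrite preimage_bigcup setI_bigcupr setI_bigcupl.
by apply: eq_bigcupr => i _; have [] := hW i.
Qed.

HB.instance Definition _ := gen_eqMixin (pt X).
HB.instance Definition _ := gen_choiceMixin (pt X).
HB.instance Definition _ :=
  isOpenTopological.Build (pt X) mopenT mopenI mopen_bigU.

Lemma mopenE (O : set (pt X)) : open O = mopen O.
Proof. by []. Qed.

Definition is_complex_manifold : Prop :=
  [/\ (forall x, exists2 c, atlas X c & cdom c x),
      (forall c, atlas X c ->
         open (cmap c @` cdom c) /\ {in cdom c, cancel (cmap c) (cinv c)}),
      (forall c c', atlas X c -> atlas X c' ->
         open (cmap c @` (cdom c `&` cdom c')) /\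
         forall x, cdom c x -> cdom c' x ->
           holo_at (cmap c' \o cinv c) (cmap c x)),
      hausdorff_space (pt X) &
      second_countable (T := pt X)].

(* A chart of the atlas around x, chosen once and for all; the default value is
   irrelevant when the atlas covers X. *)
Definition chart_at (x : X) : chart R X (mdim X) :=
  match pselect (exists c, atlas X c /\ cdom c x) with
  | left e => sval (cid e)
  | right _ => Chart set0 (fun=> 0) (fun=> x)
  end.

End Topology.

Section ManifoldMaps.
Context {R : realType}.
Local Notation C := (Cx R).
Implicit Types X Y : premanifold R.

Definition holomorphic_at X Y (f : X -> Y) (x : X) : Prop :=
  {for x, continuous f} /\
  forall c c', atlas X c -> atlas Y c' -> cdom c x -> cdom c' (f x) ->
    holo_at (cmap c' \o f \o cinv c) (cmap c x).

Definition smooth_at X Y (f : X -> Y) (x : X) : Prop :=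
  {for x, continuous f} /\
  forall c c', atlas X c -> atlas Y c' -> cdom c x -> cdom c' (f x) ->
    smooth_fun_at (cmap c' \o f \o cinv c) (cmap c x).

Definition holomorphic X Y (f : X -> Y) : Prop := forall x, holomorphic_at f x.
Definition smooth X Y (f : X -> Y) : Prop := forall x, smooth_at f x.

(* The holomorphic tangent space T_x X is 'rV[C]_(mdim X), a vector being
   identified with its coordinates in [chart_at x]. *)
Definition mdiff X Y (f : X -> Y) (x : X) : 'rV[C]_(mdim X) -> 'rV[C]_(mdim Y) :=
  'd (cmap (chart_at (f x)) \o f \o cinv (chart_at x)) (cmap (chart_at x) x).

Definition affM (n : nat) : premanifold R :=
  PreManifold [set Chart [set: 'rV[C]_n] id id].

Definition prod_chart (X Y : Type) n m (c : chart R X n) (d : chart R Y m) :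
    chart R (X * Y) (n + m) :=
  Chart (cdom c `*` cdom d)
    (fun p => row_mx (cmap c p.1) (cmap d p.2))
    (fun w => (cinv c (lsubmx w), cinv d (rsubmx w))).

Definition prodM X Y : premanifold R :=
  PreManifold [set prod_chart p.1 p.2 | p in atlas X `*` atlas Y].

Definition tangent_chart X (c : chart R X (mdim X)) :
    chart R (X * 'rV[C]_(mdim X)) (mdim X + mdim X) :=
  Chart [set xv | cdom c xv.1]
    (fun xv => row_mx (cmap c xv.1)
       ('d (cmap c \o cinv (chart_at xv.1)) (cmap (chart_at xv.1) xv.1) xv.2))
    (fun w => let x := cinv c (lsubmx w) in
       (x, 'd (cmap (chart_at x) \o cinv c) (lsubmx w) (rsubmx w))).

Definition tangentM X : premanifold R :=
  PreManifold [set tangent_chart c | c in atlas X].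

Definition mkT X (x : X) (v : 'rV[C]_(mdim X)) : tangentM X := (x, v).

(* The embedded submanifold structure on S: its charts are the restrictions to
   S of holomorphic maps F, defined on an open subset of X, whose inverse is
   holomorphic as a map into X.  Thus [is_complex_manifold (subM_ S k)] says
   that S is a locally closed complex submanifold of pure dimension k. *)
Definition subM_ X (S : set X) (k : nat) : premanifold R :=
  PreManifold [set c : chart R {x : X | S x} k |
    [/\ open (cmap c @` cdom c),
        {in cdom c, cancel (cmap c) (cinv c)},
        (forall a, cdom c a ->
           @holomorphic_at (affM k) X (fun z => sval (cinv c z)) (cmap c a)) &
        exists O : set X, exists F : X -> affM k,
          [/\ open O, cdom c = [set a | O (sval a)],
              (forall x, O x -> holomorphic_at F x) &
              (forall a, cdom c a -> cmap c a = F (sval a))]]].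

(* The dimension is the one that makes S a submanifold, if there is one (it is
   unique as soon as S is nonempty). *)
Definition sub_dim X (S : set X) : nat :=
  xget 0%N [set k | is_complex_manifold (subM_ S k)].
Definition subM X (S : set X) : premanifold R := subM_ S (sub_dim S).
Definition is_submanifold X (S : set X) : Prop := is_complex_manifold (subM S).
Definition sub_incl X (S : set X) : subM S -> X := fun a => sval a.

(* The tangent space T_a S, as a subspace of T_a X. *)
Definition sub_tangent X (S : set X) (a : subM S) : set 'rV[C]_(mdim X) :=
  range (mdiff (@sub_incl X S) a).

Definition quot X (e : X -> X -> Prop) : Type :=
  {A : set X | exists x, A = [set y | e x y]}.
Definition quot_class X (e : X -> X -> Prop) (x : X) : quot e :=
  exist _ [set y | e x y] (ex_intro _ x erefl).
Definition quot_repr X (e : X -> X -> Prop) (a : quot e) : X :=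
  sval (cid (svalP a)).

(* The quotient manifold structure of dimension m: its charts are those whose
   composition with the quotient map is a holomorphic submersion, i.e. is
   holomorphic and has a local holomorphic section through each point. *)
Definition quotM X (e : X -> X -> Prop) (m : nat) : premanifold R :=
  PreManifold [set c : chart R (quot e) m |
    [/\ open (cmap c @` cdom c),
        {in cdom c, cancel (cmap c) (cinv c)} &
        forall x, cdom c (quot_class e x) ->
          let z0 := cmap c (quot_class e x) in
          [/\ \forall x' \near x, cdom c (quot_class e x'),
              @holomorphic_at X (affM m) (fun x' => cmap c (quot_class e x')) x &
              exists s : affM m -> X,
                [/\ s z0 = x, holomorphic_at s z0 &
                    \forall z \near z0, quot_class e (s z) = cinv c z]]]].

Definition locally_trivial X (B F : premanifold R) (p : X -> B) : Prop :=
  forall b, exists U : set B, [/\ open U, U b &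
    exists t : X -> F, exists s : prodM B F -> X,
      (forall x, U (p x) -> holomorphic_at t x /\ s (p x, t x) = x) /\
      (forall b' f, U b' ->
         [/\ holomorphic_at s (b', f), p (s (b', f)) = b' & t (s (b', f)) = f])].

Definition is_fiber_bundle X (B : premanifold R) (p : X -> B) : Prop :=
  [/\ is_complex_manifold X, holomorphic p &
      exists2 F : premanifold R, is_complex_manifold F & locally_trivial F p].

End ManifoldMaps.

Record lie_data (R : realType) := LieData {
  lie_group :> groupType;
  lie_dim : nat;
  lie_atlas : set (chart R lie_group lie_dim) }.

Definition lieM (R : realType) (G : lie_data R) : premanifold R :=
  PreManifold (@lie_atlas R G).

Section LieGroups.
Context {R : realType}.
Local Notation C := (Cx R).
Implicit Type G : lie_data R.

Definition is_complex_lie_group G : Prop :=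
  [/\ is_complex_manifold (lieM G),
      @holomorphic _ (prodM (lieM G) (lieM G)) (lieM G) (fun p => (p.1 * p.2)%g) &
      @holomorphic _ (lieM G) (lieM G) (fun x => (x^-1)%g)].

Record is_subgroup (G : groupType) (S : set G) : Prop := IsSubgroup {
  sub1 : S 1%g;
  subM2 : forall x y, S x -> S y -> S (x * y)%g;
  subV : forall x, S x -> S (x^-1)%g }.

Definition subgroup_type (G : groupType) (S : set G) of is_subgroup S : Type :=
  {x : G | S x}.

Section Subgroup.
Context {G : groupType} {S : set G} (hS : is_subgroup S).
Local Notation sg_type := (subgroup_type hS).

Definition sg_one : sg_type := exist _ 1%g (sub1 hS).
Definition sg_mul (a b : sg_type) : sg_type :=
  exist _ (sval a * sval b)%g (subM2 hS (svalP a) (svalP b)).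
Definition sg_inv (a : sg_type) : sg_type :=
  exist _ ((sval a)^-1)%g (subV hS (svalP a)).

Lemma sg_mulA : associative sg_mul.
Proof. by move=> a b c; apply: sval_eq; rewrite /= mulgA. Qed.
Lemma sg_mul1g : left_id sg_one sg_mul.
Proof. by move=> a; apply: sval_eq; rewrite /= mul1g. Qed.
Lemma sg_mulg1 : right_id sg_one sg_mul.
Proof. by move=> a; apply: sval_eq; rewrite /= mulg1. Qed.
Lemma sg_mulVg : left_inverse sg_one sg_inv sg_mul.
Proof. by move=> a; apply: sval_eq; rewrite /= mulVg. Qed.
Lemma sg_mulgV : right_inverse sg_one sg_inv sg_mul.
Proof. by move=> a; apply: sval_eq; rewrite /= mulgV. Qed.

HB.instance Definition _ := gen_eqMixin sg_type.
HB.instance Definition _ := gen_choiceMixin sg_type.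
HB.instance Definition _ :=
  isGroup.Build sg_type sg_mulA sg_mul1g sg_mulg1 sg_mulVg sg_mulgV.
End Subgroup.

Definition sub_lie G (S : set G) (hS : is_subgroup S) : lie_data R :=
  @LieData R (subgroup_type hS) _ (atlas (@subM R (lieM G) S)).

Definition group_normalizer (G : groupType) (T : set G) : set G :=
  [set n | forall t, T t <-> T (n * t * n^-1)%g].

Lemma group_normalizer_subgroup (G : groupType) (T : set G) :
  is_subgroup (group_normalizer T).
Proof.
split.
- by move=> t; rewrite mul1g invg1 mulg1.
- move=> x y hx hy t; rewrite invgM !mulgA.
  by rewrite (hy t) (hx (y * t * y^-1)%g) !mulgA.
- move=> x hx t; rewrite invgK (hx (x^-1 * t * x)%g).
  by rewrite !mulgA mulgV mul1g -mulgA mulgV mulg1.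
Qed.

Definition group_center (G : groupType) : set G :=
  [set z | forall x, (x * z = z * x)%g].

Definition Z0 G : set G :=
  @connected_component (pt (lieM G)) (@group_center G) 1%g.

End LieGroups.
Arguments Z0 {R} G.

Section AlgebraicGroups.
Context {R : realType}.
Local Notation C := (Cx R).

Inductive polynomial_fun n : ('rV[C]_n -> C) -> Prop :=
| Poly_const a : polynomial_fun (fun=> a)
| Poly_coord i : polynomial_fun (fun z => z 0 i)
| Poly_add f g : polynomial_fun f -> polynomial_fun g ->
    polynomial_fun (fun z => f z + g z)
| Poly_mul f g : polynomial_fun f -> polynomial_fun g ->
    polynomial_fun (fun z => f z * g z).

Definition polynomial_map n m (f : 'rV[C]_n -> 'rV[C]_m) : Prop :=
  forall j, polynomial_fun (fun z => f z 0 j).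

(* [emb] is a closed embedding of the underlying affine variety into an affine
   space, so that regular functions are the restrictions of polynomials. *)
Record alggroup_data := AlgGroupData {
  alg_lie :> lie_data R;
  emb_dim : nat;
  emb : alg_lie -> 'rV[C]_emb_dim }.
Arguments emb {_}.

Implicit Type G : alggroup_data.

(* The last clause (a local holomorphic left inverse of [emb]) says that the
   manifold structure of G is the one induced by the embedding. *)
Definition is_affine_algebraic_group G : Prop :=
  [/\ is_complex_lie_group G,
      injective (@emb G) /\
      (exists I : set ('rV[C]_(emb_dim G) -> C),
        (forall f, I f -> polynomial_fun f) /\
        range (@emb G) = [set z | forall f, I f -> f z = 0]),
      (exists2 mu, polynomial_map mu &
         forall x y : G, emb (x * y)%g = mu (row_mx (emb x) (emb y))),
      (exists2 nu, polynomial_map nu &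
         forall x : G, emb (x^-1)%g = nu (emb x)) &
      @holomorphic R (lieM G) (affM _) (@emb G) /\
      forall x : G, exists F : 'rV[C]_(emb_dim G) -> G,
        @holomorphic_at R (affM _) (lieM G) F (emb x) /\
        \forall z \near emb x, forall y : G, emb y = z -> F z = y].

Definition regular_fun G (f : G -> C) : Prop :=
  exists2 P, polynomial_fun P & forall x, f x = P (emb x).

Definition zariski_closed G (S : set G) : Prop :=
  exists I : set (G -> C), (forall f, I f -> regular_fun f) /\
    S = [set x | forall f, I f -> f x = 0].

Definition is_algebraic_subgroup G (S : set G) : Prop :=
  is_subgroup S /\ zariski_closed S.

Definition rational_representation G m (rho : G -> 'M[C]_m) : Prop :=
  [/\ rho 1%g = 1%:M, (forall x y, rho (x * y)%g = rho x *m rho y) &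
      forall i j, regular_fun (fun x => rho x i j)].

Definition is_unipotent G (u : G) : Prop :=
  forall m (rho : G -> 'M[C]_m), rational_representation rho ->
    exists k : nat, (rho u - 1) ^+ k = 0.

(* Triviality of the unipotent radical. *)
Definition is_reductive G : Prop :=
  forall U : set G, is_algebraic_subgroup U ->
    (forall g u, U u -> U (u ^ g)%g) ->
    @connected (pt (lieM G)) U ->
    (forall u, U u -> is_unipotent u) ->
    U = [set 1%g].

(* (C^* )^k inside C^k, with its regular functions, the polynomials in the
   coordinates and their inverses. *)
Definition Gm k : set 'rV[C]_k := [set z | forall i, z 0 i != 0].
Definition Gm_mul k (z w : 'rV[C]_k) : 'rV[C]_k := \row_i (z 0 i * w 0 i).
Definition Gm_inv k (z : 'rV[C]_k) : 'rV[C]_k := \row_i (z 0 i)^-1.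

Definition is_algebraic_torus G (T : set G) : Prop :=
  is_algebraic_subgroup T /\
  exists k, exists phi : 'rV[C]_k -> G, exists psi : G -> 'rV[C]_k,
    [/\ (forall z, Gm z -> T (phi z) /\ psi (phi z) = z),
        (forall t, T t -> Gm (psi t) /\ phi (psi t) = t),
        (forall z w, Gm z -> Gm w -> phi (Gm_mul z w) = (phi z * phi w)%g),
        (exists2 P, polynomial_map P &
           forall z, Gm z -> emb (phi z) = P (row_mx z (Gm_inv z))) &
        (exists2 Q, polynomial_map Q & forall t, T t -> psi t = Q (emb t))].

End AlgebraicGroups.
Arguments alggroup_data R : clear implicits.

(* The algebraic part of a principal bundle; see [is_holomorphic_principal_bundle]
   for the geometric axioms. *)
Record bundle_data (R : realType) (M : premanifold R) (H : lie_data R) :=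
  BundleData {
    tot :> premanifold R;
    base_proj : tot -> M;
    ract : tot -> H -> tot;
    act1 : forall y, ract y 1%g = y;
    actM : forall y g h, ract y (g * h)%g = ract (ract y g) h }.

Section Bundles.
Context {R : realType}.
Local Notation C := (Cx R).
Context (M : premanifold R).

Section General.
Context (H : lie_data R) (E : bundle_data M H).

Definition is_holomorphic_principal_bundle : Prop :=
  [/\ is_complex_manifold E, holomorphic (@base_proj _ _ _ E),
      @holomorphic _ (prodM E (lieM H)) E (fun p => ract p.1 p.2),
      (forall (y : E) (h : H), base_proj (ract y h) = base_proj y) &
      forall x : M, exists U : set M, [/\ open U, U x &
        exists s : M -> E, exists t : E -> H,
          [/\ (forall x', U x' -> holomorphic_at s x' /\ base_proj (s x') = x'),
              (forall y : E, U (base_proj y) -> @holomorphic_at _ E (lieM H) t y),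
              (forall y : E, U (base_proj y) -> ract (s (base_proj y)) (t y) = y) &
              (forall x' (h : H), U x' -> t (ract (s x') h) = h)]]].

Definition at_rel (yv yv' : tangentM E) : Prop :=
  exists h : H, yv' = mkT (ract yv.1 h) (mdiff (fun y : E => ract y h) yv.1 yv.2).

Definition atiyahM : premanifold R :=
  quotM at_rel (mdim (tangentM E) - lie_dim H).

Definition at_class (y : E) (v : 'rV[C]_(mdim E)) : atiyahM :=
  quot_class at_rel (mkT y v).

Definition at_proj (a : atiyahM) : tangentM M :=
  let yv := quot_repr a in
  mkT (base_proj yv.1) (mdiff (@base_proj _ _ _ E) yv.1 yv.2).

(* For y over x, v |-> [y, v] is an isomorphism from T_y E onto the fiber of
   At(E) over x, which defines the linear structure of that fiber; the second
   clause thus says that D is a homomorphism of vector bundles. *)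
Definition is_complex_connection (D : tangentM M -> atiyahM) : Prop :=
  [/\ smooth D,
      (forall y : E, exists L : {linear 'rV[C]_(mdim M) -> 'rV[C]_(mdim E)},
         forall v, D (mkT (base_proj y) v) = at_class y (L v)) &
      (forall xv, at_proj (D xv) = xv)].

Definition is_holomorphic_connection (D : tangentM M -> atiyahM) : Prop :=
  is_complex_connection D /\ holomorphic D.

Definition horizontal (D : tangentM M -> atiyahM) (y : E) :
    set 'rV[C]_(mdim E) :=
  [set w | D (mkT (base_proj y) (mdiff (@base_proj _ _ _ E) y w)) = at_class y w].

Definition ad_rel (yz yz' : prodM E (lieM H)) : Prop :=
  exists g : H, yz' = (ract yz.1 g, yz.2 ^ g)%g.

(* dim (E x H) - dim H = dim E *)
Definition AdM : premanifold R := quotM ad_rel (mdim E).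

Definition ad_class (y : E) (z : H) : AdM :=
  @quot_class _ (prodM E (lieM H)) ad_rel (y, z).

Definition ad_proj (a : AdM) : M := base_proj (quot_repr a).1.

(* At [y, z], the image of the horizontal space at y under the differential of
   y' |-> [y', z]. *)
Definition induced_ad_connection (D : tangentM M -> atiyahM) (a : AdM) :
    set 'rV[C]_(mdim AdM) :=
  [set u | exists y z, a = ad_class y z /\
     exists2 w, horizontal D y w & u = mdiff (fun y' => ad_class y' z) y w].

End General.

Definition at_map (H H' : lie_data R) (E : bundle_data M H)
    (E' : bundle_data M H') (f : E -> E') (a : atiyahM E) : atiyahM E' :=
  let yv := quot_repr a in at_class (f yv.1) (mdiff f yv.1 yv.2).

Definition preserves (X : premanifold R)
    (D : forall x : X, set 'rV[C]_(mdim X)) (S : set X) : Prop :=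
  forall a : subM S, D (sub_incl a) `<=` sub_tangent a.

Section Reduction.
Context (G : lie_data R) (E : bundle_data M G).
Context (S : set G) (hS : is_subgroup S) (F : set E).
Context (hF : forall (y : E) (n : G), F y -> S n -> F (ract y n)).

Definition red_act (a : subM F) (n : sub_lie hS) : subM F :=
  exist _ (ract (sval a) (sval n)) (hF (svalP a) (svalP n)).

Lemma red_act1 a : red_act a 1%g = a.
Proof. by apply: sval_eq; rewrite /= act1. Qed.
Lemma red_actM a g h : red_act a (g * h)%g = red_act (red_act a g) h.
Proof. by apply: sval_eq; rewrite /= actM. Qed.

Definition reduction : bundle_data M (sub_lie hS) :=
  @BundleData R M (sub_lie hS) (subM F) (fun a => base_proj (sval a)) red_act
    red_act1 red_actM.

Definition is_holomorphic_reduction : Prop :=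
  is_complex_lie_group (sub_lie hS) /\ is_holomorphic_principal_bundle reduction.

Definition red_incl : reduction -> E := fun a => sval a.

End Reduction.

Section TorusSubbundles.
Context (G : alggroup_data R) (E : bundle_data M G).
Context (TT : set (AdM E)) (T : set G).

Definition is_torus_subbundle : Prop :=
  [/\ is_submanifold TT,
      is_fiber_bundle (fun a : subM TT => ad_proj (sub_incl a)),
      (forall (y : E) z, Z0 G z -> TT (ad_class y z)) &
      (forall y : E, is_algebraic_torus [set z | TT (ad_class y z)])].

Definition fibers_conjugate_to : Prop :=
  forall y : E, exists g : G,
    [set z | TT (ad_class y z)] = [set (t ^ g)%g | t in T].

Definition EN_set : set E := [set y | forall t, T t -> TT (ad_class y t)].

Lemma ad_class_act (y : E) (g z : G) :
  ad_class (ract y g) z = ad_class y (g * z * g^-1)%g.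
Proof.
apply: sval_eq; apply/seteqP; split=> -[y' z'] [h [-> ->]] /=.
  exists (g * h)%g; congr (_, _); first by rewrite actM.
  by rewrite /conjg invgM !mulgA mulgVK mulgVK.
exists (g^-1 * h)%g; congr (_, _).
  by rewrite -actM mulgA mulgV mul1g.
by rewrite /conjg invgM invgK !mulgA.
Qed.

Lemma EN_act (y : E) (n : G) : EN_set y -> group_normalizer T n -> EN_set (ract y n).
Proof. by move=> hy hn t /hn Tt; rewrite ad_class_act; apply: hy. Qed.

Definition EN : bundle_data M (sub_lie (group_normalizer_subgroup T)) :=
  reduction (group_normalizer_subgroup T) EN_act.

Definition EN_incl : EN -> E := @red_incl _ E _ _ _ EN_act.

End TorusSubbundles.
End Bundles.

(* Main.v *)
Require Import Defs.
From HB Require Import structures.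
From mathcomp Require Import all_boot all_order all_algebra.
From mathcomp Require Import separable cyclotomic complex ring lra zify.
From mathcomp Require Import all_classical all_reals all_analysis.
Import numFieldNormedType.Exports.

Set Implicit Arguments.
Unset Strict Implicit.
Unset Printing Implicit Defensive.

Import Order.TTheory GRing.Theory Num.Theory.
Local Open Scope classical_set_scope.
Local Open Scope ring_scope.

(* A vector w at a point y of E_N is tangent to E_N iff its vertical part theta
   with respect to a local section of E_N through y lies in Lie N.  Moving [y, a],
   a in T, along w moves it in Ad(E_G) by theta - Ad(a) theta relative to the
   section, along which the fibers of TT are constant and equal to T.  If D_1
   preserves TT, the horizontal w thus satisfies theta - Ad(a) theta in Lie N for
   all a in T.  Averaging over a finite subgroup A of T reduces to the case of
   an Ad(A)-fixed theta.  Linearizing the conjugation action of A at 1, such a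
   theta is tangent to the centralizer of A, which is the centralizer of T
   when A is large enough because points of finite order are Zariski dense in T;
   hence theta lies in Lie N.  Conversely, moving y inside E_N moves [y, a] inside
   TT, for a in T.

   The map At(E_N) -> At(E_G) has a local holomorphic left inverse, so the
   connection on E_N is smooth, resp. holomorphic, iff the one on E_G is.

   Holomorphy being complex differentiability near a point, the differentials of
   holomorphic maps depend holomorphically on the point by Goursat's lemma
   and Cauchy's estimates. *)

(** * Norms and differentials over the complex numbers *)

Section RealNorm.
Context {R : realType}.
Local Notation C := (Cx R).

(** The hypothesis on [TT] sees theta only through theta - Ad(a) theta, so the part of theta fixed
    by T is invisible to it and has to be caught by the centralizer. Lie N is present only as
    [sub_tangent e1], the tangent space at 1 of the submanifold N. The passage from a fixed vector
    to the centralizer is made with points of the group: fixed points of conjugation are produced in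
    the direction of the vector, and a local retraction onto N turns them into tangency. One finite
    subgroup has to serve all these points at once; this is possible because ga = ag is a polynomial
    condition on a with g as parameter, and its degree, which governs the order of the roots of
    unity required, does not depend on g. A point of E_N is defined by T being contained in the
    fiber of [TT], whereas the argument needs equality; density of the torsion points settles this
    too. The dimensions of At(E) and Ad(E) are fixed in advance from [mdim E], so charts of these
    quotients can be exhibited only once [mdim E] is known to be dim M + dim G. *)

Definition nr {V : normedModType C} (v : V) : R := complex.Re (`|v| : R[i]).

Section Mod.
Context {V : normedModType C}.
Implicit Types v w : V.

(** A norm over [Cx R] takes values in [Cx R], whose order is partial; nonnegativity kills the
    imaginary part, so [nr] loses nothing and estimates can be made in the ordered field [R]. *)
Lemma nrE v : `|v| = CofR (nr v).
Proof.
have := normr_ge0 v; rewrite /nr; case: (`|v| : R[i]) => a b.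
by rewrite lecE /= => /andP[/eqP -> _].
Qed.

Lemma nr_ge0 v : 0 <= nr v.
Proof. by have := normr_ge0 v; rewrite nrE /CofR ler0c. Qed.

Lemma CofR_le (a b : R) : (CofR a <= CofR b :> C) = (a <= b).
Proof. exact: lecR. Qed.

Lemma CofR_lt (a b : R) : (CofR a < CofR b :> C) = (a < b).
Proof. exact: ltcR. Qed.

Lemma CofRD (a b : R) : CofR (a + b) = CofR a + CofR b :> C.
Proof. exact: rmorphD. Qed.

Lemma CofRB (a b : R) : CofR (a - b) = CofR a - CofR b :> C.
Proof. exact: rmorphB. Qed.

Lemma CofRM (a b : R) : CofR (a * b) = CofR a * CofR b :> C.
Proof. exact: rmorphM. Qed.

Lemma CofRV (a : R) : CofR a^-1 = (CofR a)^-1 :> C.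
Proof. exact: fmorphV. Qed.

Lemma CofR_inj : injective (@CofR R).
Proof. exact: complexI. Qed.

Lemma CofR0 : CofR 0 = 0 :> C. Proof. by []. Qed.
Lemma CofR1 : CofR 1 = 1 :> C. Proof. by []. Qed.

Lemma nr0 : nr (0 : V) = 0.
Proof. by rewrite /nr normr0. Qed.

Lemma nrN v : nr (- v) = nr v.
Proof. by rewrite /nr normrN. Qed.

Lemma nrBC v w : nr (v - w) = nr (w - v).
Proof. by rewrite /nr distrC. Qed.

Lemma nrD v w : nr (v + w) <= nr v + nr w.
Proof. by rewrite -CofR_le CofRD -!nrE ler_normD. Qed.

Lemma nrB v w : nr (v - w) <= nr v + nr w.
Proof. by rewrite -(nrN w) nrD. Qed.

Lemma nr_eq0 v : nr v = 0 -> v = 0.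
Proof. by move=> v0; apply: normr0_eq0; rewrite nrE v0. Qed.

Lemma nr_gt0 v : v != 0 -> 0 < nr v.
Proof.
move=> v0; rewrite lt_def nr_ge0 andbT; apply: contra v0 => /eqP /nr_eq0 ->.
exact: eqxx.
Qed.

End Mod.

Lemma nrZ (V : normedModType C) (a : C) (v : V) : nr (a *: v) = nr a * nr v.
Proof. by apply: CofR_inj; rewrite CofRM -!nrE normrZ. Qed.

Lemma nrM (a b : C) : nr (a * b) = nr a * nr b.
Proof. exact: (@nrZ C^o). Qed.

Lemma nrV (a : C) : nr a^-1 = (nr a)^-1.
Proof. by apply: CofR_inj; rewrite CofRV -!nrE normfV. Qed.

Lemma nrR (a : R) : nr (CofR a) = `|a|.
Proof.
apply: CofR_inj; rewrite -nrE.
by have -> : `|CofR a| = `|(a%:C)%C : R[i]| by []; rewrite normc_def /= expr0n addr0 sqrtr_sqr.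
Qed.

Definition mkC (a b : R) : C := (a +i* b)%C.

Lemma mkCE a b : mkC a b = CofR a + mkC 0 1 * CofR b.
Proof. by rewrite /mkC /CofR; simpc. Qed.

Lemma mkC_ReIm (z : C) : z = mkC (complex.Re (z : R[i])) (complex.Im (z : R[i])).
Proof. by case: z. Qed.

Lemma nr_mkC a b : nr (mkC a b) = Num.sqrt (a ^+ 2 + b ^+ 2).
Proof.
apply: CofR_inj; rewrite -nrE.
by have -> : `|mkC a b| = `|(a +i* b)%C : R[i]| by []; rewrite normc_def.
Qed.

Lemma nr_i : nr (mkC 0 1) = 1.
Proof. by rewrite nr_mkC expr0n expr1n add0r sqrtr1. Qed.

Lemma nr_mkC_le a b : nr (mkC a b) <= `|a| + `|b|.
Proof. by rewrite mkCE (le_trans (nrD _ _)) // nrM !nrR nr_i mul1r. Qed.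

Lemma Re_le_nr (z : C) : `|complex.Re (z : R[i])| <= nr z.
Proof. by rewrite [z in leRHS]mkC_ReIm nr_mkC -sqrtr_sqr ler_wsqrtr // lerDl sqr_ge0. Qed.

Lemma Im_le_nr (z : C) : `|complex.Im (z : R[i])| <= nr z.
Proof. by rewrite [z in leRHS]mkC_ReIm nr_mkC -sqrtr_sqr ler_wsqrtr // lerDr sqr_ge0. Qed.

(** This is how exact identities (Goursat, mean values on circles, fixed vectors) are extracted from
    estimates whose relative error is arbitrarily small. *)
Lemma nr_le_eps0 (V : normedModType C) (v : V) (K : R) :
  (forall e : R, 0 < e -> nr v <= e * K) -> v = 0.
Proof.
move=> h; apply: nr_eq0; apply/eqP; rewrite eq_le nr_ge0 andbT.
have K0 : 0 <= K by have := le_trans (nr_ge0 v) (h 1 ltr01); rewrite mul1r.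
apply/ler_addgt0Pr => e e0; rewrite add0r.
have k1 : 0 < K + 1 by rewrite ltr_wpDl.
apply: le_trans (h (e / (K + 1)) (divr_gt0 e0 k1)) _.
by rewrite -mulrA ger_pMr // ler_pdivrMl // mulr1 lerDl.
Qed.

Lemma nbhs_nrP (V : normedModType C) (x : V) (P : set V) :
  nbhs x P <-> exists2 d : R, 0 < d & forall y, nr (y - x) < d -> P y.
Proof.
split=> [/nbhs_ballP [e /= e0 he]|[d d0 hd]].
  exists (complex.Re (e : R[i])).
    by move: e0; case: (e : R[i]) => a b; rewrite ltcE /= => /andP[].
  move=> y hy; apply: he; rewrite -ball_normE /= distrC nrE.
  move: e0 hy; case: (e : R[i]) => a b; rewrite ltcE /= => /andP[/eqP -> _].
  by rewrite -CofR_lt.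
apply/nbhs_ballP; exists (CofR d) => /=; first by rewrite -CofR0 CofR_lt.
by move=> y; rewrite -ball_normE /= distrC nrE CofR_lt => /hd.
Qed.

Lemma continuous_nrP (V W : normedModType C) (f : V -> W) (x : V) :
  {for x, continuous f} <-> forall e : R, 0 < e ->
    exists2 d : R, 0 < d & forall y, nr (y - x) < d -> nr (f y - f x) < e.
Proof.
split=> [cf e e0|h].
  have : nbhs (f x) [set z | nr (z - f x) < e] by apply/nbhs_nrP; exists e.
  by move=> /cf /nbhs_nrP.
by move=> P /nbhs_nrP [e e0 he]; apply/nbhs_nrP; have [d d0 hd] := h e e0;
  exists d => // y /hd /he.
Qed.

(** Frechet differentiability with real epsilons. [L] is a bare function: linearity and continuity
    are supplied when going back to [differentiable]. *)
Definition has_diff (V W : normedModType C) (f : V -> W) (x : V) (L : V -> W) :=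
  forall e : R, 0 < e -> exists2 d : R, 0 < d &
    forall h, nr h < d -> nr (f (x + h) - f x - L h) <= e * nr h.

Lemma littleo_nrP (V W : normedModType C) (f : V -> W) :
  (forall eps : C, 0 < eps -> \forall h \near (0 : V), `|f h| <= eps * `|h|) <->
  forall e : R, 0 < e -> exists2 d : R, 0 < d &
    forall h, nr h < d -> nr (f h) <= e * nr h.
Proof.
split=> [ho e e0|ho e e0].
  have /ho /nbhs_nrP [d d0 hd] : 0 < CofR e :> C by rewrite -CofR0 CofR_lt.
  exists d => // h hh; have /= := hd h; rewrite subr0 => /(_ hh).
  by rewrite !nrE -CofRM CofR_le.
have [e' e'0 ->] : exists2 e' : R, 0 < e' & e = CofR e'.
  move: e0; case: (e : R[i]) => a b; rewrite ltcE /= => /andP[/eqP -> a0].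
  by exists a.
have [d d0 hd] := ho e' e'0; apply/nbhs_nrP; exists d => // h.
by rewrite subr0 => /hd /=; rewrite !nrE -CofRM CofR_le.
Qed.

Lemma diff_has_diff (V W : normedModType C) (f : V -> W) x :
  differentiable f x -> has_diff f x ('d f x).
Proof.
move=> /diff_locally /eqaddoP /littleo_nrP h e /h [d d0 hd]; exists d => // k /hd.
by rewrite !fctE /= opprD addrA [x + k]addrC.
Qed.

Lemma has_diff_diff (V W : normedModType C) (f : V -> W) x (L : {linear V -> W}) :
  continuous L -> has_diff f x L ->
  differentiable f x /\ forall v, 'd f x v = L v.
Proof.
move=> cL hL.
have E : f \o shift x = cst (f x) + L +o_ 0 id.
  apply/eqaddoP/littleo_nrP => e /hL [d d0 hd]; exists d => // k /hd.
  by rewrite !fctE /= opprD addrA [x + k]addrC.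
have Ed := diff_unique cL E.
by split=> [|v]; [apply/diff_locallyP; rewrite Ed | rewrite Ed].
Qed.

(** The norm of a row vector is the largest modulus of its entries; [0 <= K] covers the case
    [n = 0], where there is no entry to bound. *)
Lemma nr_rV n (v : 'rV[C]_n) (K : R) : 0 <= K ->
  (nr v <= K) <-> (forall j, nr (v 0 j) <= K).
Proof.
move=> K0; rewrite -CofR_le -nrE; split=> h.
  move=> j; rewrite -CofR_le -nrE (le_trans _ h) //.
  rewrite [leRHS]/Num.Def.normr /= mx_normE.
  have -> : `|v 0 j| = (NngNum (normr_ge0 (v 0 j)))%:num by [].
  by rewrite num_le; apply/bigmax_geP; right; exists (0, j) => //; rewrite -num_le.
rewrite [leLHS]/Num.Def.normr /= mx_normE.
have K0' : 0 <= CofR K :> C by rewrite -CofR0 CofR_le.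
rewrite -[leRHS]/((NngNum K0')%:num) num_le; apply/bigmax_leP; split => //= ij _.
by rewrite -num_le /= nrE CofR_le ord1.
Qed.

Lemma nr_coord n (v : 'rV[C]_n) j : nr (v 0 j) <= nr v.
Proof. by move: j; apply/(nr_rV v (nr_ge0 v)). Qed.

Lemma nr_sum (V : normedModType C) (I : Type) (r : seq I) (F : I -> V) :
  nr (\sum_(i <- r) F i) <= \sum_(i <- r) nr (F i).
Proof.
elim: r => [|i r IH]; first by rewrite !big_nil nr0.
by rewrite !big_cons (le_trans (nrD _ _)) // lerD2l.
Qed.

Lemma linear_rV_bounded n (W : normedModType C) (L : {linear 'rV[C]_n -> W}) :
  exists2 K : R, 0 < K & forall v, nr (L v) <= K * nr v.
Proof.
(* The summand 1 keeps the bound positive when [L] is zero. *)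
exists (1 + \sum_i nr (L (delta_mx 0 i))).
  by rewrite ltr_pwDl // sumr_ge0 // => i _; exact: nr_ge0.
move=> v; rewrite [v in nr (L v)]row_sum_delta linear_sum.
apply: le_trans (nr_sum _ _) _; rewrite mulrDl mul1r mulr_suml.
apply: ler_wpDl; first exact: nr_ge0.
apply: ler_sum => i _; rewrite linearZ /= nrZ mulrC ler_wpM2l ?nr_ge0 //.
exact: nr_coord.
Qed.

Lemma bounded_linear_continuous (V W : normedModType C) (L : {linear V -> W}) K :
  0 < K -> (forall v, nr (L v) <= K * nr v) -> continuous L.
Proof.
move=> K0 hK v; apply/continuous_nrP => e e0; exists (e / K).
  exact: divr_gt0.
by move=> y; rewrite ltr_pdivlMr // mulrC -linearB; exact: le_lt_trans.
Qed.

Lemma linear_rV_continuous n (W : normedModType C) (L : {linear 'rV[C]_n -> W}) :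
  continuous L.
Proof. by have [K K0 /(bounded_linear_continuous K0)] := linear_rV_bounded L. Qed.

Definition linear_pack (V W : lmodType C) (f : V -> W) (hf : linear f) :
  {linear V -> W} := HB.pack f (GRing.isLinear.Build _ _ _ _ f hf).

Lemma has_diff_rV n (W : normedModType C) (f L : 'rV[C]_n -> W) x :
  linear L -> has_diff f x L ->
  differentiable f x /\ forall v, 'd f x v = L v.
Proof.
move=> lL hL.
exact: (@has_diff_diff _ _ f x (linear_pack lL) (@linear_rV_continuous _ _ (linear_pack lL)) hL).
Qed.

End RealNorm.

(** * Goursat's lemma and Cauchy's estimates *)

Section Cousin.
Context {R : realType}.

(** Bisection form of compactness: if [P] failed on the whole rectangle, it would fail on some
    quarter, and so on; the nested failing rectangles shrink to a point, where the local hypothesis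
    contradicts them. It serves for Goursat's lemma and, with the second interval reduced to a
    point, for the mean value inequality. *)
Lemma cousin_rectangle (P : R -> R -> R -> R -> Prop) (a b c d : R) :
  a <= b -> c <= d ->
  (forall x1 x2 y1 y2, x1 <= x2 -> y1 <= y2 ->
    P x1 ((x1 + x2) / 2) y1 ((y1 + y2) / 2) ->
    P ((x1 + x2) / 2) x2 y1 ((y1 + y2) / 2) ->
    P x1 ((x1 + x2) / 2) ((y1 + y2) / 2) y2 ->
    P ((x1 + x2) / 2) x2 ((y1 + y2) / 2) y2 -> P x1 x2 y1 y2) ->
  (forall x y, a <= x <= b -> c <= y <= d -> exists2 e : R, 0 < e &
    forall x1 x2 y1 y2, a <= x1 -> x1 <= x <= x2 -> x2 <= b ->
      c <= y1 -> y1 <= y <= y2 -> y2 <= d ->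
      x2 - x1 < e -> y2 - y1 < e -> P x1 x2 y1 y2) ->
  P a b c d.
Proof.
move=> ab cd quarter loc; apply: contrapT => nP.
pose W n := (b - a) / 2 ^+ n; pose H n := (d - c) / 2 ^+ n.
have W0 n : 0 <= W n by rewrite divr_ge0 // ?subr_ge0 // exprn_ge0.
have H0 n : 0 <= H n by rewrite divr_ge0 // ?subr_ge0 // exprn_ge0.
have WS n : W n = W n.+1 + W n.+1.
  by rewrite /W exprS invfM mulrA; field; rewrite expf_neq0.
have HS n : H n = H n.+1 + H n.+1.
  by rewrite /H exprS invfM mulrA; field; rewrite expf_neq0.
pose good n (q : R * R) := ~ P q.1 (q.1 + W n) q.2 (q.2 + H n).
pose inside n (q q' : R * R) := [/\ q.1 <= q'.1, q'.1 + W n.+1 <= q.1 + W n,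
  q.2 <= q'.2 & q'.2 + H n.+1 <= q.2 + H n].
(* A total choice function for the lower left corner of the next failing quarter; when the current
   rectangle does not fail, the same corner serves as default value. *)
have /choice[F hF] : forall nq : nat * (R * R), exists q',
    good nq.1 nq.2 -> inside nq.1 nq.2 q' /\ good nq.1.+1 q'.
  move=> [n [x y]] /=; have [g|] := pselect (good n (x, y)); last first.
    by move=> h; exists (x, y).
  suff [q' [h1 h2]] : exists q', inside n (x, y) q' /\ good n.+1 q' by exists q'.
  apply: contrapT => no.
  have mx : (x + (x + W n)) / 2 = x + W n.+1 by rewrite WS; field.
  have my : (y + (y + H n)) / 2 = y + H n.+1 by rewrite HS; field.
  have w := W0 n.+1; have h := H0 n.+1; have ws := WS n; have hs := HS n.
  have ex : x + W n = x + W n.+1 + W n.+1 by rewrite ws addrA.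
  have ey : y + H n = y + H n.+1 + H n.+1 by rewrite hs addrA.
  have all q' : inside n (x, y) q' -> P q'.1 (q'.1 + W n.+1) q'.2 (q'.2 + H n.+1).
    by move=> h1; apply: contrapT => h2; apply: no; exists q'.
  apply: g => /=; apply: quarter; rewrite ?lerDl ?mx ?my //.
  - by apply: (all (x, y)); split=> /=; lra.
  - by rewrite ex; apply: (all (x + W n.+1, y)); split=> /=; lra.
  - by rewrite ey; apply: (all (x, y + H n.+1)); split=> /=; lra.
  - by rewrite ex ey; apply: (all (x + W n.+1, y + H n.+1)); split=> /=; lra.
pose s := fix s n := if n is n'.+1 then F (n', s n') else (a, c).
have W00 : W 0 = b - a by rewrite /W expr0 divr1.
have H00 : H 0 = d - c by rewrite /H expr0 divr1.
have gs n : good n (s n).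
  elim: n => [|n IH]; last by have [] := hF (n, s n) IH.
  by rewrite /good /= W00 H00 !subrKC.
have ins n : inside n (s n) (s n.+1) by have [] := hF (n, s n) (gs n).
have mono n k : [/\ (s n).1 <= (s (n + k)%N).1, (s (n + k)%N).1 + W (n + k)%N <= (s n).1 + W n,
   (s n).2 <= (s (n + k)%N).2 & (s (n + k)%N).2 + H (n + k)%N <= (s n).2 + H n].
  elim: k => [|k [h1 h2 h3 h4]]; first by rewrite addn0.
  by rewrite addnS; have [g1 g2 g3 g4] := ins (n + k)%N; split; lra.
have cross1 n m : (s n).1 <= (s m).1 + W m.
  have [h _ _ _] := mono n m; have [_ h' _ _] := mono m n.
  by move: h'; rewrite addnC; have := W0 (n + m)%N; lra.
have cross2 n m : (s n).2 <= (s m).2 + H m.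
  have [_ _ h _] := mono n m; have [_ _ _ h'] := mono m n.
  by move: h'; rewrite addnC; have := H0 (n + m)%N; lra.
(* Every left end is below every right end, so the supremum of the left ends lies in all the
   intervals. *)
have limit (t V : nat -> R) : (forall n m, t n <= t m + V m) ->
    exists z, forall n, t n <= z <= t n + V n.
  move=> h; exists (sup (range t)) => n.
  have hs : has_sup (range t).
    by split; [exists (t 0); exists 0 | exists (t 0 + V 0) => _ [k _ <-]].
  apply/andP; split; first by apply: sup_upper_bound => //; exists n.
  by apply: ge_sup => [|_ [k _ <-]]; [exists (t 0); exists 0 | exact: h].
have [x hx] := limit (fun n => (s n).1) W cross1.
have [y hy] := limit (fun n => (s n).2) H cross2.
have [e e0 he] : exists2 e : R, 0 < e & forall x1 x2 y1 y2, a <= x1 -> x1 <= x <= x2 -> x2 <= b ->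
      c <= y1 -> y1 <= y <= y2 -> y2 <= d -> x2 - x1 < e -> y2 - y1 < e -> P x1 x2 y1 y2.
  apply: loc; first by have /= := hx 0; rewrite W00 subrKC.
  by have /= := hy 0; rewrite H00 subrKC.
have [n [hn1 hn2]] : exists n, W n < e /\ H n < e.
  pose D := (b - a) + (d - c) + 1.
  have D0 : 0 < D by rewrite /D; lra.
  have [n hn] : exists n : nat, D / e < n%:R.
    by exists (Num.truncn (D / e)).+1; exact: truncnS_gt.
  have n2 : n%:R < 2 ^+ n :> R by rewrite -natrX ltr_nat ltn_expl.
  have De : D < e * 2 ^+ n.
    by rewrite mulrC -ltr_pdivrMr // (lt_trans hn).
  have p0 : 0 < 2 ^+ n :> R by rewrite exprn_gt0.
  by exists n; split; rewrite ltr_pdivrMr //; apply: le_lt_trans De; rewrite /D; lra.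
have [m1 m2 m3 m4] := mono 0 n; rewrite add0n /= W00 H00 !subrKC in m1 m2 m3 m4.
by apply: (gs n); apply: he => //; rewrite ?hx ?hy // addrC addKr.
Qed.

End Cousin.

(** * Functions of a real variable and their primitives *)

Section RealDerivative.
Context {R : realType}.
Local Notation C := (Cx R).

Definition rder (W : normedModType C) (u : R -> W) (t : R) (l : W) :=
  forall e : R, 0 < e -> exists2 d : R, 0 < d &
    forall s, `|s - t| < d -> nr (u s - u t - CofR (s - t) *: l) <= e * `|s - t|.

(** Increments add up under bisection, so the bound [M + e] follows from its local form around each
    point; the loss [e] is removed at the end. *)
Lemma mean_value_bound (W : normedModType C) (u : R -> W) (a b M : R) :
  a <= b -> (forall t, a <= t <= b -> exists2 l, rder u t l & nr l <= M) ->
  nr (u b - u a) <= M * (b - a).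
Proof.
move=> ab hu; apply/ler_addgt0Pr => e' e'0.
pose e := e' / (b - a + 1).
have ba1 : 0 < b - a + 1 by lra.
have e0 : 0 < e by rewrite divr_gt0.
suff h : nr (u b - u a) <= (M + e) * (b - a).
  apply: le_trans h _; rewrite mulrDl lerD2l /e -mulrA ger_pMr // ler_pdivrMl //.
  by rewrite mulr1; lra.
apply: (@cousin_rectangle R (fun x1 x2 _ _ => nr (u x2 - u x1) <= (M + e) * (x2 - x1)) a b 0 0) => //.
  move=> x1 x2 _ _ _ _ h1 h2 _ _; set m := (x1 + x2) / 2 in h1 h2.
  rewrite -(subrK (u m) (u x2)) -addrA (le_trans (nrD _ _)) //.
  by rewrite (le_trans (lerD h2 h1)) // -mulrDr addrA subrK.
move=> t y ht _; have [l hl lM] := hu t ht.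
have [d d0 hd] := hl e e0; exists d => // x1 x2 _ _ _ /andP[h1 h2] _ _ _ _ hx _.
(* Both ends are compared with the point [t] between them: the two errors are at most [e] times the
   distances to [t], which add up to [x2 - x1]. *)
have -> : u x2 - u x1 = (u x2 - u t - CofR (x2 - t) *: l) -
    (u x1 - u t - CofR (x1 - t) *: l) + CofR (x2 - x1) *: l.
  have -> : CofR (x2 - x1) = CofR (x2 - t) - CofR (x1 - t) :> C.
    by rewrite -CofRB; congr CofR; ring.
  rewrite scalerBl; set A := CofR _ *: l; set B := CofR _ *: l.
  rewrite opprD opprK [X in X + (A - B)]addrACA.
  by rewrite [- A + B]addrC -(opprB A B) subrK opprB addrA subrK.
rewrite (le_trans (nrD _ _)) // mulrDl addrC lerD //.
  rewrite nrZ nrR ger0_norm; last by lra.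
  by rewrite mulrC ler_wpM2r //; lra.
rewrite (le_trans (nrB _ _)) //.
have k1 : `|x2 - t| < d by rewrite ger0_norm; lra.
have k2 : `|x1 - t| < d by rewrite ler0_norm; lra.
apply: le_trans (lerD (hd _ k1) (hd _ k2)) _.
by rewrite ger0_norm ?ler0_norm -?mulrDr; try lra.
Qed.

Lemma rderD (W : normedModType C) (u v : R -> W) t l m :
  rder u t l -> rder v t m -> rder (fun s => u s + v s) t (l + m).
Proof.
move=> hu hv e e0; have e2 : 0 < e / 2 by lra.
have [d1 d10 h1] := hu _ e2; have [d2 d20 h2] := hv _ e2.
exists (Num.min d1 d2); first by rewrite lt_min d10.
move=> s; rewrite lt_min => /andP[/h1 k1 /h2 k2].
have -> : u s + v s - (u t + v t) = (u s - u t) + (v s - v t).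
  by rewrite opprD addrACA.
rewrite scalerDr opprD addrACA (le_trans (nrD _ _)) //.
by apply: le_trans (lerD k1 k2) _; rewrite -mulrDl -splitr.
Qed.

Lemma rderZ (W : normedModType C) (c : C) (u : R -> W) t l :
  rder u t l -> rder (fun s => c *: u s) t (c *: l).
Proof.
move=> hu e e0; have c0 : 0 < nr c + 1 by rewrite ltr_wpDl // nr_ge0.
have [d d0 h] := hu _ (divr_gt0 e0 c0); exists d => // s /h k.
rewrite scalerA mulrC -scalerA -!scalerBr nrZ.
apply: le_trans (ler_wpM2l (nr_ge0 c) k) _.
rewrite mulrA ler_wpM2r // mulrCA ger_pMr // ler_pdivrMr // mul1r.
by rewrite lerDl.
Qed.

Lemma rderN (W : normedModType C) (u : R -> W) t l :
  rder u t l -> rder (fun s => - u s) t (- l).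
Proof.
move=> hu e /hu [d d0 h]; exists d => // s /h.
by rewrite scalerN -!opprD nrN.
Qed.

Lemma rderB (W : normedModType C) (u v : R -> W) t l m :
  rder u t l -> rder v t m -> rder (fun s => u s - v s) t (l - m).
Proof. by move=> hu /rderN; exact: rderD. Qed.

Lemma rder_id t : rder (fun s => CofR s : C) t 1.
Proof.
move=> e e0; exists 1 => // s _.
have -> : CofR (s - t) *: (1 : C) = CofR s - CofR t by rewrite CofRB [_ *: _]mulr1.
by rewrite subrr nr0 mulr_ge0 // ltW.
Qed.

(** Integrals are represented below by increments of primitives; this makes them independent of the
    primitive. *)
Lemma rder_unique_increment (W : normedModType C) (u v : R -> W) (f : R -> W) a b :
  a <= b -> (forall t, a <= t <= b -> rder u t (f t)) ->
  (forall t, a <= t <= b -> rder v t (f t)) -> u b - u a = v b - v a.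
Proof.
move=> ab hu hv; apply/eqP; rewrite -subr_eq0; apply/eqP/nr_eq0/eqP.
rewrite eq_le nr_ge0 andbT -(mul0r (b - a)).
have -> : u b - u a - (v b - v a) = (u b - v b) - (u a - v a).
  by rewrite !opprD !opprK addrACA.
apply: (@mean_value_bound W (fun s => u s - v s) a b 0 ab) => t ht.
exists 0; last by rewrite nr0.
by rewrite -(subrr (f t)); apply: rderB; [exact: hu | exact: hv].
Qed.

Lemma primitive_real (v : R -> R) (a : R) : continuous v -> exists V : R -> R,
  forall t, a <= t -> derivable V t 1 /\ derive1 V t = v t.
Proof.
(* Integration starts at [a - 1] so that [a] is an interior point and has a two-sided derivative. *)
move=> cv; exists (fun x => \int[lebesgue_measure]_(t in `[a - 1, x]) (v t)).
move=> t at_.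
apply: (@continuous_FTC1_closed R v (a - 1) t (t + 1)).
- by rewrite ltrDl.
- apply: continuous_compact_integrable; first exact: segment_compact.
  exact: continuous_subspaceT.
- by lra.
- exact: cv.
Qed.

Lemma derivable_eps (U : R -> R) t : derivable U t 1 ->
  forall e : R, 0 < e -> exists2 d : R, 0 < d &
    forall s, `|s - t| < d -> `|U s - U t - (s - t) * derive1 U t| <= e * `|s - t|.
Proof.
move=> dU e e0; have dU' : differentiable U t by apply/derivable1_diffP.
have /eqaddoP /(_ _ e0) /nbhs_ballP [d d0 hd] := diff_locally dU'.
exists d => // s hs; have := hd (s - t).
rewrite /ball /= sub0r normrN => /(_ hs).
by rewrite !fctE /= subrK opprD addrA (deriv1E dU).
Qed.

Lemma rder_of_derivable (V W : R -> R) t : derivable V t 1 -> derivable W t 1 ->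
  rder (fun s => mkC (V s) (W s) : C) t (mkC (derive1 V t) (derive1 W t)).
Proof.
move=> dV dW e e0; have e2 : 0 < e / 2 by lra.
have [d1 d10 h1] := derivable_eps dV e2; have [d2 d20 h2] := derivable_eps dW e2.
exists (Num.min d1 d2); first by rewrite lt_min d10.
move=> s; rewrite lt_min => /andP[/h1 k1 /h2 k2].
have -> : mkC (V s) (W s) - mkC (V t) (W t) - CofR (s - t) *: (mkC (derive1 V t) (derive1 W t) : C) =
    mkC (V s - V t - (s - t) * derive1 V t) (W s - W t - (s - t) * derive1 W t).
  by rewrite /mkC /CofR [_ *: _]/(_ * _); simpc.
apply: le_trans (nr_mkC_le _ _) _; apply: le_trans (lerD k1 k2) _.
by rewrite -mulrDl -splitr.
Qed.

Lemma primitive_exists (u : R -> C) (a b : R) : a <= b ->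
  (forall t, a <= t <= b -> forall e : R, 0 < e -> exists2 d : R, 0 < d &
     forall s, `|s - t| < d -> nr (u s - u t) <= e) ->
  exists U : R -> C, forall t, a <= t <= b -> rder U t (u t).
Proof.
(* Clamping to [a, b] extends [u] continuously to the whole line; real and imaginary parts are then
   integrated separately. *)
move=> ab cu; pose k t := Num.max a (Num.min b t).
have kin t : a <= k t <= b by rewrite le_max lexx ge_max ab ge_min lexx.
have k_lip s t : `|k s - k t| <= `|s - t|.
  rewrite /k ler_norml /Num.max /Num.min; have := ler_norm (s - t); have := ler_norm (t - s).
  by rewrite (distrC t s); do ![case: ifP => //]; lra.
have kid t : a <= t <= b -> k t = t.
  by move=> /andP[h1 h2]; rewrite /k min_r // max_r.
have cont (f : C -> R) : (forall z w, `|f z - f w| <= nr (z - w)) -> continuous (f \o u \o k).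
  move=> hf t; apply/cvgrPdist_le => e e0.
  have [d d0 hd] := cu (k t) (kin t) e e0.
  apply/nbhs_ballP; exists d => //= s; rewrite /ball /= => hs.
  apply: le_trans (hf _ _) _; rewrite nrBC; apply: hd.
  by apply: le_lt_trans (k_lip _ _) _; rewrite distrC.
have cRe : continuous ((fun z : C => complex.Re (z : R[i])) \o u \o k).
  by apply: cont => z w; rewrite -raddfB; exact: Re_le_nr.
have cIm : continuous ((fun z : C => complex.Im (z : R[i])) \o u \o k).
  by apply: cont => z w; rewrite -raddfB; exact: Im_le_nr.
have [V hV] := primitive_real a cRe.
have [W hW] := primitive_real a cIm.
exists (fun s => mkC (V s) (W s)) => t /[dup] ht /andP[at_ _].
have [dV eV] := hV _ at_; have [dW eW] := hW _ at_.
have := rder_of_derivable dV dW; rewrite eV eW /= (kid _ ht).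
by rewrite -mkC_ReIm.
Qed.

End RealDerivative.

(** * Goursat's lemma on rectangles, and logarithmic polar coordinates *)

Section Goursat.
Context {R : realType}.
Local Notation C := (Cx R).
Local Notation I := (mkC 0 1 : C).

Lemma rder_half_square (x t : R) : rder (fun s => CofR ((s - x) ^+ 2 / 2) : C) t (CofR (t - x)).
Proof.
move=> e e0; exists e => // s hs.
have -> : CofR ((s - x) ^+ 2 / 2) - CofR ((t - x) ^+ 2 / 2) - CofR (s - t) *: CofR (t - x)
    = CofR ((s - t) ^+ 2 / 2) :> C.
  have -> : CofR (s - t) *: (CofR (t - x) : C) = CofR ((s - t) * (t - x)) by rewrite CofRM.
  by rewrite -!CofRB; congr CofR; field.
rewrite nrR normrM normrX expr2 (ger0_norm (_ : 0 <= 2^-1)) ?invr_ge0 //.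
rewrite -mulrA mulrC ler_wpM2r //; have := normr_ge0 (s - t); lra.
Qed.

Lemma rderM (c : C) (u : R -> C) t l : rder u t l -> rder (fun s => c * u s) t (c * l).
Proof. exact: (@rderZ R C c u). Qed.

Lemma rder_lin (c : C) t : rder (fun s => c * CofR s) t c.
Proof. by have := rderM c (@rder_id R t); rewrite mulr1. Qed.

(** [g] is a function of x + iy in real coordinates whose local expansions have a complex linear
    part [l]. The left side of the conclusion is the integral of g dz along the boundary, the four
    sides being increments of the primitives [P] and [U]. *)
Lemma goursat_rectangle (g P U : R -> R -> C) a b c d : a <= b -> c <= d ->
  (forall x y, a <= x <= b -> c <= y <= d -> exists l : C, forall e : R, 0 < e ->
     exists2 dl : R, 0 < dl & forall x' y', `|x' - x| < dl -> `|y' - y| < dl ->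
       nr (g x' y' - g x y - l * mkC (x' - x) (y' - y)) <= e * (`|x' - x| + `|y' - y|)) ->
  (forall x y, a <= x <= b -> c <= y <= d -> rder (P y) x (g x y)) ->
  (forall x y, a <= x <= b -> c <= y <= d -> rder (U x) y (g x y)) ->
  (P c b - P c a) - (P d b - P d a) + I * (U b d - U b c) - I * (U a d - U a c) = 0.
Proof.
move=> ab cd hg hP hU.
pose Phi x1 x2 y1 y2 := (P y1 x2 - P y1 x1) - (P y2 x2 - P y2 x1)
  + I * (U x2 y2 - U x2 y1) - I * (U x1 y2 - U x1 y1).
rewrite -/(Phi a b c d).
(* An error [e] times the diameter integrates to [e] times diameter times perimeter. The size is
   measured by the sum of the squared sides, which quartering divides by four, so that the four
   bounds add up exactly. *)
apply: (@nr_le_eps0 _ _ _ (4 * ((b - a) ^+ 2 + (d - c) ^+ 2))) => e e0.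
rewrite mulrA (mulrC e 4).
apply: (@cousin_rectangle R (fun x1 x2 y1 y2 =>
  nr (Phi x1 x2 y1 y2) <= 4 * e * ((x2 - x1) ^+ 2 + (y2 - y1) ^+ 2)) a b c d ab cd).
  move=> x1 x2 y1 y2 _ _; set m := (x1 + x2) / 2; set n := (y1 + y2) / 2.
  have -> : m - x1 = (x2 - x1) / 2 by rewrite /m; field.
  have -> : x2 - m = (x2 - x1) / 2 by rewrite /m; field.
  have -> : n - y1 = (y2 - y1) / 2 by rewrite /n; field.
  have -> : y2 - n = (y2 - y1) / 2 by rewrite /n; field.
  move=> h1 h2 h3 h4.
  have -> : Phi x1 x2 y1 y2 = Phi x1 m y1 n + Phi m x2 y1 n + (Phi x1 m n y2 + Phi m x2 n y2).
    by rewrite /Phi; ring.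
  apply: le_trans (nrD _ _) _; apply: le_trans (lerD (nrD _ _) (nrD _ _)) _.
  apply: le_trans (lerD (lerD h1 h2) (lerD h3 h4)) _.
  by rewrite le_eqVlt; apply/orP; left; apply/eqP; field.
move=> x0 y0 hx hy; have [l hl] := hg _ _ hx hy.
have [dl dl0 {}hl] := hl e e0; exists dl => // x1 x2 y1 y2 ax /andP[h1 h2] xb cy /andP[h3 h4] yd w h.
have xin x : x1 <= x <= x2 -> (a <= x <= b) /\ `|x - x0| <= x2 - x1.
  by move=> /andP[? ?]; split; [lra | rewrite ler_norml; lra].
have yin y : y1 <= y <= y2 -> (c <= y <= d) /\ `|y - y0| <= y2 - y1.
  by move=> /andP[? ?]; split; [lra | rewrite ler_norml; lra].
have x12 : x1 <= x2 by lra. have y12 : y1 <= y2 by lra.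
(* [A] and [B] are primitives, along horizontal and vertical segments, of the affine approximation
   of [g] at (x0, y0). Its boundary integral vanishes, so only the remainder estimated in [est]
   contributes. *)
pose A y s : C := g x0 y0 * CofR s + l * (CofR ((s - x0) ^+ 2 / 2) + I * CofR (y - y0) * CofR s).
pose B x s : C := g x0 y0 * CofR s + l * (CofR (x - x0) * CofR s + I * CofR ((s - y0) ^+ 2 / 2)).
pose D := (x2 - x1) + (y2 - y1).
have est x y : x1 <= x <= x2 -> y1 <= y <= y2 ->
    nr (g x y - (g x0 y0 + l * mkC (x - x0) (y - y0))) <= e * D.
  move=> /xin [_ xx] /yin [_ yy]; rewrite opprD addrA.
  apply: le_trans (hl _ _ (le_lt_trans xx w) (le_lt_trans yy h)) _.
  by rewrite ler_wpM2l ?(ltW e0) // lerD.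
have hor y : y1 <= y <= y2 -> nr ((P y x2 - A y x2) - (P y x1 - A y x1)) <= e * D * (x2 - x1).
  move=> hy'; apply: (@mean_value_bound R C (fun s => P y s - A y s)) => // s hs.
  exists (g s y - (g x0 y0 + l * mkC (s - x0) (y - y0))); last exact: est.
  apply: rderB; first by apply: hP; [have [] := xin s hs | have [] := yin y hy'].
  rewrite mkCE; apply: rderD.
    exact: rder_lin.
  apply: rderM; apply: rderD; first exact: rder_half_square.
  exact: rder_lin.
have ver x : x1 <= x <= x2 -> nr ((U x y2 - B x y2) - (U x y1 - B x y1)) <= e * D * (y2 - y1).
  move=> hx'; apply: (@mean_value_bound R C (fun s => U x s - B x s)) => // s hs.
  exists (g x s - (g x0 y0 + l * mkC (x - x0) (s - y0))); last exact: est.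
  apply: rderB; first by apply: hU; [have [] := xin x hx' | have [] := yin s hs].
  rewrite mkCE; apply: rderD.
    exact: rder_lin.
  apply: rderM; apply: rderD.
    exact: rder_lin.
  by apply: rderM; exact: rder_half_square.
have x1i : x1 <= x1 <= x2 by lra. have x2i : x1 <= x2 <= x2 by lra.
have y1i : y1 <= y1 <= y2 by lra. have y2i : y1 <= y2 <= y2 by lra.
have -> : Phi x1 x2 y1 y2 =
   (((P y1 x2 - A y1 x2) - (P y1 x1 - A y1 x1)) - ((P y2 x2 - A y2 x2) - (P y2 x1 - A y2 x1)))
  + (I * ((U x2 y2 - B x2 y2) - (U x2 y1 - B x2 y1)) - I * ((U x1 y2 - B x1 y2) - (U x1 y1 - B x1 y1))).
  rewrite /Phi /A /B !CofRB; move: (CofR (_ / 2)) (CofR (_ / 2)) (CofR (_ / 2)) (CofR (_ / 2)) => q1 q2 q3 q4.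
  by move: (CofR x1) (CofR x2) (CofR y1) (CofR y2) (CofR x0) (CofR y0) => *; ring.
apply: le_trans (nrD _ _) _; apply: le_trans (lerD (nrB _ _) (nrB _ _)) _.
rewrite !nrM nr_i !mul1r.
apply: le_trans (lerD (lerD (hor _ y1i) (hor _ y2i)) (lerD (ver _ x2i) (ver _ x1i))) _.
rewrite /D; set p := x2 - x1; set q := y2 - y1.
have -> : e * (p + q) * p + e * (p + q) * p + (e * (p + q) * q + e * (p + q) * q) =
  4 * e * (p ^+ 2 + q ^+ 2) - 2 * e * (p - q) ^+ 2 by ring.
by rewrite gerBl mulr_ge0 ?sqr_ge0 // mulr_ge0 // ltW.
Qed.

Definition cis (t : R) : C := mkC (cos t) (sin t).
(** The exponential of s + it. In these coordinates an annulus is a rectangle, so Goursat's lemma on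
    rectangles compares integrals over concentric circles. *)
Definition polar (s t : R) : C := CofR (expR s) * cis t.

Lemma cisD s t : cis (s + t) = cis s * cis t.
Proof. by rewrite /cis cosD sinD /mkC; simpc; congr (_ +i* _)%C; ring. Qed.

Lemma polarD s t s' t' : polar (s + s') (t + t') = polar s t * polar s' t'.
Proof. by rewrite /polar expRD CofRM cisD; ring. Qed.

Lemma nr_cis t : nr (cis t) = 1.
Proof. by rewrite nr_mkC cos2Dsin2 sqrtr1. Qed.

Lemma nr_polar s t : nr (polar s t) = expR s.
Proof. by rewrite nrM nrR nr_cis mulr1 ger0_norm // expR_ge0. Qed.

Lemma polar_diff0 (e : R) : 0 < e -> exists2 d : R, 0 < d & forall p q,
  `|p| < d -> `|q| < d -> nr (polar p q - 1 - mkC p q) <= e * (`|p| + `|q|).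
Proof.
(* The four products estimated below add up to at most 3 [f] |p| + 5 [f] |q|, which the factor 16
   absorbs with room to spare. *)
move=> e0; pose f := Num.min (e / 16) 1.
have f0 : 0 < f by rewrite lt_min divr_gt0 ?ltr01.
have f1 : f <= 1 by rewrite ge_min lexx orbT.
have fe : f <= e / 16 by rewrite ge_min lexx.
move: f f0 f1 fe => f f0 f1 fe.
have der0 (F : R -> R) v : derivable F 0 1 -> derive1 F 0 = v -> exists2 d : R, 0 < d &
    forall s, `|s| < d -> `|F s - F 0 - s * v| <= f * `|s|.
  move=> dF <-; have [d d0 hd] := derivable_eps dF f0; exists d => // s.
  by have := hd s; rewrite subr0.
have [d1 d10 h1] : exists2 d : R, 0 < d & forall s, `|s| < d -> `|expR s - 1 - s| <= f * `|s|.
  have [//|d d0 hd] := der0 expR 1 (@derivable_expR R 0).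
    by rewrite derive1E derive_val expR0.
  by exists d => // s /hd; rewrite expR0 mulr1.
have [d2 d20 h2] : exists2 d : R, 0 < d & forall s, `|s| < d -> `|sin s - s| <= f * `|s|.
  have [//|d d0 hd] := der0 sin 1 (@derivable_sin R 0).
    by rewrite derive1E derive_val cos0.
  by exists d => // s /hd; rewrite sin0 mulr1 subr0.
have [d3 d30 h3] : exists2 d : R, 0 < d & forall s, `|s| < d -> `|cos s - 1| <= f * `|s|.
  have [//|d d0 hd] := der0 cos 0 (@derivable_cos R 0).
    by rewrite derive1E derive_val sin0 oppr0.
  by exists d => // s /hd; rewrite cos0 mulr0 subr0.
exists (Num.min f (Num.min d1 (Num.min d2 d3))); first by rewrite !lt_min f0 d10 d20.
move=> p q; rewrite !lt_min => /and4P[pf /h1 k1 _ _] /and4P[qf _ /h2 k2 /h3 k3].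
have -> : polar p q - 1 - mkC p q =
    mkC ((expR p - 1 - p) * cos q + (1 + p) * (cos q - 1)) (expR p * (sin q - q) + (expR p - 1) * q).
  by rewrite /polar /cis /mkC /CofR; simpc; congr (_ +i* _)%C; ring.
have p0 := normr_ge0 p; have q0 := normr_ge0 q.
have e1 : `|expR p - 1| <= 2 * `|p|.
  have -> : expR p - 1 = (expR p - 1 - p) + p by ring.
  apply: le_trans (ler_normD _ _) _; have := ler_wpM2r p0 f1; lra.
have e3 : `|expR p| <= 3.
  have -> : expR p = (expR p - 1) + 1 by ring.
  by apply: le_trans (ler_normD _ _) _; rewrite normr1; lra.
have pp1 : `|1 + p| <= 2 by apply: le_trans (ler_normD _ _) _; rewrite normr1; lra.
apply: le_trans (nr_mkC_le _ _) _.
apply: le_trans (lerD (ler_normD _ _) (ler_normD _ _)) _; rewrite !normrM.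
have c1 : `|cos q| <= 1 by rewrite ler_norml cos_le1 cos_geN1.
have a1 : `|expR p - 1 - p| * `|cos q| <= f * `|p| by apply: le_trans (ler_piMr _ c1) k1.
have a2 : `|1 + p| * `|cos q - 1| <= 2 * (f * `|q|) by rewrite ler_pM.
have a3 : `|expR p| * `|sin q - q| <= 3 * (f * `|q|) by rewrite ler_pM.
have a4 : `|expR p - 1| * `|q| <= 2 * `|p| * f by rewrite ler_pM // ltW.
have b1 : f * `|p| <= e / 16 * `|p| by rewrite ler_wpM2r.
have b2 : f * `|q| <= e / 16 * `|q| by rewrite ler_wpM2r.
have b3 : 0 <= e * `|p| by rewrite mulr_ge0 // ltW.
have b4 : 0 <= e * `|q| by rewrite mulr_ge0 // ltW.
by lra.
Qed.

End Goursat.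

(** * Cauchy's formula in one variable *)

Section CauchyFormula.
Context {R : realType}.
Local Notation C := (Cx R).

Lemma near_eq_diff (V W : normedModType C) (f g : V -> W) x :
  {near x, f =1 g} -> differentiable g x ->
  differentiable f x /\ forall v, 'd f x v = 'd g x v.
Proof.
move=> /nbhs_nrP [d d0 hd] dg; apply: has_diff_diff; first exact: diff_continuous.
move=> e /(diff_has_diff dg) [d' d'0 hd']; exists (Num.min d d').
  by rewrite lt_min d0.
move=> h; rewrite lt_min => /andP[h1 h2].
by rewrite !hd ?subrr ?nr0 // ?hd' // addrC addKr.
Qed.

Lemma diff_C (W : normedModType C) (f : C -> W) x (k : C) :
  'd f x k = k *: 'd f x 1.
Proof. by rewrite -linearZ /= [_ *: _]mulr1. Qed.

(** The exponential being multiplicative, its expansion at (s, t) is the one at 0 multiplied by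
    [polar s t], whence the coefficient [l * z]. The complex linear expansion obtained is the
    hypothesis of [goursat_rectangle]. *)
Lemma diff_polar (h : C -> C) s t : differentiable h (polar s t) ->
  exists m : C, forall e : R, 0 < e -> exists2 dl : R, 0 < dl &
    forall x' y', `|x' - s| < dl -> `|y' - t| < dl ->
    nr (h (polar x' y') - h (polar s t) - m * mkC (x' - s) (y' - t)) <=
      e * (`|x' - s| + `|y' - t|).
Proof.
move=> dh; pose l := 'd h (polar s t) 1; pose z := polar s t.
have hl := diff_has_diff dh; pose r := nr z.
have r0 : 0 < r by rewrite /r nr_polar expR_gt0.
have l0 := nr_ge0 l.
exists (l * z) => e e0.
pose e1 := Num.min 1 (e / (2 * r * (nr l + 1))).
have rl0 : 0 < 2 * r * (nr l + 1) by rewrite !mulr_gt0 // ltr_wpDl.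
have e10 : 0 < e1 by rewrite lt_min ltr01 divr_gt0.
have e11 : e1 <= 1 by rewrite ge_min lexx.
have e12 : nr l * r * e1 <= e / 2.
  have : e1 <= e / (2 * r * (nr l + 1)) by rewrite ge_min lexx orbT.
  rewrite ler_pdivlMr // => h1.
  have : 0 <= e1 * r by rewrite mulr_ge0 // ltW.
  by move: h1; lra.
move: e1 e10 e11 e12 => e1 e10 e11 e12.
have [d1 d10 hd1] := polar_diff0 e10.
have e20 : 0 < e / (4 * r) by rewrite divr_gt0 // mulr_gt0.
have [d2 d20 hd2] := hl _ e20.
exists (Num.min d1 (d2 / (4 * r))); first by rewrite lt_min d10 divr_gt0 // mulr_gt0.
move=> x' y'; rewrite !lt_min => /andP[p1 p2] /andP[q1 q2].
set p := x' - s in p1 p2 *; set q := y' - t in q1 q2 *.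
have -> : polar x' y' = z + z * (polar p q - 1).
  by rewrite mulrBr mulr1 subrKC -polarD; congr polar; rewrite /p /q subrKC.
set w := polar p q - 1 - mkC p q.
have hw : nr w <= e1 * (`|p| + `|q|) by exact: hd1.
have pE : polar p q - 1 = mkC p q + w by rewrite /w subrKC.
have S0 : 0 <= `|p| + `|q| by rewrite addr_ge0.
have hk : nr (z * (polar p q - 1)) <= r * (2 * (`|p| + `|q|)).
  rewrite nrM ler_wpM2l // ?nr_ge0 // pE (le_trans (nrD _ _)) //.
  rewrite mulrDl mul1r lerD ?nr_mkC_le // (le_trans hw) //.
  by rewrite -[leRHS]mul1r ler_wpM2r.
have hkd : nr (z * (polar p q - 1)) < d2.
  apply: le_lt_trans hk _; move: p2 q2; rewrite !ltr_pdivlMr ?mulr_gt0 //; lra.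
have := hd2 _ hkd; rewrite [X in _ - X]diff_C -/l -/z => hh.
have -> : h (z + z * (polar p q - 1)) - h z - l * z * mkC p q =
  (h (z + z * (polar p q - 1)) - h z - (z * (polar p q - 1)) *: l) + l * z * w.
  have -> : (z * (polar p q - 1)) *: l = z * (polar p q - 1) * l by [].
  by rewrite /w; ring.
apply: le_trans (nrD _ _) _; apply: (@le_trans _ _ (e / 2 * (`|p| + `|q|) + e / 2 * (`|p| + `|q|))).
  apply: lerD.
    apply: le_trans hh _; apply: le_trans (ler_wpM2l (ltW e20) hk) _.
    rewrite le_eqVlt; apply/orP; left; apply/eqP; field.
    by rewrite gt_eqF.
  rewrite nrM (nrM l z) -/r; apply: le_trans (ler_wpM2l _ hw) _; first by apply: mulr_ge0 => //; exact: ltW.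
  by rewrite mulrA ler_wpM2r.
by rewrite -mulrDl -splitr.
Qed.

Lemma circle_continuous (h : C -> C) r t : 0 < r ->
  differentiable h (CofR r * cis t) -> forall e : R, 0 < e ->
  exists2 d : R, 0 < d & forall s, `|s - t| < d ->
    nr (h (CofR r * cis s) - h (CofR r * cis t)) <= e.
Proof.
move=> r0; have E s : CofR r * cis s = polar (ln r) s by rewrite /polar lnK.
rewrite E => /diff_polar [m hm] e e0; have [d d0 hd] := hm 1 ltr01.
have m0 : 0 < nr m + 1 by rewrite ltr_wpDl // nr_ge0.
exists (Num.min d (e / (nr m + 1))); first by rewrite lt_min d0 divr_gt0.
move=> s; rewrite E lt_min => /andP[h1]; rewrite ltr_pdivlMr // => h2.
have := hd (ln r) s; rewrite subrr normr0 => /(_ d0 h1) h3.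
set X := _ - _; rewrite -(subrK (m * mkC 0 (s - t)) X).
apply: le_trans (nrD _ _) _; apply: le_trans (lerD h3 (lexx _)) _.
rewrite nrM; have := ler_wpM2l (nr_ge0 m) (nr_mkC_le 0 (s - t)); rewrite normr0.
by move: h2; lra.
Qed.

Lemma circle_primitive (h : C -> C) r : 0 < r ->
  (forall z, nr z = r -> differentiable h z) ->
  exists U : R -> C, forall t, 0 <= t <= 2 * pi -> rder U t (h (CofR r * cis t)).
Proof.
move=> r0 dh; apply: (@primitive_exists _ (fun t => h (CofR r * cis t))).
  by rewrite mulr_ge0 // pi_ge0.
move=> t _; apply: circle_continuous => //; apply: dh.
by rewrite nrM nr_cis nrR mulr1 gtr0_norm.
Qed.

(** In logarithmic polar coordinates the boundary integral over [ln r', ln r] x [0, 2 pi] vanishes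
    and its two radial sides cancel, so the circle integral does not depend on the radius; a small
    [r'] gives the value at the center up to [e]. At 0 only continuity is assumed, in view of
    difference quotients. *)
Lemma circle_mean_value (h : C -> C) r (U : R -> C) : 0 < r ->
  (forall z, z != 0 -> nr z <= r -> differentiable h z) -> {for 0, continuous h} ->
  (forall t, 0 <= t <= 2 * pi -> rder U t (h (CofR r * cis t))) ->
  U (2 * pi) - U 0 = CofR (2 * pi) * h 0.
Proof.
move=> r0 dh ch hU.
have pi0 : 0 <= 2 * pi :> R by rewrite mulr_ge0 // pi_ge0.
apply/eqP; rewrite -subr_eq0; apply/eqP.
apply: (@nr_le_eps0 _ _ _ (2 * pi)) => e e0.
have [d d0 hd] := (continuous_nrP _ _).1 ch e e0.
pose r' := Num.min r (d / 2).
have r'0 : 0 < r' by rewrite lt_min r0 divr_gt0.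
have r'r : r' <= r by rewrite ge_min lexx.
have r'd : r' < d.
  by rewrite gt_min; apply/orP; right; rewrite ltr_pdivrMr // ltr_pMr // ltr1n.
move: r' r'0 r'r r'd => r' r'0 r'r r'd.
have ab : ln r' <= ln r by rewrite ler_ln ?posrE.
pose g s t := h (polar s t).
have dg s t : s <= ln r -> differentiable h (polar s t).
  move=> hs; apply: dh.
    apply/eqP => z0; have := nr_polar s t; rewrite z0 nr0 => /eqP.
    by rewrite eq_sym gt_eqF // expR_gt0.
  by rewrite nr_polar -[leRHS](lnK r0) ler_expR.
have cont s t : s <= ln r -> forall e : R, 0 < e -> exists2 d : R, 0 < d &
    forall s' t', `|s' - s| < d -> `|t' - t| < d -> nr (g s' t' - g s t) <= e.
  move=> hs f f0; have [m hm] := diff_polar (dg s t hs).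
  have [dl dl0 hdl] := hm 1 ltr01.
  have m0 := nr_ge0 m; have m1 : 0 < 2 * (nr m + 1) by rewrite mulr_gt0 // ltr_wpDl.
  exists (Num.min dl (f / (2 * (nr m + 1)))); first by rewrite lt_min dl0 divr_gt0.
  move=> s' t'; rewrite !lt_min => /andP[h1 +] /andP[h2 +].
  rewrite !ltr_pdivlMr // => h3 h4.
  set X := g _ _ - _; rewrite -(subrK (m * mkC (s' - s) (t' - t)) X).
  apply: le_trans (nrD _ _) _; apply: le_trans (lerD (hdl _ _ h1 h2) (lexx _)) _.
  rewrite nrM; have := ler_wpM2l m0 (nr_mkC_le (s' - s) (t' - t)).
  by move: h3 h4; lra.
have /choice[P hP] : forall t, exists Pt : R -> C,
    forall s, ln r' <= s <= ln r -> rder Pt s (g s t).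
  move=> t; apply: (@primitive_exists _ (fun s => g s t)) => // s /andP[_ hs] f f0.
  have [dl dl0 hdl] := cont s t hs f f0; exists dl => // s' hs'.
  by apply: hdl => //; rewrite subrr normr0.
have /choice[Q hQ] : forall s, exists Qs : R -> C, s <= ln r ->
    forall t, 0 <= t <= 2 * pi -> rder Qs t (g s t).
  move=> s; have [hs|hs] := boolP (s <= ln r); last by exists (fun=> 0).
  have [|Qs hQs] := @primitive_exists R (fun t => g s t) 0 (2 * pi) pi0.
    move=> t _ f f0; have [dl dl0 hdl] := cont s t hs f f0; exists dl => // t' ht'.
    by apply: hdl => //; rewrite subrr normr0.
  by exists Qs.
have gou := @goursat_rectangle R g P Q _ _ _ _ ab pi0 _
  (fun x y hx _ => hP y x hx) (fun x y hx hy => hQ x (proj2 (andP hx)) y hy).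
have {gou} := gou (fun x y hx _ => diff_polar (dg x y (proj2 (andP hx)))).
(* The sides t = 0 and t = 2 pi carry the same integrand, by periodicity. *)
have -> : P 0 (ln r) - P 0 (ln r') = P (2 * pi) (ln r) - P (2 * pi) (ln r').
  apply: (@rder_unique_increment R C _ _ (fun s => g s 0) _ _ ab) => [s /hP //|s hs].
  have -> : g s 0 = g s (2 * pi); last exact: hP.
  by rewrite /g /polar /cis mulr_natl cos2pi sin2pi cos0 sin0.
rewrite subrr add0r -mulrBr => /eqP; rewrite mulf_eq0 => /orP[/eqP I0|].
  by have := @nr_i R; rewrite I0 nr0 => /eqP; rewrite eq_sym oner_eq0.
rewrite subr_eq0 => /eqP QE.
have -> : U (2 * pi) - U 0 = Q (ln r') (2 * pi) - Q (ln r') 0.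
  rewrite -QE; apply: (@rder_unique_increment R C _ _ (fun t => g (ln r) t)) => // t ht.
    by rewrite /g /polar lnK //; exact: hU.
  exact: hQ.
have -> : Q (ln r') (2 * pi) - Q (ln r') 0 - CofR (2 * pi) * h 0 =
  (Q (ln r') (2 * pi) - h 0 * CofR (2 * pi)) - (Q (ln r') 0 - h 0 * CofR 0).
  by rewrite CofR0; ring.
rewrite -[2 * pi in leRHS]subr0.
apply: (@mean_value_bound R C (fun t => Q (ln r') t - h 0 * CofR t)) => // t ht.
exists (g (ln r') t - h 0); first by apply: rderB; [exact: hQ | exact: rder_lin].
by apply/ltW/hd; rewrite subr0 nr_polar lnK.
Qed.

(** The difference quotient at 0 completed by the derivative: differentiable off 0 and continuous at
    0, as [circle_mean_value] asks. *)
Definition slope (f : C -> C) (z : C) : C :=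
  if z == 0 then 'd f 0 1 else (f z - f 0) / z.

Lemma slope_diff (f : C -> C) z : z != 0 -> differentiable f z ->
  differentiable (slope f) z.
Proof.
move=> z0 df.
have d1 : differentiable (fun w : C => (f w - f 0) / w) z.
  have -> : (fun w : C => (f w - f 0) / w) = (f - cst (f 0)) * (fun w => (id w)^-1) by [].
  by apply: differentiableM; [exact: differentiableB | exact: differentiableV].
suff /near_eq_diff /(_ d1) [] : {near z, slope f =1 (fun w : C => (f w - f 0) / w)} by [].
apply/nbhs_nrP; exists (nr z); first exact: nr_gt0.
move=> y hy; rewrite /slope; case: eqP => // y0; move: hy.
by rewrite y0 sub0r nrN ltxx.
Qed.

Lemma slope_continuous (f : C -> C) : differentiable f 0 -> {for 0, continuous (slope f)}.
Proof.
move=> df; apply/continuous_nrP => e e0; have e2 : 0 < e / 2 by lra.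
have [d d0 hd] := diff_has_diff df e2; exists d => // y; rewrite subr0 => hy.
rewrite /slope eqxx; case: eqP => [_|/eqP y0]; first by rewrite subrr nr0.
have := hd y hy; rewrite add0r diff_C => h.
apply: (@le_lt_trans _ _ (e / 2)); last by lra.
have yn := nr_gt0 y0.
rewrite -(ler_pM2r yn) -nrM mulrBl divfK //.
by rewrite [_ * y]mulrC.
Qed.

(** Mean value property of the difference quotient. Subtracting [f 0] does not change Cauchy's
    integral for the derivative, but makes the integrand extend continuously to 0. *)
Lemma cauchy_formula (f : C -> C) r (U : R -> C) : 0 < r ->
  (forall z, nr z <= r -> differentiable f z) ->
  (forall t, 0 <= t <= 2 * pi ->
     rder U t ((f (CofR r * cis t) - f 0) / (CofR r * cis t))) ->
  U (2 * pi) - U 0 = CofR (2 * pi) * 'd f 0 1.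
Proof.
move=> r0 df hU; have -> : 'd f 0 1 = slope f 0 by rewrite /slope eqxx.
have d0 : differentiable f 0 by apply: df; rewrite nr0 ltW.
apply: (circle_mean_value r0) => [z z0 hz||t ht].
- exact: slope_diff z0 (df z hz).
- exact: slope_continuous.
rewrite /slope ifF; first exact: hU.
apply/negbTE/eqP => /(congr1 nr); rewrite nrM nr_cis nrR nr0 mulr1 gtr0_norm //.
by move=> rr; rewrite rr ltxx in r0.
Qed.

Lemma cauchy_primitive (f : C -> C) r : 0 < r ->
  (forall z, nr z <= r -> differentiable f z) ->
  exists U : R -> C, forall t, 0 <= t <= 2 * pi ->
     rder U t ((f (CofR r * cis t) - f 0) / (CofR r * cis t)).
Proof.
move=> r0 df; have nz z : nr z = r -> z != 0.
  by move=> hz; apply/eqP => z0; rewrite -hz z0 nr0 ltxx in r0.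
have [|U hU] := @circle_primitive (slope f) r r0.
  by move=> z hz; apply: slope_diff; [exact: nz | apply: df; rewrite hz].
exists U => t /hU; rewrite /slope ifF //; apply/negbTE/nz.
by rewrite nrM nr_cis nrR mulr1 gtr0_norm.
Qed.

(** The factor 2 comes from bounding [f z - f 0] instead of [f z]. *)
Lemma cauchy_estimate1 (f : C -> C) r B : 0 < r ->
  (forall z, nr z <= r -> differentiable f z /\ nr (f z) <= B) ->
  nr ('d f 0 1) <= 2 * B / r.
Proof.
move=> r0 hf; have [U hU] := cauchy_primitive r0 (fun z hz => (hf z hz).1).
have := cauchy_formula r0 (fun z hz => (hf z hz).1) hU.
have pi0 : 0 < 2 * pi :> R by rewrite mulr_gt0 // pi_gt0.
have nz t : nr (CofR r * cis t) = r by rewrite nrM nr_cis nrR mulr1 gtr0_norm.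
have : nr (U (2 * pi) - U 0) <= 2 * B / r * (2 * pi - 0).
  apply: mean_value_bound; first exact: ltW.
  move=> t /hU h; exists ((f (CofR r * cis t) - f 0) / (CofR r * cis t)) => //.
  rewrite nrM nrV nz ler_wpM2r ?invr_ge0 // ?(ltW r0) //.
  rewrite (le_trans (nrB _ _)) // mulr_natl mulr2n lerD //.
    by apply: (hf _ _).2; rewrite nz.
  by apply: (hf _ _).2; rewrite nr0 ltW.
move=> + E; rewrite E subr0 nrM nrR gtr0_norm // mulrC.
by rewrite ler_pM2r.
Qed.

End CauchyFormula.

(** * Cauchy's estimates and second derivatives in several variables *)

Section SeveralVariables.
Context {R : realType}.
Local Notation C := (Cx R).

Lemma diff_line (V W : normedModType C) (f : V -> W) (y v : V) (z : C) :
  differentiable f (y + z *: v) ->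
  differentiable (fun z : C => f (y + z *: v)) z /\
  'd (fun z : C => f (y + z *: v)) z 1 = 'd f (y + z *: v) v.
Proof.
move=> df; pose g := cst y + ( *:%R ^~ v : C -> V).
have hg : is_diff z g (0 + *:%R ^~ v) by apply: is_diffD.
have dg : differentiable g z by apply: ex_diff.
have -> : (fun z : C => f (y + z *: v)) = f \o g by [].
split; first exact: (differentiable_comp dg df).
rewrite (diff_comp dg df) /= diff_val /=.
by congr ('d _ _ _); rewrite !fctE add0r scale1r.
Qed.

Lemma rder_line (V W : normedModType C) (f : V -> W) (y v : V) (t : R) :
  differentiable f (y + CofR t *: v) ->
  rder (fun t => f (y + CofR t *: v)) t ('d f (y + CofR t *: v) v).
Proof.
move=> /diff_has_diff hf e e0; have v1 : 0 < nr v + 1 by rewrite ltr_wpDl // nr_ge0.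
have [d d0 hd] := hf _ (divr_gt0 e0 v1); exists (d / (nr v + 1)).
  exact: divr_gt0.
move=> s; rewrite ltr_pdivlMr // => hs.
have k : nr (CofR (s - t) *: v) <= `|s - t| * (nr v + 1).
  by rewrite nrZ nrR ler_wpM2l // lerDl.
have := hd _ (le_lt_trans k hs).
rewrite -(addrA y) -scalerDl -CofRD subrKC linearZ /= => h.
apply: le_trans h _; apply: le_trans (ler_wpM2l (ltW (divr_gt0 e0 v1)) k) _.
by rewrite mulrCA divfK ?gt_eqF // mulrC.
Qed.

Lemma diff_shift (V W : normedModType C) (f : V -> W) (y h : V) :
  differentiable f (y + h) -> differentiable (fun y => f (y + h)) y /\
  forall v, 'd (fun y => f (y + h)) y v = 'd f (y + h) v.
Proof.
move=> df; apply: has_diff_diff; first exact: diff_continuous.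
by move=> e /(diff_has_diff df) [d d0 hd]; exists d => // k /hd; rewrite (addrAC y h k).
Qed.

Variable n : nat.
Local Notation V := 'rV[C]_n.

Section Ball.
Variables (f : V -> C) (x0 : V) (r0 B : R).
Hypothesis r0_gt0 : 0 < r0.
Hypothesis hf : forall y : V, nr (y - x0) < r0 -> differentiable f y /\ nr (f y) <= B.

Lemma cauchy_estimate (y v : V) : nr (y - x0) <= r0 / 2 ->
  nr ('d f y v) <= 8 * B / r0 * nr v.
Proof.
move=> hy; have [->|v0] := eqVneq v 0; first by rewrite linear0 !nr0 mulr0.
(* On the complex line through [y] in the direction [v], parameters in the disc of radius [r] move
   [y] by at most [r0 / 4], hence stay within the ball of radius [r0]. *)
have nv := nr_gt0 v0; pose r := r0 / 4 / nr v.
have rp : 0 < r by rewrite !divr_gt0.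
have inb (z : C) : nr z <= r -> nr (y + z *: v - x0) < r0.
  rewrite ler_pdivlMr // addrAC => hz; apply: le_lt_trans (nrD _ _) _.
  by rewrite nrZ; move: hz hy r0_gt0; lra.
have [|d1] := @diff_line V C f y v 0; first by apply: (hf (inb _ _)).1; rewrite nr0 ltW.
rewrite scale0r addr0 => <-.
have -> : 8 * B / r0 * nr v = 2 * B / r by rewrite /r; field; rewrite !gt_eqF.
apply: (@cauchy_estimate1 R (fun z => f (y + z *: v)) r B rp) => z hz.
 have [h1 h2] := hf (inb z hz); split; [exact: (diff_line h1).1 | exact: h2].
Qed.

Lemma ball_convex (y z : V) (t : R) (r : R) : nr (y - x0) < r -> nr (z - x0) < r -> 0 <= t <= 1 ->
  nr (z + CofR t *: (y - z) - x0) < r.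
Proof.
move=> hy hz /andP[t0 t1].
have -> : z + CofR t *: (y - z) - x0 = CofR (1 - t) *: (z - x0) + CofR t *: (y - x0).
  rewrite [LHS]addrAC CofRB scalerBl scale1r -(addrA (z - x0)); congr (_ + _).
  by rewrite addrC -scalerBr opprB addrA subrK.
apply: le_lt_trans (nrD _ _) _; rewrite !nrZ !nrR !ger0_norm //; last by lra.
have [t00|t0'] := eqVneq t 0; first by rewrite t00; lra.
have tp : 0 < t by rewrite lt_def t0'.
have h1 : t * nr (y - x0) < t * r by rewrite ltr_pM2l.
have h2 : (1 - t) * nr (z - x0) <= (1 - t) * r by apply: ler_wpM2l; [lra | exact: ltW].
by lra.
Qed.

Lemma ball_lipschitz (y z : V) : nr (y - x0) < r0 / 2 -> nr (z - x0) < r0 / 2 ->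
  nr (f y - f z) <= 8 * B / r0 * nr (y - z).
Proof.
move=> hy hz; have := @mean_value_bound R C (fun t => f (z + CofR t *: (y - z))) 0 1
  (8 * B / r0 * nr (y - z)) ler01.
rewrite CofR1 CofR0 scale1r scale0r addr0 subrKC subr0 mulr1; apply.
move=> t ht; have hb := ball_convex hy hz ht.
exists ('d f (z + CofR t *: (y - z)) (y - z)); last by apply: cauchy_estimate; exact: ltW.
by apply: rder_line; apply: (hf _).1; apply: lt_trans hb _; rewrite ltr_pdivrMr // ltr_pMr // ltr1n.
Qed.

End Ball.

(** Cauchy's estimate is used twice: for [f] it gives a Lipschitz bound; then for the increment z
    |-> f (z + h) - f z, thus of size O(h), it shows that the differential is Lipschitz. The mean
    value inequality along a segment turns this into a quadratic remainder. *)
Lemma second_order (f : V -> C) (x0 : V) : (\forall y \near x0, differentiable f y) ->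
  exists K rho : R, [/\ 0 <= K, 0 < rho,
   (forall y : V, nr (y - x0) < rho + rho -> differentiable f y),
   (forall y h v : V, nr (y - x0) < rho -> nr h < rho ->
     nr ('d f (y + h) v - 'd f y v) <= K * nr h * nr v) &
   (forall y h : V, nr (y - x0) < rho -> nr h < rho ->
     nr (f (y + h) - f y - 'd f y h) <= K * nr h ^+ 2)].
Proof.
move=> /nbhs_nrP [d1 d10 hd1].
have /continuous_nrP /(_ 1 ltr01) [d2 d20 hd2] : {for x0, continuous f}.
  by apply: differentiable_continuous; apply: hd1; rewrite subrr nr0.
pose r0 := Num.min d1 d2; pose B := nr (f x0) + 1.
have r00 : 0 < r0 by rewrite lt_min d10.
have hf (y : V) : nr (y - x0) < r0 -> differentiable f y /\ nr (f y) <= B.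
  rewrite lt_min => /andP[/hd1 h1 /hd2 h2]; split; first exact: h1.
  by rewrite -(subrK (f x0) (f y)) (le_trans (nrD _ _)) // addrC lerD2l ltW.
have B0 : 0 <= B by rewrite addr_ge0 // nr_ge0.
move: r0 B r00 hf B0 => r0 B r00 hf B0.
pose c := 8 * B / r0; have c0 : 0 <= c by rewrite divr_ge0 ?mulr_ge0 // ltW.
(* Points within [rho + rho] of [x0] lie in the half of the ball of radius [r0 / 4] on which the
   increment of [f] is estimated. *)
pose rho := r0 / 16; have rhop : 0 < rho by rewrite divr_gt0.
pose K := 8 * c / (r0 / 4) ; have K0 : 0 <= K.
  by apply: divr_ge0; [apply: mulr_ge0 | apply: ltW; apply: divr_gt0].
have r4 : 0 < r0 / 4 by rewrite divr_gt0.
have lip (y h v : V) : nr (y - x0) <= rho + rho -> nr h < rho ->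
    nr ('d f (y + h) v - 'd f y v) <= K * nr h * nr v.
  move=> hy hh; pose g (z : V) := f (z + h) - f z.
  have dfs (z : V) : nr (z - x0) < r0 / 4 -> differentiable f (z + h) /\ differentiable f z.
    move=> hz; split; apply: (hf _ _).1; last by lra.
    rewrite addrAC (le_lt_trans (nrD _ _)) //; move: hz hh; rewrite /rho; lra.
  have dg (z : V) : nr (z - x0) < r0 / 4 -> differentiable g z /\
      'd g z v = 'd f (z + h) v - 'd f z v.
    move=> /dfs [h1 h2].
    have [d3 e3] := diff_shift h1; split; first exact: (differentiableB d3 h2).
    apply: etrans (congr1 (fun F => F v) (diffB d3 h2)) _.
    exact: (congr1 (fun w => w - 'd f z v) (e3 v)).
  have hy4 : nr (y - x0) < r0 / 4 by apply: le_lt_trans hy _; rewrite /rho; lra.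
  rewrite -(dg y hy4).2.
  have -> : K * nr h = 8 * (c * nr h) / (r0 / 4) by rewrite /K; field; rewrite gt_eqF.
  apply: (@cauchy_estimate g x0 (r0 / 4) (c * nr h) r4) => [z hz|]; last first.
    by apply: le_trans hy _; rewrite /rho; lra.
  split; first exact: (dg z hz).1.
  have -> : nr h = nr (z + h - z) by rewrite addrAC subrr add0r.
  apply: (ball_lipschitz r00 hf); last by lra.
  by rewrite addrAC (le_lt_trans (nrD _ _)) //; move: hz hh; rewrite /rho; lra.
exists K, rho; split=> [||y hy|y h v hy hh|y h hy hh]; [exact: K0|exact: rhop| | |].
- by apply: (hf _ _).1; apply: lt_trans hy _; rewrite /rho; lra.
- by apply: lip => //; lra.
have := @mean_value_bound R C (fun t => f (y + CofR t *: h) - 'd f y h * CofR t) 0 1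
  (K * nr h ^+ 2) ler01.
rewrite CofR1 CofR0 scale1r scale0r addr0 mulr0 subr0 mulr1 subr0 mulr1.
rewrite addrAC; apply => t /andP[t0 t1].
have hth : nr (CofR t *: h) <= nr h.
  by rewrite nrZ nrR ger0_norm // ler_piMl // nr_ge0.
have hth' : nr (CofR t *: h) < rho by exact: le_lt_trans hth hh.
exists ('d f (y + CofR t *: h) h - 'd f y h).
  apply: rderB; last exact: rder_lin.
  apply: rder_line; apply: (hf _ _).1; rewrite addrAC (le_lt_trans (nrD _ _)) //.
  by move: hy hth'; rewrite /rho; lra.
apply: le_trans (lip _ _ _ _ hth') _; first by lra.
by rewrite expr2 mulrA ler_wpM2r ?nr_ge0 // ler_wpM2l.
Qed.

Lemma div_sub_div (F : fieldType) (a b x y : F) : x != 0 -> y != 0 ->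
  a / x - b / y = (a - b) / x + b * ((y - x) / (x * y)).
Proof. by move=> x0 y0; field; rewrite x0 y0. Qed.

Lemma diff_linC (f : V -> C) (x : V) (a : C) (k l : V) :
  'd f x (a *: k + l) = a * 'd f x k + 'd f x l.
Proof. exact: (@linearP _ _ _ _ ('d f x) a k l). Qed.

(* [G x k] stands for ['d f x k]; abstracting it keeps unification away from [diff]. *)
Lemma direction_has_diff (f : V -> C) (G : V -> V -> C) (x0 u : V) (K rho r : R) :
  0 <= K -> 0 < rho -> 0 < r -> r * nr u < rho ->
  (forall x a k l, G x (a *: k + l) = a * G x k + G x l) ->
  (forall y h v : V, nr (y - x0) < rho -> nr h < rho ->
     nr (G (y + h) v - G y v) <= K * nr h * nr v) ->
  (forall y h : V, nr (y - x0) < rho -> nr h < rho ->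
     nr (f (y + h) - f y - G y h) <= K * nr h ^+ 2) ->
  (forall x : V, nr (x - x0) < rho -> exists2 U : R -> C,
    (forall t, 0 <= t <= 2 * pi ->
       rder U t ((f (x + (CofR r * cis t) *: u) - f x) / (CofR r * cis t))) &
    U (2 * pi) - U 0 = CofR (2 * pi) * G x u) ->
  exists2 Lam : V -> C, linear Lam & has_diff (fun x => G x u) x0 Lam.
Proof.
move=> K0 rho0 r0 ru Glin lip rem reprU.
have u1 : 0 < nr u + 1 by rewrite ltr_wpDl // nr_ge0.
have small (z : C) : nr z <= r -> nr (z *: u) < rho.
  by move=> hz; rewrite nrZ; apply: le_lt_trans ru; rewrite ler_wpM2r ?nr_ge0.
have pi0 : 0 < 2 * pi :> R by rewrite mulr_gt0 // pi_gt0.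
have pin0 : CofR (2 * pi) != 0 :> C by rewrite -CofR0 (inj_eq (@CofR_inj R)) gt_eqF.
pose z t : C := CofR r * cis t.
have nz t : nr (z t) = r by rewrite nrM nr_cis nrR mulr1 gtr0_norm.
have zn0 t : z t != 0 by apply/eqP => zt; have := nz t; rewrite zt nr0 => rr; rewrite -rr ltxx in r0.
have small' t : nr (z t *: u) < rho by apply: small; rewrite nz.
have x00 : nr (x0 - x0) < rho by rewrite subrr nr0.
(* [P k] is a primitive along the circle of the integrand of Cauchy's formula, differentiated in the
   base point in the direction [k]; the estimates that follow show that this integrand is
   continuous. *)
have /choice[P hP] : forall k : V, exists P : R -> C, forall t, 0 <= t <= 2 * pi ->
    rder P t ((G (x0 + z t *: u) k - G x0 k) / z t).
  move=> k; pose A t := G (x0 + z t *: u) k - G x0 k.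
  apply: (@primitive_exists R (fun t => A t / z t)); first exact: ltW.
  move=> t _ e e0; pose c := K * nr u * nr k / r + nr (A t) / r ^+ 2.
  have c0 : 0 <= c.
    apply: addr_ge0; apply: divr_ge0; rewrite ?nr_ge0 ?(ltW r0) ?exprn_ge0 ?(ltW r0) //.
    by apply: mulr_ge0; [apply: mulr_ge0 => // |]; exact: nr_ge0.
  pose eta := Num.min (rho / (2 * (nr u + 1))) (e / (c + 1)).
  have eta0 : 0 < eta by rewrite lt_min !divr_gt0 // ?mulr_gt0 // ltr_wpDl.
  have eta1 : eta * nr u < rho.
    have : eta <= rho / (2 * (nr u + 1)) by rewrite ge_min lexx.
    rewrite ler_pdivlMr ?mulr_gt0 // => h.
    have : 0 < eta * (nr u + 1) by rewrite mulr_gt0.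
    by move: h eta0; lra.
  have eta2 : c * eta <= e.
    have : eta <= e / (c + 1) by rewrite ge_min lexx orbT.
    rewrite ler_pdivlMr ?ltr_wpDl // => h.
    by move: h eta0; lra.
  have [|d d0 hd] := @circle_continuous R (@id C) r t r0 _ eta eta0.
    exact: ex_diff.
  exists d => // s /hd; rewrite -/(z s) -/(z t) => zst.
  have -> : A s / z s - A t / z t = (A s - A t) / z s + A t * ((z t - z s) / (z s * z t)).
    exact: div_sub_div (zn0 s) (zn0 t).
  apply: le_trans (nrD _ _) _; rewrite (nrM (A s - A t)) (nrM (A t)) (nrM (z t - z s)) !nrV (nrM (z s) (z t)) !nz [nr (z t - z s)]nrBC.
  apply: le_trans eta2; rewrite /c mulrDl.
  have hsu : nr ((z s - z t) *: u) <= eta * nr u by rewrite nrZ ler_wpM2r ?nr_ge0.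
  apply: lerD; last first.
    rewrite -[r * r]expr2 [nr (z s - z t) / _]mulrC mulrA.
    by rewrite ler_wpM2l // divr_ge0 ?nr_ge0 // exprn_ge0 // ltW.
  have -> : K * nr u * nr k / r * eta = K * (eta * nr u) * nr k / r by ring.
  rewrite ler_wpM2r ?invr_ge0 ?(ltW r0) //.
  have -> : A s - A t = G (x0 + z t *: u + (z s - z t) *: u) k - G (x0 + z t *: u) k.
    by rewrite /A opprB addrA subrK -(addrA x0) -scalerDl subrKC.
  apply: le_trans (lip _ _ _ _ _) _.
  - by rewrite addrAC subrr add0r.
  - exact: le_lt_trans hsu eta1.
  - by rewrite ler_wpM2r ?nr_ge0 // ler_wpM2l.
(* Cauchy's formula differentiated under the integral sign. *)
pose Lam (k : V) := (CofR (2 * pi))^-1 * (P k (2 * pi) - P k 0).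
have lamE k : CofR (2 * pi) * Lam k = P k (2 * pi) - P k 0 by rewrite mulVKf.
have lin : linear Lam.
  move=> a k l.
  suff D : P (a *: k + l) (2 * pi) - P (a *: k + l) 0 =
     (a * P k (2 * pi) + P l (2 * pi)) - (a * P k 0 + P l 0).
    have -> : a *: Lam k = a * Lam k by [].
    by rewrite /Lam D; move: (_^-1) => w; ring.
  apply: (@rder_unique_increment R C _ (fun t => a * P k t + P l t) _ _ _ (ltW pi0) (hP _)).
  move=> t ht; have -> : (G (x0 + z t *: u) (a *: k + l) - G x0 (a *: k + l)) / z t =
     a * ((G (x0 + z t *: u) k - G x0 k) / z t) + (G (x0 + z t *: u) l - G x0 l) / z t.
    by rewrite !Glin; move: (z t)^-1 => w; ring.
  by apply: rderD; [apply: rderM; exact: hP | exact: hP].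
exists Lam; first exact: lin.
(* Two quadratic remainders, at x0 + z u and at x0, are divided by |z| = r; the added 1 keeps [K']
   positive. *)
move=> e e0; pose K' := 2 * K / r + 1.
have K'0 : 0 < K' by rewrite ltr_wpDl // divr_ge0 ?mulr_ge0 // ltW.
exists (Num.min rho (e / K')); first by rewrite lt_min rho0 divr_gt0.
move=> k; rewrite lt_min => /andP[kr]; rewrite ltr_pdivlMr // => ke.
have xk : nr (x0 + k - x0) < rho by rewrite addrAC subrr add0r.
have [U1 hU1 eU1] := reprU _ xk; have [U0 hU0 eU0] := reprU _ x00.
have : nr ((U1 (2 * pi) - U0 (2 * pi) - P k (2 * pi)) - (U1 0 - U0 0 - P k 0)) <=
    (2 * K / r * nr k ^+ 2) * (2 * pi - 0).
  apply: (@mean_value_bound R C (fun t => U1 t - U0 t - P k t)); first exact: ltW.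
  move=> t ht; eexists; first by apply: rderB; [apply: rderB; [exact: hU1|exact: hU0]|exact: hP].
  rewrite -!mulrBl (nrM _ (z t)^-1) nrV nz mulrAC ler_wpM2r ?invr_ge0 ?(ltW r0) //.
  have h1 := rem (x0 + z t *: u) k; have h0 := rem x0 k x00 kr.
  have {}h1 := h1 (_ : nr (x0 + z t *: u - x0) < rho) kr.
  have -> : f (x0 + k + z t *: u) - f (x0 + k) - (f (x0 + z t *: u) - f x0) -
      (G (x0 + z t *: u) k - G x0 k) =
    (f (x0 + z t *: u + k) - f (x0 + z t *: u) - G (x0 + z t *: u) k) -
    (f (x0 + k) - f x0 - G x0 k).
    by rewrite [x0 + k + _]addrAC; ring.
  rewrite (le_trans (nrB _ _)) // -mulrA mulr_natl mulr2n lerD //; apply: h1.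
  by rewrite addrAC subrr add0r.
have -> : U1 (2 * pi) - U0 (2 * pi) - P k (2 * pi) - (U1 0 - U0 0 - P k 0) =
   CofR (2 * pi) * (G (x0 + k) u - G x0 u - Lam k).
  by rewrite !mulrBr lamE -eU1 -eU0; ring.
rewrite nrM nrR gtr0_norm // subr0 mulrC ler_pM2r // => h; apply: le_trans h _.
rewrite expr2 mulrA ler_wpM2r ?nr_ge0 // (le_trans _ (ltW ke)) //.
by rewrite mulrC ler_wpM2l ?nr_ge0 // lerDl.
Qed.

(** Cauchy's formula writes the derivative in the direction [u] as a circle integral of values of
    [f], which can be differentiated in the base point under the integral sign. *)
Lemma diff_direction_diff (f : V -> C) (x0 u : V) : (\forall y \near x0, differentiable f y) ->
  differentiable (fun x => 'd f x u) x0.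
Proof.
move=> /second_order [K [rho [K0 rho0 df lip rem]]].
have u1 : 0 < nr u + 1 by rewrite ltr_wpDl // nr_ge0.
pose r := rho / (nr u + 1); have r0 : 0 < r by rewrite divr_gt0.
have ru : r * nr u < rho by rewrite /r mulrAC ltr_pdivrMr // ltr_pM2l // ltrDl.
have small (z : C) : nr z <= r -> nr (z *: u) < rho.
  by move=> hz; rewrite nrZ; apply: le_lt_trans ru; rewrite ler_wpM2r ?nr_ge0.
have reprU (x : V) : nr (x - x0) < rho -> exists2 U : R -> C,
    (forall t, 0 <= t <= 2 * pi -> rder U t
      ((f (x + (CofR r * cis t) *: u) - f x) / (CofR r * cis t))) &
    U (2 * pi) - U 0 = CofR (2 * pi) * 'd f x u.
  move=> hx; have dl (w : C) : nr w <= r -> differentiable f (x + w *: u).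
    move=> hw; apply: df; rewrite addrAC (le_lt_trans (nrD _ _)) // ltrD //.
    exact: small.
  have dl' (w : C) : nr w <= r -> differentiable (fun w : C => f (x + w *: u)) w.
    by move=> /dl h; exact: (diff_line h).1.
  have [U hU] := cauchy_primitive r0 dl'; exists U.
    by move=> t /hU; rewrite scale0r addr0.
  have r00 : nr (0 : C) <= r by rewrite nr0 ltW.
  rewrite (cauchy_formula r0 dl' hU); congr (_ * _).
  by have [_ ->] := diff_line (dl 0 r00); rewrite scale0r addr0.
have [Lam lin h] := direction_has_diff K0 rho0 r0 ru (diff_linC f) lip rem reprU.
exact: (has_diff_rV lin h).1.
Qed.

End SeveralVariables.

(** * Holomorphic maps between spaces of row vectors *)

Section Holomorphy.
Context {R : realType}.
Local Notation C := (Cx R).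

Lemma nr_row_mx n m (a : 'rV[C]_n) (b : 'rV[C]_m) (K : R) :
  nr a <= K -> nr b <= K -> nr (row_mx a b) <= K.
Proof.
move=> ha hb; have K0 := le_trans (nr_ge0 a) ha.
apply/(nr_rV _ K0) => j; rewrite mxE; case: fintype.split => i.
  exact: le_trans (nr_coord a i) ha.
exact: le_trans (nr_coord b i) hb.
Qed.

Lemma linear_rV_diff n (W : normedModType C) (L : 'rV[C]_n -> W) (lL : linear L) x :
  differentiable L x /\ forall v, 'd L x v = L v.
Proof.
apply: has_diff_rV => // e e0; exists 1 => // h _.
have -> : L (x + h) = L x + L h by have := lL 1 x h; rewrite !scale1r.
rewrite [L x + L h]addrC addrK subrr nr0.
by apply: mulr_ge0; [exact: ltW | exact: nr_ge0].
Qed.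

Lemma has_diff_comp (U V W : normedModType C) (f : U -> V) (g : V -> W) x :
  differentiable f x -> differentiable g (f x) ->
  differentiable (g \o f) x /\ forall v, 'd (g \o f) x v = 'd g (f x) ('d f x v).
Proof.
move=> df dg; split; first exact: (differentiable_comp df dg).
by move=> v; exact: (congr1 (fun F => F v) (diff_comp df dg)).
Qed.

Lemma diff_row_mx n m1 m2 (f : 'rV[C]_n -> 'rV[C]_m1) (g : 'rV[C]_n -> 'rV[C]_m2) x :
  differentiable f x -> differentiable g x ->
  differentiable (fun y => row_mx (f y) (g y)) x /\
  forall v, 'd (fun y => row_mx (f y) (g y)) x v = row_mx ('d f x v) ('d g x v).
Proof.
move=> /diff_has_diff hf /diff_has_diff hg.
apply: (@has_diff_rV _ _ _ (fun y => row_mx (f y) (g y)) (fun v => row_mx ('d f x v) ('d g x v))).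
  move=> a u v; rewrite (linearP ('d f x)) (linearP ('d g x)).
  by rewrite scale_row_mx add_row_mx.
move=> e e0; have [d1 d10 h1] := hf e e0; have [d2 d20 h2] := hg e e0.
exists (Num.min d1 d2); first by rewrite lt_min d10.
move=> h; rewrite lt_min => /andP[/h1 k1 /h2 k2].
by rewrite !opp_row_mx !add_row_mx; exact: nr_row_mx.
Qed.

Lemma holo_diff_at n m (f : 'rV[C]_n -> 'rV[C]_m) x : holo_at f x -> differentiable f x.
Proof. by move=> h; exact: (nbhs_singleton h). Qed.

Lemma holo_near n m (f : 'rV[C]_n -> 'rV[C]_m) x :
  holo_at f x -> \forall y \near x, holo_at f y.
Proof. by move=> h; exact: (nbhs_interior h). Qed.

Lemma holo_continuous n m (f : 'rV[C]_n -> 'rV[C]_m) x : holo_at f x -> {for x, continuous f}.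
Proof. by move=> /holo_diff_at h; exact: differentiable_continuous h. Qed.

Lemma near_all n (x : 'rV[C]_n) (P : 'rV[C]_n -> Prop) : (forall y, P y) -> \forall y \near x, P y.
Proof. by move=> h; apply/nbhs_nrP; exists 1. Qed.

Lemma cont_near n m (f : 'rV[C]_n -> 'rV[C]_m) x (P : 'rV[C]_m -> Prop) :
  {for x, continuous f} -> (\forall y \near f x, P y) -> \forall y \near x, P (f y).
Proof. move=> h1 h2; exact (h1 P h2). Qed.

Lemma holo_ext n m (f g : 'rV[C]_n -> 'rV[C]_m) x : {near x, f =1 g} -> holo_at g x -> holo_at f x.
Proof.
move=> /nbhs_interior E hg; apply: filterS2 E hg => y Ey dg; exact: (near_eq_diff Ey dg).1.
Qed.

Lemma holo_comp n m p (f : 'rV[C]_n -> 'rV[C]_m) (g : 'rV[C]_m -> 'rV[C]_p) x :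
  holo_at f x -> holo_at g (f x) -> holo_at (g \o f) x.
Proof.
move=> hf hg.
have hg' := cont_near (holo_continuous hf) hg.
apply: filterS2 hg' hf => y dg df; exact: (has_diff_comp df dg).1.
Qed.

Lemma holo_linear n m (L : 'rV[C]_n -> 'rV[C]_m) x : linear L -> holo_at L x.
Proof. by move=> lL; apply: near_all => y; exact: (linear_rV_diff lL y).1. Qed.

Lemma holo_cst n m (c : 'rV[C]_m) (x : 'rV[C]_n) : holo_at (fun=> c) x.
Proof. by apply: near_all => y; exact: differentiable_cst. Qed.

Lemma holo_row_mx n m1 m2 (f : 'rV[C]_n -> 'rV[C]_m1) (g : 'rV[C]_n -> 'rV[C]_m2) x :
  holo_at f x -> holo_at g x -> holo_at (fun y => row_mx (f y) (g y)) x.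
Proof.
move=> hf hg; apply: filterS2 hf hg => y df dg; exact: (diff_row_mx df dg).1.
Qed.

Lemma linear_lsubmx n m : linear (@lsubmx C 1 n m).
Proof. by move=> a u v; rewrite linearP. Qed.

Lemma linear_rsubmx n m : linear (@rsubmx C 1 n m).
Proof. by move=> a u v; rewrite linearP. Qed.

Lemma diff_coordinates n m (f : 'rV[C]_n -> 'rV[C]_m) x :
  (forall j, differentiable (fun y => f y 0 j) x) -> differentiable f x.
Proof.
move=> df.
suff h : has_diff f x (fun v => \row_j 'd (fun y => f y 0 j) x v).
  apply: (has_diff_rV _ h).1 => a u v; apply/rowP => j; rewrite !mxE.
  exact: (linearP ('d (fun y => f y 0 j) x) a u v).
move=> e e0.
have /choice[d hd] : forall j, exists d : R, 0 < d /\ forall h, nr h < d ->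
    nr (f (x + h) 0 j - f x 0 j - 'd (fun y => f y 0 j) x h) <= e * nr h.
  by move=> j; have [d d0 hd] := diff_has_diff (df j) e0; exists d.
exists (\big[Num.min/1]_j d j).
  by apply: lt_bigmin => // j _; exact: (hd j).1.
move=> h hh; apply/(nr_rV _ _); first by rewrite mulr_ge0 ?nr_ge0 // ltW.
move=> j; rewrite !mxE; apply: (hd j).2; apply: lt_le_trans hh _.
exact: bigmin_le_cond.
Qed.

Lemma diff_coordinate n m (f : 'rV[C]_n -> 'rV[C]_m) x j : differentiable f x ->
  differentiable (fun y => f y 0 j) x /\ forall v, 'd (fun y => f y 0 j) x v = 'd f x v 0 j.
Proof.
move=> df; have lc : linear (fun w : 'rV[C]_m => w 0 j : C) by move=> a u v; rewrite !mxE.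
have [d1 e1] := linear_rV_diff lc (f x).
have [d2 e2] := has_diff_comp df d1; split; first exact: d2.
by move=> v; rewrite -(e1 ('d f x v)) -(e2 v).
Qed.

Lemma linear_form_expand n (L : 'rV[C]_n -> C) v :
  (forall (a : C) k l, L (a *: k + l) = a * L k + L l) ->
  L v = \sum_(i < n) v 0 i * L (delta_mx 0 i).
Proof.
move=> lL; rewrite [v in LHS]row_sum_delta.
have L0 : L 0 = 0.
  by have := lL 0 0 0; rewrite scale0r add0r mul0r add0r => ->; have := lL (-1) 0 0; rewrite scaler0 addr0 mulN1r addNr.
elim/big_rec2: _ => [|i y x _ IH]; first exact: L0.
by rewrite lL IH.
Qed.

(** Coordinatewise, a finite sum of products of an entry of the vector and a partial derivative.
    Holomorphy of tangent maps, and stability of C^k under composition, rest on it. *)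
Lemma holo_derivative n m (f : 'rV[C]_n -> 'rV[C]_m) x b : holo_at f x ->
  holo_at (fun w : 'rV[C]_(n + n) => 'd f (lsubmx w) (rsubmx w)) (row_mx x b).
Proof.
move=> hf; have hl w : {for w, continuous (@lsubmx C 1 n n)}.
  by apply: holo_continuous; apply: holo_linear; exact: linear_lsubmx.
have hf' : \forall y \near lsubmx (row_mx x b), holo_at f y.
  by rewrite row_mxKl; exact: holo_near.
apply: filterS (cont_near (hl _) hf') => w hw.
apply: diff_coordinates => j.
have hj : \forall y \near lsubmx w, differentiable (fun y => f y 0 j) y.
  by apply: filterS hw => y dy; exact: (diff_coordinate j dy).1.
pose F (w : 'rV[C]_(n + n)) : C := \sum_(i < n)
  (rsubmx w) 0 i * 'd (fun y => f y 0 j) (lsubmx w) (delta_mx 0 i).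
have E : {near w, (fun w => 'd f (lsubmx w) (rsubmx w) 0 j) =1 F}.
  apply: filterS (cont_near (hl _) hw) => w' dw; rewrite /F.
  rewrite -(diff_coordinate j dw).2.
  exact: (linear_form_expand _ (diff_linC (fun y => f y 0 j) (lsubmx w'))).
apply: (near_eq_diff E _).1.
have -> : F = \sum_(i < n) (fun w : 'rV[C]_(n + n) => rsubmx w 0 i *
    'd (fun y => f y 0 j) (lsubmx w) (delta_mx 0 i)).
  by apply/funext => w'; rewrite fct_sumE.
apply: differentiable_sum => i.
have lc : linear (fun w : 'rV[C]_(n + n) => rsubmx w 0 i : C).
  by move=> a u v; rewrite !mxE.
apply: (differentiableM (linear_rV_diff lc w).1).
have dl := (linear_rV_diff (@linear_lsubmx n n) w).1.
exact: (differentiable_comp dl (diff_direction_diff (delta_mx 0 i) hj)).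
Qed.

End Holomorphy.

(** * Composition of smooth and holomorphic maps *)

Section SmoothMaps.
Context {R : realType}.
Local Notation C := (Cx R).

(** From a limit of quotients over a punctured neighbourhood to the multiplied-out form, in which t
    = 0 is no exception. *)
Lemma real_derivP n m (f : 'rV[C]_n -> 'rV[C]_m) v x l :
  real_deriv f v x l <-> rder (fun t => f (x + CofR t *: v)) 0 l.
Proof.
have key (t : R) : t != 0 -> nr (f (x + CofR t *: v) - f x - CofR t *: l) =
    `|t| * nr ((CofR t)^-1 *: (f (x + CofR t *: v) - f x) - l).
  move=> t0; have t0' : CofR t != 0 :> C by rewrite -CofR0 (inj_eq (@CofR_inj R)).
  by rewrite -(nrR t) -nrZ scalerBr scalerA mulfV // scale1r.
split.
  move=> h e e0; have /h h' : nbhs l [set y | nr (y - l) < e] by apply/nbhs_nrP; exists e.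
  have /nbhs_ballP [d /= d0 hd] : nbhs (0 : R) [set t : R | t != 0 ->
    nr ((CofR t)^-1 *: (f (x + CofR t *: v) - f x) - l) < e] := h'.
  exists d => // t.
  rewrite subr0 CofR0 scale0r addr0 => td.
  have [->|t0] := eqVneq t 0.
    by rewrite CofR0 scale0r addr0 subrr scale0r subr0 nr0 normr0 mulr0.
  rewrite key // mulrC ler_wpM2r //; apply/ltW/hd => //.
  by rewrite /ball /= sub0r normrN.
move=> h P /nbhs_nrP [e e0 he].
have e2 : 0 < e / 2 by rewrite divr_gt0.
have [d d0 hd] := h _ e2; apply/nbhs_ballP; exists d => //= t.
rewrite /ball /= sub0r normrN => td t0; apply: he.
have := hd t; rewrite subr0 CofR0 scale0r addr0 => /(_ td).
rewrite key // mulrC ler_pM2r ?normr_gt0 // => h'.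
by apply: le_lt_trans h' _; rewrite ltr_pdivrMr // ltr_pMr // ltr1n.
Qed.

Lemma rder_comp (V W : normedModType C) (u : R -> V) (h : V -> W) t l :
  rder u t l -> differentiable h (u t) -> rder (h \o u) t ('d h (u t) l).
Proof.
move=> hu dh e e0; pose L := 'd h (u t).
have [M M0 hM] : exists2 M : R, 0 < M & forall v, nr (L v) <= M * nr v.
  have [M] := linear_lipschitz (diff_continuous dh).
  case: M => a b; rewrite ltcE /= => /andP[/eqP -> a0] hM; exists a => // v.
  by have := hM v; rewrite !nrE -CofR_le CofRM.
have l1 : 0 < nr l + 1 by rewrite ltr_wpDl // nr_ge0.
have e1 : 0 < e / (2 * (nr l + 1)) by rewrite divr_gt0 // mulr_gt0.
have [d1 d10 h1] := diff_has_diff dh e1.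
pose e2 := Num.min 1 (e / (2 * M)).
have e20 : 0 < e2 by rewrite lt_min ltr01 divr_gt0 // mulr_gt0.
have e21 : e2 <= 1 by rewrite ge_min lexx.
have e22 : M * e2 <= e / 2.
  have : e2 <= e / (2 * M) by rewrite ge_min lexx orbT.
  by rewrite ler_pdivlMr ?mulr_gt0 //; lra.
move: e2 e20 e21 e22 => e2 e20 e21 e22.
have [d2 d20 h2] := hu _ e20.
exists (Num.min d2 (d1 / (nr l + 1))); first by rewrite lt_min d20 divr_gt0.
move=> s; rewrite lt_min ltr_pdivlMr // => /andP[s2 s1].
set k := u s - u t; have hk := h2 s s2; rewrite -/k in hk.
have nk : nr k <= `|s - t| * (nr l + 1).
  rewrite -(subrK (CofR (s - t) *: l) k) (le_trans (nrD _ _)) // nrZ nrR.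
  have := ler_wpM2r (normr_ge0 (s - t)) e21; rewrite mul1r => hh.
  by move: hk hh; lra.
have := h1 k (le_lt_trans nk s1); rewrite /k subrKC -/k => h3.
have -> : (h \o u) s - (h \o u) t - CofR (s - t) *: L l =
    (h (u s) - h (u t) - L k) + L (k - CofR (s - t) *: l).
  have -> : k - CofR (s - t) *: l = (- CofR (s - t)) *: l + k by rewrite scaleNr addrC.
  have -> : L ((- CofR (s - t)) *: l + k) = (- CofR (s - t)) *: L l + L k.
    exact: (linearP ('d h (u t))).
  by rewrite scaleNr [_ + L k]addrC addrA subrK.
apply: le_trans (nrD _ _) _.
have b1 : e / (2 * (nr l + 1)) * nr k <= e / 2 * `|s - t|.
  apply: le_trans (ler_wpM2l (ltW e1) nk) _.
  by have -> : e / (2 * (nr l + 1)) * (`|s - t| * (nr l + 1)) = e / 2 * `|s - t|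
    by field; rewrite gt_eqF.
have b2 : nr (L (k - CofR (s - t) *: l)) <= e / 2 * `|s - t|.
  apply: le_trans (hM _) _; apply: le_trans (ler_wpM2l (ltW M0) hk) _.
  by rewrite mulrA ler_wpM2r.
by apply: le_trans (lerD (le_trans h3 b1) b2) _; rewrite -mulrDl -splitr.
Qed.

Lemma rder_ext (W : normedModType C) (u v : R -> W) t l :
  (exists2 d : R, 0 < d & forall s, `|s - t| < d -> u s = v s) -> rder v t l -> rder u t l.
Proof.
move=> [d d0 E] hv e /hv [d' d'0 h]; exists (Num.min d d'); first by rewrite lt_min d0.
move=> s; rewrite lt_min => /andP[s1 s2]; rewrite (E s s1) (E t) ?subrr ?normr0 //.
exact: h.
Qed.

Lemma rder_row_mx m1 m2 (u : R -> 'rV[C]_m1) (v : R -> 'rV[C]_m2) t l k :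
  rder u t l -> rder v t k -> rder (fun s => row_mx (u s) (v s)) t (row_mx l k).
Proof.
move=> hu hv e e0; have [d1 d10 h1] := hu e e0; have [d2 d20 h2] := hv e e0.
exists (Num.min d1 d2); first by rewrite lt_min d10.
move=> s; rewrite lt_min => /andP[/h1 k1 /h2 k2].
by rewrite scale_row_mx !opp_row_mx !add_row_mx; exact: nr_row_mx.
Qed.

Lemma Ck_sub k n m (U U' : set 'rV[C]_n) (f : 'rV[C]_n -> 'rV[C]_m) :
  U' `<=` U -> Ck k U f -> Ck k U' f.
Proof.
elim: k f => [|k IH] f sU [cf hf].
  by split; [move=> x U'x; exact: (cf x (sU x U'x)) |].
split; first by move=> x U'x; exact: (cf x (sU x U'x)).
move=> v; have [g hg ckg] := hf v; exists g; last exact: IH.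
by move=> x U'x; exact: (hg x (sU x U'x)).
Qed.

Lemma continuous_ext n m (f g : 'rV[C]_n -> 'rV[C]_m) x : {near x, f =1 g} ->
  {for x, continuous f} -> {for x, continuous g}.
Proof.
move=> /nbhs_nrP [d' d'0 E] /continuous_nrP cf; apply/continuous_nrP => e e0.
have [d d0 hd] := cf e e0; exists (Num.min d d'); first by rewrite lt_min d0.
by move=> y; rewrite lt_min => /andP[/hd h1 /E <-]; rewrite -(E x) // subrr nr0.
Qed.

Lemma Ck_ext k n m (U : set 'rV[C]_n) (f g : 'rV[C]_n -> 'rV[C]_m) :
  open U -> (forall x, U x -> f x = g x) -> Ck k U f -> Ck k U g.
Proof.
move=> oU E ck.
have Un x : U x -> \forall y \near x, U y by move=> Ux; exact: (open_nbhs_nbhs (conj oU Ux)).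
have cg x : U x -> {for x, continuous g}.
  move=> Ux; apply: (continuous_ext (f := f)); first by apply: filterS (Un x Ux) => y /E.
  by case: k ck => [|k] [cf _]; exact: (cf x Ux).
case: k ck => [|k] [cf hf]; first by split; [exact: cg |].
split; first exact: cg.
move=> v; have [f' hf' ckf'] := hf v; exists f'; last exact: ckf'.
move=> x Ux.
apply/real_derivP; have /real_derivP := hf' x Ux; apply: rder_ext.
have [d d0 hd] := (nbhs_nrP x U).1 (Un x Ux).
have v1 : 0 < nr v + 1 by rewrite ltr_wpDl // nr_ge0.
exists (d / (nr v + 1)); first exact: divr_gt0.
move=> s; rewrite subr0 ltr_pdivlMr // => hs; apply/esym/E/hd.
rewrite addrAC subrr add0r nrZ nrR; apply: le_lt_trans hs.
by rewrite ler_wpM2l // lerDl.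
Qed.

Lemma CkS k n m (U : set 'rV[C]_n) (f : 'rV[C]_n -> 'rV[C]_m) : Ck k.+1 U f -> Ck k U f.
Proof.
elim: k f => [|k IH] f [cf hf]; first by split; [exact: cf |].
by split; [exact: cf | move=> v; have [g hg ckg] := hf v; exists g; [exact: hg | exact: IH]].
Qed.

Lemma continuous_row_mx n m1 m2 (f : 'rV[C]_n -> 'rV[C]_m1) (g : 'rV[C]_n -> 'rV[C]_m2) x :
  {for x, continuous f} -> {for x, continuous g} ->
  {for x, continuous (fun y => row_mx (f y) (g y))}.
Proof.
move=> /continuous_nrP cf /continuous_nrP cg; apply/continuous_nrP => e e0.
have e2 : 0 < e / 2 by rewrite divr_gt0.
have [d1 d10 h1] := cf _ e2; have [d2 d20 h2] := cg _ e2.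
exists (Num.min d1 d2); first by rewrite lt_min d10.
move=> y; rewrite lt_min => /andP[/h1 k1 /h2 k2].
rewrite opp_row_mx add_row_mx; apply: (@le_lt_trans _ _ (e / 2)).
  by apply: nr_row_mx; exact: ltW.
by rewrite ltr_pdivrMr // ltr_pMr // ltr1n.
Qed.

Lemma Ck_row_mx k n m1 m2 (U : set 'rV[C]_n) (f : 'rV[C]_n -> 'rV[C]_m1) (g : 'rV[C]_n -> 'rV[C]_m2) :
  Ck k U f -> Ck k U g -> Ck k U (fun x => row_mx (f x) (g x)).
Proof.
elim: k f g => [|k IH] f g [cf hf] [cg hg].
  split; last by [].
  by move=> x Ux; exact: (continuous_row_mx (cf x Ux) (cg x Ux)).
split=> [x Ux|v]; first exact: (continuous_row_mx (cf x Ux) (cg x Ux)).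
have [f' hf' kf'] := hf v; have [g' hg' kg'] := hg v.
exists (fun x => row_mx (f' x) (g' x)); last exact: IH.
move=> x Ux; apply/real_derivP; apply: rder_row_mx; apply/real_derivP.
  exact: (hf' x Ux).
exact: (hg' x Ux).
Qed.

Lemma continuous_comp_rV n m p (f : 'rV[C]_n -> 'rV[C]_m) (h : 'rV[C]_m -> 'rV[C]_p) x :
  {for x, continuous f} -> {for f x, continuous h} -> {for x, continuous (h \o f)}.
Proof. move=> cf ch; exact (continuous_comp cf ch). Qed.

(** The derivative of the composite along [v] is again a composite: the holomorphic map (y, b) |->
    dh_y(b) after the pair of [f] and its derivative. The induction thus doubles the intermediate
    dimension and has to be general in it. *)
Lemma Ck_comp k n m p (U : set 'rV[C]_n) (f : 'rV[C]_n -> 'rV[C]_m) (h : 'rV[C]_m -> 'rV[C]_p) :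
  (forall x, U x -> holo_at h (f x)) -> Ck k U f -> Ck k U (h \o f).
Proof.
elim: k m f h => [|k IH] m f h hh [cf hf].
  split; last by [].
  by move=> x Ux; exact: (continuous_comp_rV (cf x Ux) (holo_continuous (hh x Ux))).
split=> [x Ux|v].
  exact: (continuous_comp_rV (cf x Ux) (holo_continuous (hh x Ux))).
have [g hg kg] := hf v.
exists ((fun w : 'rV[C]_(m + m) => 'd h (lsubmx w) (rsubmx w)) \o (fun x => row_mx (f x) (g x))).
  move=> x Ux; apply/real_derivP; rewrite /= row_mxKl row_mxKr.
  have /real_derivP h1 := hg x Ux.
  have := @rder_comp _ _ (fun t => f (x + CofR t *: v)) h 0 (g x) h1.
  by rewrite CofR0 scale0r addr0; apply; exact: holo_diff_at (hh x Ux).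
apply: IH; first by move=> x Ux; exact: holo_derivative (hh x Ux).
by apply: Ck_row_mx; [apply: CkS; split; [exact: cf | exact: hf] | exact: kg].
Qed.

Lemma smooth_fun_ext n m (f g : 'rV[C]_n -> 'rV[C]_m) x :
  {near x, f =1 g} -> smooth_fun_at f x -> smooth_fun_at g x.
Proof.
move=> E [U [oU Ux] ckf]; pose U' := U `&` interior [set y | f y = g y].
have oU' : open U' by apply: openI => //; exact: open_interior.
exists U'; first by split=> //; split=> //; exact: E.
move=> k; apply: (@Ck_ext _ _ _ _ f) => // [y [_ /interior_subset //]|].
by apply: (Ck_sub _ (ckf k)) => y [].
Qed.

(** A single open set has to serve all orders [k]; it is cut down once, to the points whose image is
    a point of holomorphy of [h]. *)
Lemma smooth_fun_comp n m p (f : 'rV[C]_n -> 'rV[C]_m) (h : 'rV[C]_m -> 'rV[C]_p) x :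
  smooth_fun_at f x -> holo_at h (f x) -> smooth_fun_at (h \o f) x.
Proof.
move=> [U [oU Ux] ckf] hh.
have cf y : U y -> {for y, continuous f} by move=> Uy; exact: (ckf 0%N).1.
pose U' := U `&` [set y | holo_at h (f y)].
have Uop : open U'.
  rewrite openE => y [Uy hy]; apply: filterI; first exact: (open_nbhs_nbhs (conj oU Uy)).
  exact: cont_near (cf y Uy) (holo_near hy).
exists U'; first by split.
by move=> k; apply: Ck_comp => [y []|] //; apply: (Ck_sub _ (ckf k)) => y [].
Qed.

End SmoothMaps.

(** * Holomorphic maps between manifolds *)

Section ManifoldCore.
Context {R : realType}.
Local Notation C := (Cx R).
Implicit Types X Y Z : premanifold R.

(* Quotients and tangent bundles are only needed with this part of
   [is_complex_manifold]: Hausdorffness and countability play no role. *)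
Definition holo_atlas X : Prop :=
  [/\ (forall x, exists2 c, atlas X c & cdom c x),
      (forall c, atlas X c ->
         open (cmap c @` cdom c) /\ {in cdom c, cancel (cmap c) (cinv c)}) &
      (forall c c', atlas X c -> atlas X c' ->
         open (cmap c @` (cdom c `&` cdom c')) /\
         forall x, cdom c x -> cdom c' x ->
           holo_at (cmap c' \o cinv c) (cmap c x))].

Lemma manifold_holo_atlas X : is_complex_manifold X -> holo_atlas X.
Proof. by case. Qed.

Section Charts.
Context {X} (hX : holo_atlas X).
Local Notation ch := (chart R X (mdim X)).
Implicit Types (c d : ch) (x : X).

Lemma cinvK c x : atlas X c -> cdom c x -> cinv c (cmap c x) = x.
Proof. by have [_ + _] := hX => /[apply] -[_ h] cx; apply: h; exact: mem_set. Qed.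

Lemma chart_image c w : atlas X c -> (cmap c @` cdom c) w -> cdom c (cinv c w) /\ cmap c (cinv c w) = w.
Proof. by move=> ac [x cx <-]; rewrite cinvK. Qed.

Lemma chart_image_near c x : atlas X c -> cdom c x ->
  \forall w \near cmap c x, (cmap c @` cdom c) w.
Proof.
move=> ac cx; have [_ h _] := hX; have [oc _] := h c ac.
by apply: open_nbhs_nbhs; split=> //; exists x.
Qed.

Lemma cinv_near c x : atlas X c -> cdom c x ->
  \forall w \near cmap c x, cdom c (cinv c w) /\ cmap c (cinv c w) = w.
Proof. by move=> ac cx; apply: filterS (chart_image_near ac cx) => w; exact: chart_image. Qed.

(** The atlas topology tests a set in every chart [d], where this one is the preimage of [W] under
    the transition map. *)
Lemma chart_open_inter c (W : set 'rV[C]_(mdim X)) : atlas X c -> open W ->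
  mopen (cdom c `&` cmap c @^-1` W).
Proof.
move=> ac oW d ad; have [_ _ h] := hX; have [od hd] := h d c ad ac.
exists ((cmap d @` (cdom d `&` cdom c)) `&` (cmap c \o cinv d) @^-1` W).
  rewrite openE => w [[x [dx cx] <-] Ww]; apply: filterI.
    by apply: open_nbhs_nbhs; split=> //; exists x.
  have hc := holo_continuous (hd x dx cx).
  by apply: (cont_near hc); exact: open_nbhs_nbhs.
apply/seteqP; split=> x /=.
  by move=> [[cx Wx] dx]; split=> //; split; [exists x | rewrite cinvK].
move=> [dx [[y [dy cy] e] +]]; have <- : y = x by rewrite -(cinvK ad dx) -e cinvK.
by rewrite cinvK.
Qed.

Lemma cdom_open c : atlas X c -> open (cdom c : set (pt X)).
Proof.
move=> ac; have := chart_open_inter ac openT.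
by rewrite preimage_setT setIT.
Qed.

Lemma cdom_near c x : atlas X c -> cdom c x -> \forall x' \near x, cdom c x'.
Proof. by move=> ac cx; apply: open_nbhs_nbhs; split=> //; exact: cdom_open. Qed.

Lemma cmap_near c x (P : set 'rV[C]_(mdim X)) : atlas X c -> cdom c x ->
  (\forall w \near cmap c x, P w) -> \forall x' \near x, P (cmap c x').
Proof.
move=> ac cx /nbhs_interior; rewrite nbhsE /= => -[W [oW Wx] WP].
have : open_nbhs x (cdom c `&` cmap c @^-1` W).
  by split; [exact: chart_open_inter | split].
move=> /open_nbhs_nbhs; apply: filterS => y [_ /WP]; exact: nbhs_singleton.
Qed.

Lemma cinv_cont c x (O : set X) : atlas X c -> cdom c x ->
  (\forall x' \near x, O x') -> \forall w \near cmap c x, O (cinv c w).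
Proof.
move=> ac cx hO.
have [U [oU Ux] UO] : exists2 U, open_nbhs (x : pt X) U & U `<=` O.
  by have : nbhs (x : pt X) O := hO; rewrite nbhsE.
have [W oW e] := oU c ac.
have Wx : W (cmap c x) by have [_] : (cdom c `&` cmap c @^-1` W) x by rewrite -e.
apply: filterS2 (chart_image_near ac cx) (open_nbhs_nbhs (conj oW Wx)) => w [y cy <-] Wy.
by rewrite cinvK //; apply: UO; have [] : (U `&` cdom c) y by rewrite e.
Qed.

Lemma chart_atP x : atlas X (chart_at x) /\ cdom (chart_at x) x.
Proof.
rewrite /chart_at; case: pselect => [e|]; first by case: (cid e).
by case; have [h _ _] := hX; have [c ac cx] := h x; exists c.
Qed.

Lemma chart_at_atlas x : atlas X (chart_at x). Proof. exact: (chart_atP x).1. Qed.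
Lemma transition_holo c d x : atlas X c -> atlas X d -> cdom c x -> cdom d x ->
  holo_at (cmap d \o cinv c) (cmap c x).
Proof. by move=> ac ad cx dx; have [_ _ h] := hX; exact: (h c d ac ad).2. Qed.

End Charts.

Definition idchart n : chart R (affM (R:=R) n) n := Chart [set: 'rV[C]_n] id id.

Lemma affM_atlas n : holo_atlas (affM (R:=R) n).
Proof.
split=> [x|c ->|c c' -> -> /=]; first by exists (Chart [set: 'rV[C]_n] id id).
  by split=> //=; rewrite image_id; exact: openT.
split=> [|x _ _]; first by rewrite image_id setIT; exact: openT.
by apply: holo_linear => a u v.
Qed.

Lemma affM_near n (x : affM (R:=R) n) (P : set 'rV[C]_n) :
  (\forall y \near (x : pt (affM n)), P y) <-> (\forall y \near (x : 'rV[C]_n), P y).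
Proof.
have ac : atlas (affM n) (idchart n) by [].
split=> h; first exact: (@cinv_cont _ (affM_atlas n) (idchart n) x P ac I h).
exact: (@cmap_near _ (affM_atlas n) (idchart n) x P ac I h).
Qed.

Lemma chart_at_affM n (x : affM (R:=R) n) : chart_at x = idchart n.
Proof. exact: chart_at_atlas (affM_atlas n) x. Qed.

Lemma hol_near_pre X Y (f : X -> Y) x (P : set Y) : {for x, continuous f} ->
  (\forall y \near f x, P y) -> \forall x' \near x, P (f x').
Proof. by move=> h1 h2; exact: (h1 P h2). Qed.

Lemma hol_cont X Y (f : X -> Y) x : holomorphic_at f x -> {for x, continuous f}.
Proof. by case. Qed.

Lemma local_rep_near X Y (hX : holo_atlas X) (hY : holo_atlas Y) (f : X -> Y) x c c' :
  {for x, continuous f} -> atlas X c -> atlas Y c' -> cdom c x -> cdom c' (f x) ->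
  \forall w \near cmap c x, cdom c (cinv c w) /\ cdom c' (f (cinv c w)).
Proof.
move=> cf ac ac' cx cfx.
apply: (@cinv_cont X hX c x (cdom c `&` f @^-1` cdom c') ac cx).
apply: filterI; first exact: (cdom_near hX ac cx).
exact: hol_near_pre cf (cdom_near hY ac' cfx).
Qed.

(** Holomorphy includes continuity and quantifies over all pairs of charts; transition maps reduce
    everything to one pair, once [f] is known to stay in the domain of [c'] near [x]. *)
Lemma hol_by_chart X Y (hX : holo_atlas X) (hY : holo_atlas Y) (f : X -> Y) x c c' :
  atlas X c -> atlas Y c' -> cdom c x -> cdom c' (f x) ->
  (\forall x' \near x, cdom c' (f x')) ->
  holo_at (cmap c' \o f \o cinv c) (cmap c x) -> holomorphic_at f x.
Proof.
move=> ac ac' cx cfx nf hf.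
have cf : {for x, continuous f}.
  move=> P hP; have h1 := cinv_cont hY ac' cfx hP.
  have h2 : \forall w \near cmap c x, P (cinv c' ((cmap c' \o f \o cinv c) w)).
    apply: (@cont_near R _ _ _ _ (fun w => P (cinv c' w)) (holo_continuous hf)).
    by rewrite /= (cinvK hX ac cx).
  have h3 := @cmap_near X hX c x (fun w => P (cinv c' ((cmap c' \o f \o cinv c) w))) ac cx h2.
  have : nbhs (x : pt X) (f @^-1` P); last by [].
  apply: filterS (filterI h3 (filterI nf (cdom_near hX ac cx))) => x' [k1 [k2 k3]].
  by move: k1; rewrite /= (cinvK hX ac k3) (cinvK hY ac' k2).
split=> // d d' ad ad' dx dfx.
have t1 := transition_holo hX ad ac dx cx.
have t2 := transition_holo hY ac' ad' cfx dfx.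
have e0 : (cmap c \o cinv d) (cmap d x) = cmap c x by rewrite /= (cinvK hX ad dx).
have e1 : (cmap c' \o f \o cinv c) (cmap c x) = cmap c' (f x) by rewrite /= (cinvK hX ac cx).
rewrite -e1 in t2; have h2 := holo_comp hf t2; rewrite -e0 in h2.
apply: holo_ext (holo_comp t1 h2).
have n0 : \forall x' \near x, (cdom c `&` f @^-1` cdom c') x'.
  by apply: filterI; [exact: (cdom_near hX ac cx) | exact: nf].
have n1 := @cinv_cont X hX d x (cdom c `&` f @^-1` cdom c') ad dx n0.
apply: filterS n1 => w [cw fw] /=.
by rewrite (cinvK hX ac cw) (cinvK hY ac' fw).
Qed.

Lemma hol_comp X Y Z (hX : holo_atlas X) (hY : holo_atlas Y) (f : X -> Y) (g : Y -> Z) x :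
  holomorphic_at f x -> holomorphic_at g (f x) -> holomorphic_at (g \o f) x.
Proof.
move=> [cf hf] [cg hg]; split.
  by move=> P hP; apply: (cf _ (cg P hP)).
move=> c d ac ad cx dx; have [c' ac' cfx] := (let: And3 h _ _ := hY in h) (f x).
have e : (cmap c' \o f \o cinv c) (cmap c x) = cmap c' (f x) by rewrite /= (cinvK hX ac cx).
have h2 := hg c' d ac' ad cfx dx; rewrite -e in h2.
apply: holo_ext (holo_comp (hf c c' ac ac' cx cfx) h2).
apply: filterS (local_rep_near hX hY cf ac ac' cx cfx) => w [_ fw] /=.
by rewrite (cinvK hY ac' fw).
Qed.

Lemma smooth_hol_comp X Y Z (hX : holo_atlas X) (hY : holo_atlas Y) (f : X -> Y) (g : Y -> Z) x :
  smooth_at f x -> holomorphic_at g (f x) -> smooth_at (g \o f) x.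
Proof.
move=> [cf hf] [cg hg]; split.
  by move=> P hP; apply: (cf _ (cg P hP)).
move=> c d ac ad cx dx; have [c' ac' cfx] := (let: And3 h _ _ := hY in h) (f x).
have e : (cmap c' \o f \o cinv c) (cmap c x) = cmap c' (f x) by rewrite /= (cinvK hX ac cx).
have h2 := hg c' d ac' ad cfx dx; rewrite -e in h2.
apply: smooth_fun_ext (smooth_fun_comp (hf c c' ac ac' cx cfx) h2).
apply: filterS (local_rep_near hX hY cf ac ac' cx cfx) => w [_ fw] /=.
by rewrite (cinvK hY ac' fw).
Qed.

Lemma cont_mext X Y (f g : X -> Y) x : {near x, f =1 g} ->
  {for x, continuous f} -> {for x, continuous g}.
Proof.
move=> E cf P hP; have e : f x = g x := nbhs_singleton E.
rewrite -e in hP; apply: filterS2 E (cf P hP) => y; rewrite /= => <- //.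
Qed.

Lemma hol_ext X Y (hX : holo_atlas X) (f g : X -> Y) x : {near x, f =1 g} ->
  holomorphic_at f x -> holomorphic_at g x.
Proof.
move=> E [cf hf]; split; first exact: cont_mext E cf.
have e : f x = g x := nbhs_singleton E.
move=> c d ac ad cx; rewrite -e => dx; apply: holo_ext (hf c d ac ad cx dx).
by apply: filterS (cinv_cont hX ac cx E) => w /= ->.
Qed.

Lemma smooth_ext X Y (hX : holo_atlas X) (f g : X -> Y) x : {near x, f =1 g} ->
  smooth_at f x -> smooth_at g x.
Proof.
move=> E [cf hf]; split; first exact: cont_mext E cf.
have e : f x = g x := nbhs_singleton E.
move=> c d ac ad cx; rewrite -e => dx; apply: smooth_fun_ext (hf c d ac ad cx dx).
by apply: filterS (cinv_cont hX ac cx E) => w /= ->.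
Qed.

Lemma hol_id X (hX : holo_atlas X) x : holomorphic_at (@id X) x.
Proof.
split=> [P //|c d ac ad cx dx]; exact: (transition_holo hX ac ad cx dx).
Qed.

Lemma mnear_all X (x : X) (P : X -> Prop) : (forall y, P y) -> \forall y \near x, P y.
Proof. by move=> h; apply: (filterS (fun y _ => h y)); exact: filterT. Qed.

Lemma hol_cst X Y (hX : holo_atlas X) (y : Y) x : holomorphic_at (fun _ : X => y) x.
Proof.
split=> [|c d ac ad cx dx]; last exact: holo_cst.
move=> P hP; have Py : P y := nbhs_singleton hP.
exact: (@mnear_all X x (fun=> P y)).
Qed.

Lemma hol_cmap X (hX : holo_atlas X) c x : atlas X c -> cdom c x ->
  @holomorphic_at R X (affM (mdim X)) (cmap c) x.
Proof.
move=> ac cx; apply: (hol_by_chart hX (affM_atlas _) ac (_ : atlas (affM _) (idchart _)) cx) => //.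
  exact: mnear_all.
have : holo_at (@id 'rV[C]_(mdim X)) (cmap c x) by apply: holo_linear.
by apply: holo_ext; apply: filterS (cinv_near hX ac cx) => w [].
Qed.

Lemma hol_cinv X (hX : holo_atlas X) c x : atlas X c -> cdom c x ->
  @holomorphic_at R (affM (mdim X)) X (cinv c) (cmap c x).
Proof.
move=> ac cx; apply: (hol_by_chart (affM_atlas _) hX (_ : atlas (affM _) (idchart _)) ac) => //.
- by rewrite (cinvK hX ac cx).
- apply/affM_near; exact: (@cinv_cont X hX c x (cdom c) ac cx (cdom_near hX ac cx)).
have : holo_at (@id 'rV[C]_(mdim X)) (cmap c x) by apply: holo_linear.
by apply: holo_ext; apply: filterS (cinv_near hX ac cx) => w [].
Qed.

Lemma hol_affM n m (f : 'rV[C]_n -> 'rV[C]_m) x :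
  @holomorphic_at R (affM n) (affM m) f x <-> holo_at f x.
Proof.
split=> [[_ h]|h]; first exact: (h (idchart n) (idchart m)).
apply: (hol_by_chart (affM_atlas n) (affM_atlas m) (_ : atlas (affM n) (idchart _))
  (_ : atlas (affM m) (idchart _))) => //.
exact: (@mnear_all (affM n) x).
Qed.

Lemma hol_near X Y (hX : holo_atlas X) (hY : holo_atlas Y) (f : X -> Y) x :
  holomorphic_at f x -> \forall x' \near x, holomorphic_at f x'.
Proof.
move=> [cf hf]; have [ac cx] := chart_atP hX x; have [ac' cfx] := chart_atP hY (f x).
have h1 := cmap_near hX ac cx (holo_near (hf _ _ ac ac' cx cfx)).
have h2 := hol_near_pre cf (cdom_near hY ac' cfx).
have h3 := cdom_near hX ac cx.
apply: filterS (filterI (nbhs_interior h2) (filterI h1 h3)) => x' [k2 [k1 k3]].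
by apply: (hol_by_chart hX hY ac ac' k3 (nbhs_singleton k2) k2 k1).
Qed.

End ManifoldCore.

(** * Differentials of maps between manifolds, and products *)

Section Differentials.
Context {R : realType}.
Local Notation C := (Cx R).
Implicit Types X Y Z W : premanifold R.

(** [mdiff] is tied to the charts picked by [chart_at]; here the charts are free. For the identity
    map this is the change of tangent coordinates. *)
Definition dloc X Y (c : chart R X (mdim X)) (d : chart R Y (mdim Y)) (f : X -> Y) (x : X) :=
  fun v => 'd (cmap d \o f \o cinv c) (cmap c x) v.

Lemma diff_id_near n m (f : 'rV[C]_n -> 'rV[C]_m) (L : 'rV[C]_n -> 'rV[C]_m) x v :
  linear L -> {near x, f =1 L} -> 'd f x v = L v.
Proof.
move=> lL E; have [dL eL] := linear_rV_diff lL x.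
by rewrite (near_eq_diff E dL).2 eL.
Qed.

Lemma diff_cst_near n m (f : 'rV[C]_n -> 'rV[C]_m) y x v :
  {near x, f =1 (fun=> y)} -> 'd f x v = 0.
Proof.
move=> E; have dL : differentiable (cst y : 'rV[C]_n -> 'rV[C]_m) x := differentiable_cst y x.
rewrite (near_eq_diff E dL).2.
exact: (congr1 (fun F => F v) (diff_cst y x)).
Qed.

Lemma dloc_comp X Y Z (hX : holo_atlas X) (hY : holo_atlas Y) (f : X -> Y) (g : Y -> Z) x c d e v :
  atlas X c -> atlas Y d -> atlas Z e -> cdom c x -> cdom d (f x) -> cdom e (g (f x)) ->
  holomorphic_at f x -> holomorphic_at g (f x) ->
  dloc c e (g \o f) x v = dloc d e g (f x) (dloc c d f x v).
Proof.
move=> ac ad ae cx dx ex [cf hf] [cg hg].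
have E : (cmap d \o f \o cinv c) (cmap c x) = cmap d (f x) by rewrite /= (cinvK hX ac cx).
have d1 := holo_diff_at (hf c d ac ad cx dx).
have d2 := holo_diff_at (hg d e ad ae dx ex); rewrite -E in d2.
have [d3 e3] := has_diff_comp d1 d2.
rewrite /dloc -[in RHS]E -e3; apply: (near_eq_diff _ d3).2.
apply: filterS (local_rep_near hX hY cf ac ad cx dx) => w [_ fw] /=.
by rewrite (cinvK hY ad fw).
Qed.

Lemma dloc_ext X Y (hX : holo_atlas X) (f g : X -> Y) x c d v :
  atlas X c -> atlas Y d -> cdom c x -> cdom d (f x) ->
  {near x, f =1 g} -> holomorphic_at f x -> dloc c d f x v = dloc c d g x v.
Proof.
move=> ac ad cx dx E [cf hf]; have d1 := holo_diff_at (hf c d ac ad cx dx).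
apply/esym/(near_eq_diff _ d1).2.
by apply: filterS (cinv_cont hX ac cx E) => w /= ->.
Qed.

Lemma mdiff_comp X Y Z (hX : holo_atlas X) (hY : holo_atlas Y) (hZ : holo_atlas Z)
    (f : X -> Y) (g : Y -> Z) x v :
  holomorphic_at f x -> holomorphic_at g (f x) ->
  mdiff (g \o f) x v = mdiff g (f x) (mdiff f x v).
Proof.
move=> hf hg; have [ac cx] := chart_atP hX x; have [ad dx] := chart_atP hY (f x).
have [ae ex] := chart_atP hZ (g (f x)).
exact: (dloc_comp hX hY v ac ad ae cx dx ex hf hg).
Qed.

Lemma mdiff_ext X Y (hX : holo_atlas X) (hY : holo_atlas Y) (f g : X -> Y) x v :
  {near x, f =1 g} -> holomorphic_at f x -> mdiff f x v = mdiff g x v.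
Proof.
move=> E hf; have [ac cx] := chart_atP hX x; have [ad dx] := chart_atP hY (f x).
rewrite /mdiff -(nbhs_singleton E : f x = g x).
exact: (dloc_ext hX v ac ad cx dx E hf).
Qed.

Lemma mdiffP X Y (f : X -> Y) x a u v : mdiff f x (a *: u + v) = a *: mdiff f x u + mdiff f x v.
Proof. exact: (linearP ('d (cmap (chart_at (f x)) \o f \o cinv (chart_at x)) (cmap (chart_at x) x))). Qed.

Lemma mdiff0 X Y (f : X -> Y) x : mdiff f x 0 = 0.
Proof. by have := mdiffP f x (-1) 0 0; rewrite scaler0 addr0 scaleN1r addNr. Qed.

Lemma mdiffD X Y (f : X -> Y) x u v : mdiff f x (u + v) = mdiff f x u + mdiff f x v.
Proof. by have := mdiffP f x 1 u v; rewrite !scale1r. Qed.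

Lemma mdiffZ X Y (f : X -> Y) x a u : mdiff f x (a *: u) = a *: mdiff f x u.
Proof. by have := mdiffP f x a u 0; rewrite mdiff0 !addr0. Qed.

Lemma mdiff_id X (hX : holo_atlas X) x v : mdiff (@id X) x v = v.
Proof.
have [ac cx] := chart_atP hX x.
apply: (@diff_id_near _ _ _ id) => //.
by apply: filterS (cinv_near hX ac cx) => w [].
Qed.

Lemma mdiff_cst X Y (y : Y) (x : X) v : mdiff (fun _ : X => y) x v = 0.
Proof. by apply: (@diff_cst_near _ _ _ (cmap (chart_at y) y)); exact: near_all. Qed.

Section Product.
Context {X Y : premanifold R} (hX : holo_atlas X) (hY : holo_atlas Y).

Lemma prod_image (c : chart R X (mdim X)) (d : chart R Y (mdim Y)) (A : set X) (B : set Y) :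
  cmap (prod_chart c d) @` (A `*` B) =
  (lsubmx @^-1` (cmap c @` A)) `&` (rsubmx @^-1` (cmap d @` B)).
Proof.
apply/seteqP; split=> w /=.
  move=> [[x y] [/= Ax By] <-]; rewrite row_mxKl row_mxKr.
  by split; [exists x | exists y].
by move=> [[x Ax e1] [y By e2]]; exists (x, y) => //=; rewrite e1 e2 hsubmxK.
Qed.

Lemma prod_open n m (A : set 'rV[C]_n) (B : set 'rV[C]_m) : open A -> open B ->
  open ((@lsubmx _ 1 n m @^-1` A) `&` (@rsubmx _ 1 n m @^-1` B)).
Proof.
move=> oA oB; rewrite openE => w [Aw Bw]; apply: filterI.
  apply: (@cont_near R _ _ _ _ A _ (open_nbhs_nbhs (conj oA Aw))).
  by apply: holo_continuous; apply: holo_linear; exact: linear_lsubmx.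
apply: (@cont_near R _ _ _ _ B _ (open_nbhs_nbhs (conj oB Bw))).
by apply: holo_continuous; apply: holo_linear; exact: linear_rsubmx.
Qed.

Lemma prodM_atlas : holo_atlas (prodM X Y).
Proof.
have [covX chX trX] := hX; have [covY chY trY] := hY; split.
- move=> [x y]; have [c ac cx] := covX x; have [d ad dy] := covY y.
  by exists (prod_chart c d); [exists (c, d) | split].
- move=> _ [[c d] [/= ac ad] <-]; split.
    by rewrite prod_image; apply: prod_open; [exact: (chX c ac).1 | exact: (chY d ad).1].
  move=> [x y]; rewrite inE => -[/= cx dy].
  by rewrite row_mxKl row_mxKr (cinvK hX ac cx) (cinvK hY ad dy).
move=> _ _ [[c d] [/= ac ad] <-] [[c' d'] [/= ac' ad'] <-]; split.
  rewrite -[cdom (prod_chart c d) `&` _]/((cdom c `*` cdom d) `&` (cdom c' `*` cdom d')).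
  rewrite -setXI prod_image; apply: prod_open.
    exact: (trX c c' ac ac').1.
  exact: (trY d d' ad ad').1.
move=> [x y] [/= cx dy] [/= cx' dy'].
have h1 := (trX c c' ac ac').2 x cx cx'; have h2 := (trY d d' ad ad').2 y dy dy'.
apply: holo_row_mx.
  apply: (@holo_comp R _ _ _ (@lsubmx _ 1 _ _) (cmap c' \o cinv c)).
    by apply: holo_linear; exact: linear_lsubmx.
  by rewrite row_mxKl.
apply: (@holo_comp R _ _ _ (@rsubmx _ 1 _ _) (cmap d' \o cinv d)).
  by apply: holo_linear; exact: linear_rsubmx.
by rewrite row_mxKr.
Qed.

Lemma prod_atlas (c : chart R X (mdim X)) (d : chart R Y (mdim Y)) :
  atlas X c -> atlas Y d -> atlas (prodM X Y) (prod_chart c d).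
Proof. by move=> ac ad; exists (c, d). Qed.

Lemma hol_fst (p : prodM X Y) : @holomorphic_at R (prodM X Y) X fst p.
Proof.
case: p => x y; have [ac cx] := chart_atP hX x; have [ad dy] := chart_atP hY y.
have apc := prod_atlas ac ad.
have pc : cdom (prod_chart (chart_at x) (chart_at y)) (x, y) by split.
apply: (hol_by_chart prodM_atlas hX apc ac pc cx).
  by apply: filterS (cdom_near prodM_atlas apc pc) => -[a b] [].
have : holo_at (@lsubmx C 1 (mdim X) (mdim Y)) (cmap (prod_chart (chart_at x) (chart_at y)) (x, y)).
  by apply: holo_linear; exact: linear_lsubmx.
apply: holo_ext; apply: filterS (chart_image_near prodM_atlas apc pc) => w [[a b] [/= ca cb] <-] /=.
by rewrite !row_mxKl (cinvK hX ac ca).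
Qed.

Lemma hol_snd (p : prodM X Y) : @holomorphic_at R (prodM X Y) Y snd p.
Proof.
case: p => x y; have [ac cx] := chart_atP hX x; have [ad dy] := chart_atP hY y.
have apc := prod_atlas ac ad.
have pc : cdom (prod_chart (chart_at x) (chart_at y)) (x, y) by split.
apply: (hol_by_chart prodM_atlas hY apc ad pc dy).
  by apply: filterS (cdom_near prodM_atlas apc pc) => -[a b] [].
have : holo_at (@rsubmx C 1 (mdim X) (mdim Y)) (cmap (prod_chart (chart_at x) (chart_at y)) (x, y)).
  by apply: holo_linear; exact: linear_rsubmx.
apply: holo_ext; apply: filterS (chart_image_near prodM_atlas apc pc) => w [[a b] [/= ca cb] <-] /=.
by rewrite !row_mxKr (cinvK hY ad cb).
Qed.

Lemma hol_pair Z (hZ : holo_atlas Z) (f : Z -> X) (g : Z -> Y) z :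
  holomorphic_at f z -> holomorphic_at g z ->
  @holomorphic_at R Z (prodM X Y) (fun z => (f z, g z)) z.
Proof.
move=> [cf hf] [cg hg]; have [ac cx] := chart_atP hX (f z).
have [ad dy] := chart_atP hY (g z); have [ae ez] := chart_atP hZ z.
have apc := prod_atlas ac ad.
have pc : cdom (prod_chart (chart_at (f z)) (chart_at (g z))) (f z, g z) by split.
apply: (hol_by_chart hZ prodM_atlas ae apc ez pc).
  apply: filterI; first exact: hol_near_pre cf (cdom_near hX ac cx).
  exact: hol_near_pre cg (cdom_near hY ad dy).
exact: (holo_row_mx (hf _ _ ae ac ez cx) (hg _ _ ae ad ez dy)).
Qed.

(** Sum of the two partial differentials; it yields the Leibniz rules for the group law and for the
    action. *)
Lemma mdiff_prod Z W (hZ : holo_atlas Z) (hW : holo_atlas W) (B : prodM X Y -> Z)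
    (f : W -> X) (g : W -> Y) w v :
  holomorphic_at f w -> holomorphic_at g w -> holomorphic_at B (f w, g w) ->
  mdiff (fun w => B (f w, g w)) w v =
  mdiff (fun x => B (x, g w)) (f w) (mdiff f w v) + mdiff (fun y => B (f w, y)) (g w) (mdiff g w v).
Proof.
move=> hf hg hB; have [ac cx] := chart_atP hX (f w).
have [ad dy] := chart_atP hY (g w); have [aw cw] := chart_atP hW w.
have [ae ez] := chart_atP hZ (B (f w, g w)).
have apc := prod_atlas ac ad.
(* The factors of [chart_at (f w, g w)] are not controlled; in the explicit chart [p] the
   differential of a pair is the row of the differentials. *)
pose p : chart R (prodM X Y) (mdim (prodM X Y)) := prod_chart (chart_at (f w)) (chart_at (g w)).
have pc : cdom p (f w, g w) by split.
have pairE V (hV : holo_atlas V) (f' : V -> X) (g' : V -> Y) (u : V) vv : f' u = f w -> g' u = g w ->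
    holomorphic_at f' u -> holomorphic_at g' u ->
    @dloc V (prodM X Y) (chart_at u) p (fun z => (f' z, g' z)) u vv =
    row_mx (mdiff f' u vv) (mdiff g' u vv).
  move=> ef eg hf' hg'; have [au cu] := chart_atP hV u.
  have d1 := holo_diff_at (hf'.2 _ _ au ac cu (eq_ind_r (fun z => cdom _ z) cx ef)).
  have d2 := holo_diff_at (hg'.2 _ _ au ad cu (eq_ind_r (fun z => cdom _ z) dy eg)).
  rewrite /mdiff ef eg; exact: (diff_row_mx d1 d2).2.
have step V (hV : holo_atlas V) (f' : V -> X) (g' : V -> Y) (u : V) vv : f' u = f w -> g' u = g w ->
    holomorphic_at f' u -> holomorphic_at g' u ->
    mdiff (fun z => B (f' z, g' z)) u vv =
    @dloc (prodM X Y) Z p (chart_at (B (f w, g w))) B (f w, g w) (row_mx (mdiff f' u vv) (mdiff g' u vv)).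
  move=> ef eg hf' hg'; have [au cu] := chart_atP hV u.
  rewrite -(pairE V hV f' g' u vv ef eg hf' hg').
  have hp := hol_pair hV hf' hg'.
  have := @dloc_comp V (prodM X Y) Z hV prodM_atlas (fun z => (f' z, g' z)) B u
    (chart_at u) p (chart_at (B (f w, g w))) vv au apc.
  rewrite /mdiff ef eg; apply => //.
rewrite (step W hW f g w v) // (step X hX id (fun=> g w) (f w)) //; first last.
- exact: hol_cst.
- exact: hol_id.
rewrite (step Y hY (fun=> f w) id (g w)) //; first last.
- exact: hol_id.
- exact: hol_cst.
rewrite (mdiff_id hX) (mdiff_id hY) !mdiff_cst.
rewrite -[RHS](linearD ('d (cmap (chart_at (B (f w, g w))) \o B \o cinv p) (cmap p (f w, g w)))).
by rewrite add_row_mx addr0 add0r.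
Qed.

End Product.
End Differentials.

(** * Tangent bundles, quotients and submanifolds *)

Section Tangent.
Context {R : realType}.
Local Notation C := (Cx R).
Implicit Types X Y Z : premanifold R.

Section TangentAtlas.
Context {X : premanifold R} (hX : holo_atlas X).
Implicit Types (c d : chart R X (mdim X)).

Lemma dloc_id_comp c d e x v : atlas X c -> atlas X d -> atlas X e ->
  cdom c x -> cdom d x -> cdom e x ->
  dloc d e (@id X) x (dloc c d (@id X) x v) = dloc c e (@id X) x v.
Proof.
move=> ac ad ae cx dx ex; apply/esym.
exact: (@dloc_comp R X X X hX hX id id x c d e v ac ad ae cx dx ex (hol_id hX x) (hol_id hX x)).
Qed.

Lemma dloc_id c x v : atlas X c -> cdom c x -> dloc c c (@id X) x v = v.
Proof.
move=> ac cx; apply: (@diff_id_near _ _ _ _ id) => //.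
by apply: filterS (cinv_near hX ac cx) => w [].
Qed.

Lemma dloc_id_chartK c x v : atlas X c -> cdom c x ->
  dloc (chart_at x) c (@id X) x (dloc c (chart_at x) (@id X) x v) = v.
Proof.
move=> ac cx; have [ax xx] := chart_atP hX x.
by rewrite (dloc_id_comp v ac ax ac cx xx cx) dloc_id.
Qed.

Lemma dloc_id_Kchart c x v : atlas X c -> cdom c x ->
  dloc c (chart_at x) (@id X) x (dloc (chart_at x) c (@id X) x v) = v.
Proof.
move=> ac cx; have [ax xx] := chart_atP hX x.
by rewrite (dloc_id_comp v ax ac ax xx cx xx) dloc_id.
Qed.

Lemma tangent_cinvE c x w : atlas X c -> cdom c x -> lsubmx w = cmap c x ->
  cinv (tangent_chart c) w = mkT x (dloc c (chart_at x) (@id X) x (rsubmx w)).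
Proof. by move=> ac cx e; rewrite /= e (cinvK hX ac cx). Qed.

Lemma tangent_image c (A : set X) : atlas X c -> A `<=` cdom c ->
  cmap (tangent_chart c) @` [set xv | A xv.1] = lsubmx @^-1` (cmap c @` A).
Proof.
move=> ac Ac; apply/seteqP; split=> w /=.
  by move=> [[x v] /= Ax <-]; rewrite row_mxKl; exists x.
move=> [x Ax e]; exists (mkT x (dloc c (chart_at x) (@id X) x (rsubmx w))) => //=.
rewrite -[X in row_mx _ X]/(dloc (chart_at x) c (@id X) x (dloc c (chart_at x) (@id X) x (rsubmx w))).
by rewrite (dloc_id_chartK _ ac (Ac x Ax)) e hsubmxK.
Qed.

Lemma lsub_open n m (A : set 'rV[C]_n) : open A -> open (@lsubmx C 1 n m @^-1` A).
Proof.
move=> oA; have := prod_open oA (@openT 'rV[C]_m).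
by rewrite preimage_setT setIT.
Qed.

End TangentAtlas.

Lemma T_local X Y (hX : holo_atlas X) (hY : holo_atlas Y) (f : X -> Y) x c d r :
  atlas X c -> atlas Y d -> cdom c x -> cdom d (f x) -> holomorphic_at f x ->
  cmap (tangent_chart d) (mkT (f x) (mdiff f x (dloc c (chart_at x) (@id X) x r))) =
  row_mx (cmap d (f x)) (dloc c d f x r).
Proof.
move=> ac ad cx dx hf; have [ax xx] := chart_atP hX x; have [ay yy] := chart_atP hY (f x).
congr row_mx; rewrite -[LHS]/(dloc (chart_at (f x)) d (@id Y) (f x) (mdiff f x _)).
have e1 := @dloc_comp R X X Y hX hX id f x c (chart_at x) (chart_at (f x)) r ac ax ay cx xx yy (hol_id hX x) hf.
rewrite -[mdiff f x _]e1.
have := @dloc_comp R X Y Y hX hY f id x c (chart_at (f x)) d r ac ay ad cx yy dx hf (hol_id hY _).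
by move=> <-.
Qed.

(** Vectors are stored in the coordinates of [chart_at], which depends on the point in an arbitrary
    way. By [T_local] it cancels out of the local expression, which is (phi, dphi) with phi that of
    [f], and [holo_derivative] applies. *)
Lemma T_local_near X Y (hX : holo_atlas X) (hY : holo_atlas Y) (f : X -> Y) x c d (v : 'rV[C]_(mdim X)) :
  atlas X c -> atlas Y d -> cdom c x -> cdom d (f x) -> holomorphic_at f x ->
  holo_at (cmap (tangent_chart d) \o (fun xv : tangentM X => mkT (f xv.1) (mdiff f xv.1 xv.2)) \o
     cinv (tangent_chart c)) (cmap (tangent_chart c) (x, v)).
Proof.
move=> ac ad cx dx hf; have hphi := hf.2 c d ac ad cx dx.
set phi := cmap d \o f \o cinv c in hphi.
pose w0 := cmap (tangent_chart c) (x, v).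
have l0 : lsubmx w0 = cmap c x by rewrite /w0 /= row_mxKl.
have hl w : {for w, continuous (@lsubmx C 1 (mdim X) (mdim X))}.
  by apply: holo_continuous; apply: holo_linear; exact: linear_lsubmx.
have h0 : holo_at (fun w : 'rV[C]_(mdim X + mdim X) => row_mx (phi (lsubmx w)) ('d phi (lsubmx w) (rsubmx w))) w0.
  apply: holo_row_mx.
    apply: (@holo_comp R _ _ _ (@lsubmx _ 1 _ _) phi); last by rewrite l0.
    by apply: holo_linear; exact: linear_lsubmx.
  by have := holo_derivative (rsubmx w0) hphi; rewrite -l0 hsubmxK.
apply: holo_ext h0.
have n1 : \forall x' \near x, cdom c x' /\ cdom d (f x') /\ holomorphic_at f x'.
  apply: filterI; first exact: (cdom_near hX ac cx).
  apply: filterI; first exact: hol_near_pre (hol_cont hf) (cdom_near hY ad dx).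
  exact: (hol_near hX hY hf).
have n2 := @cinv_cont _ X hX c x _ ac cx n1; rewrite -l0 in n2.
have n3 := chart_image_near hX ac cx; rewrite -l0 in n3.
apply: filterS2 (cont_near (hl w0) n2) (cont_near (hl w0) n3) => w + [x' cx' e'].
rewrite -e' (cinvK hX ac cx') => -[_ [dx' hf']].
apply: etrans (congr1 (fun q : tangentM X => cmap (tangent_chart d) (mkT (f q.1) (mdiff f q.1 q.2)))
  (tangent_cinvE hX ac cx' (esym e'))) _.
apply: etrans (T_local hX hY (rsubmx w) ac ad cx' dx' hf') _.
by rewrite /phi /= (cinvK hX ac cx').
Qed.

(** Transition maps are local expressions of the tangent map of the identity. *)
Lemma tangentM_atlas X (hX : holo_atlas X) : holo_atlas (tangentM X).
Proof.
have [cov chX tr] := hX; split.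
- by move=> [x v]; have [c ac cx] := cov x; exists (tangent_chart c) => //; exists c.
- move=> _ [c ac <-]; split.
    by rewrite (tangent_image hX ac (@subset_refl _ _)); apply: lsub_open; exact: (chX c ac).1.
  case=> x v; rewrite inE; move=> cx.
  have l0 : lsubmx (cmap (tangent_chart c) (x, v)) = cmap c x by rewrite /= row_mxKl.
  apply: etrans (tangent_cinvE hX ac cx l0) _.
  rewrite /mkT [rsubmx _](_ : _ = dloc (chart_at x) c (@id X) x v); last by rewrite /= row_mxKr.
  by congr (_, _); exact: dloc_id_Kchart.
move=> _ _ [c ac <-] [c' ac' <-]; split.
  have -> : cdom (tangent_chart c) `&` cdom (tangent_chart c') = [set xv | (cdom c `&` cdom c') xv.1] by [].
  rewrite (tangent_image hX ac); last by move=> x [].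
  by apply: lsub_open; exact: (tr c c' ac ac').1.
move=> [x v] /= cx cx'.
apply: holo_ext (@T_local_near X X hX hX id x c c' v ac ac' cx cx' (hol_id hX x)).
by apply: near_all => w /=; rewrite mdiff_id.
Qed.

Lemma tangent_atlas X (c : chart R X (mdim X)) : atlas X c -> atlas (tangentM X) (tangent_chart c).
Proof. by move=> ac; exists c. Qed.

Lemma hol_T_base X (hX : holo_atlas X) (xv : tangentM X) :
  @holomorphic_at R (tangentM X) X fst xv.
Proof.
case: xv => x v; have [ac cx] := chart_atP hX x.
have hT := tangentM_atlas hX.
have tx : cdom (tangent_chart (chart_at x)) (x, v) by [].
apply: (hol_by_chart hT hX (tangent_atlas ac) ac tx cx).
  exact: (cdom_near hT (tangent_atlas ac) tx).
have : holo_at (@lsubmx C 1 (mdim X) (mdim X)) (cmap (tangent_chart (chart_at x)) (x, v)).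
  by apply: holo_linear; exact: linear_lsubmx.
apply: holo_ext; apply: filterS (chart_image_near hT (tangent_atlas ac) tx) => w [[a b] /= ca <-].
by rewrite !row_mxKl (cinvK hX ac ca).
Qed.

Lemma hol_T_map X Y (hX : holo_atlas X) (hY : holo_atlas Y) (f : X -> Y) x v :
  holomorphic_at f x ->
  @holomorphic_at R (tangentM X) (tangentM Y) (fun xv => mkT (f xv.1) (mdiff f xv.1 xv.2)) (x, v).
Proof.
move=> hf; have [ac cx] := chart_atP hX x; have [ad dx] := chart_atP hY (f x).
have tx : cdom (tangent_chart (chart_at x)) (x, v) by [].
apply: (hol_by_chart (tangentM_atlas hX) (tangentM_atlas hY) (tangent_atlas ac) (tangent_atlas ad) tx).
- exact: dx.
- have hb := hol_cont (hol_comp (tangentM_atlas hX) hX (hol_T_base hX (x, v)) hf).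
  exact: hol_near_pre hb (cdom_near hY ad dx).
exact: T_local_near.
Qed.

Lemma hol_T_affM_pair n (w : affM (n + n)) :
  @holomorphic_at R (affM (n + n)) (tangentM (affM n)) (fun w => mkT (X := affM n) (lsubmx w) (rsubmx w)) w.
Proof.
have hA := affM_atlas (R := R) n; have hT := tangentM_atlas hA.
have ac : atlas (affM (R := R) n) (idchart n) by [].
have ac2 : atlas (affM (R := R) (n + n)) (idchart (n + n)) by [].
apply: (hol_by_chart (affM_atlas _) hT ac2 (tangent_atlas ac)) => //; first exact: mnear_all.
have : holo_at (@id 'rV[C]_(n + n)) w by apply: holo_linear.
apply: holo_ext; apply: near_all => z /=.
rewrite chart_at_affM [X in row_mx _ X](_ : _ = rsubmx z) ?hsubmxK //.
by apply: (@diff_id_near _ _ _ _ id) => //; exact: near_all.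
Qed.

Lemma hol_T_in X (hX : holo_atlas X) n (psi : affM n -> X) (a b : 'rV[C]_n) :
  holomorphic_at psi a ->
  @holomorphic_at R (affM (n + n)) (tangentM X)
    (fun w => mkT (psi (lsubmx w)) (mdiff psi (lsubmx w) (rsubmx w))) (row_mx a b).
Proof.
rewrite -[in holomorphic_at psi a](row_mxKl a b) => hpsi.
have h := @hol_T_map (affM n) X (affM_atlas n) hX psi _ (rsubmx (row_mx a b)) hpsi.
exact: (hol_comp (affM_atlas _) (tangentM_atlas (affM_atlas n)) (hol_T_affM_pair (row_mx a b)) h).
Qed.

(** The second argument is frozen at the base point of the vector. This is needed for coordinates on
    a bundle that are centered at the very point where they are differentiated. *)
Lemma hol_T_diagonal X (hX : holo_atlas X) k (f : prodM X X -> affM k) x v :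
  holomorphic_at f (x, x) ->
  @holomorphic_at R (tangentM X) (affM k) (fun xv => mdiff (fun x' => f (x', xv.1)) xv.1 xv.2) (x, v).
Proof.
move=> hf; have hP := prodM_atlas hX hX; have hT := tangentM_atlas hX.
have hA := affM_atlas (R := R) k.
have [ac cx] := chart_atP hX x; set c := chart_at x in ac cx.
have ak : atlas (affM (R := R) k) (idchart k) by [].
pose p : chart R (prodM X X) (mdim (prodM X X)) := prod_chart c c.
have ap : atlas (prodM X X) p := prod_atlas ac ac.
have px : cdom p (x, x) by split.
have hphi : holo_at (f \o cinv p) (cmap p (x, x)) := hf.2 p (idchart k) ap ak px I.
set phi := f \o cinv p in hphi.
(* In coordinates, (x, v) |-> ((x, x), (v, 0)). *)
pose A (w : 'rV[C]_(mdim X + mdim X)) : 'rV[C]_((mdim X + mdim X) + (mdim X + mdim X)) :=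
  row_mx (row_mx (lsubmx w) (lsubmx w)) (row_mx (rsubmx w) 0).
have lA : linear A.
  move=> a u u'; rewrite /A (linear_lsubmx a u u') (linear_rsubmx a u u').
  by rewrite !scale_row_mx !add_row_mx scaler0 addr0.
pose H (w : 'rV[C]_((mdim X + mdim X) + (mdim X + mdim X))) := 'd phi (lsubmx w) (rsubmx w).
have tx : cdom (tangent_chart c) (x, v) by [].
have h1 : @holomorphic_at R (tangentM X) (affM (mdim X + mdim X)) (cmap (tangent_chart c)) (x, v).
  exact: (hol_cmap hT (tangent_atlas ac) tx).
have h2 : holo_at (H \o A) (cmap (tangent_chart c) (x, v)).
  apply: holo_comp; first exact: holo_linear.
  by rewrite /A /H /= !row_mxKl; exact: holo_derivative.
have h3 := hol_comp hT (affM_atlas _) h1 ((hol_affM (H \o A) _).2 h2).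
apply: hol_ext h3; first exact: hT.
have hb := hol_T_base hX (x, v).
have hd : @holomorphic_at R (tangentM X) (prodM X X) (fun xv => (xv.1, xv.1)) (x, v).
  exact: (hol_pair hX hX hT hb hb).
have n1 := hol_near_pre (hol_cont hd) (hol_near hP hA hf).
have n2 := hol_near_pre (hol_cont hb) (cdom_near hX ac cx).
apply: filterS2 n1 n2 => -[y u] /= hfy cy; rewrite /H /A /= !row_mxKl !row_mxKr.
have [ay yy] := chart_atP hX y.
have hpair : @holomorphic_at R X (prodM X X) (fun z => (z, y)) y.
  by apply: (hol_pair hX hX hX); [exact: hol_id | exact: hol_cst].
have py : cdom p (y, y) by split.
have := @dloc_comp R X (prodM X X) (affM k) hX hP (fun z => (z, y)) f y (chart_at y) p (idchart k) u
  ay ap ak yy py I hpair hfy.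
move=> E; rewrite /mdiff chart_at_affM; apply/esym; apply: (etrans E).
rewrite /dloc -/phi; congr ('d phi _ _).
have d1 := holo_diff_at ((hol_id hX y).2 _ _ ay ac yy cy).
have d2 := holo_diff_at ((hol_cst hX y y).2 _ _ ay ac yy cy).
apply: etrans ((diff_row_mx d1 d2).2 u) _; congr row_mx.
by apply: (@diff_cst_near _ _ _ _ (cmap c y)); exact: near_all.
Qed.

End Tangent.

(** * Quotient manifolds *)

Section Quotients.
Context {R : realType}.
Local Notation C := (Cx R).
Context {X : premanifold R} (hX : holo_atlas X) (e : X -> X -> Prop) (m : nat).

Lemma quot_reprK (a : quot e) : quot_class e (quot_repr a) = a.
Proof. by apply: sval_eq; rewrite /quot_repr /=; case: cid => x /= ->. Qed.

Hypothesis e_refl : forall x, e x x.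
Hypothesis e_sym : forall x y, e x y -> e y x.
Hypothesis e_trans : forall x y z, e x y -> e y z -> e x z.

Lemma quot_classP x y : quot_class e x = quot_class e y <-> e x y.
Proof.
split=> [[E]|exy]; first by have : [set z | e y z] y by []; rewrite -E.
apply: sval_eq; apply/seteqP; split=> z /= h; apply: e_trans h => //.
exact: e_sym.
Qed.

Lemma quot_repr_rel x : e (quot_repr (quot_class e x)) x.
Proof. by apply/quot_classP; rewrite quot_reprK. Qed.

(** The recipe for the charts of both At(E) and Ad(E): the fibers of [Q] are exactly the classes,
    and its local sections provide those that [quotM] demands. *)
Lemma quot_chart (O : set X) (Q : X -> affM m) :
  (forall x, O x -> \forall x' \near x, O x') ->
  (forall x y, O x -> e x y -> O y) ->
  (forall x y, O x -> O y -> Q x = Q y <-> e x y) ->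
  (forall x, O x -> holomorphic_at Q x) ->
  (forall x, O x -> exists s : affM m -> X,
     [/\ s (Q x) = x, holomorphic_at s (Q x) &
         \forall z \near (Q x : 'rV[C]_m), O (s z) /\ Q (s z) = z]) ->
  O !=set0 ->
  exists2 c, atlas (quotM e m) c & (forall x, O x -> cdom c (quot_class e x)) /\
    (forall x, O x -> cmap c (quot_class e x) = Q x).
Proof.
move=> opO satO Qe hQ secQ [x0 Ox0].
have oQ : open (Q @` O : set 'rV[C]_m).
  rewrite openE => _ [x Ox <-]; have [s [_ _ n]] := secQ x Ox.
  by apply: filterS n => z [Os Qs]; exists (s z).
(* The inverse picks any preimage of [z] under [Q], with default value [x0] outside the image. *)
pose c : chart R (quot e) m := Chart [set a | exists2 x, O x & a = quot_class e x]
  (fun a => Q (quot_repr a)) (fun z => quot_class e (xget x0 [set x | O x /\ Q x = z])).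
have reprO x : O x -> O (quot_repr (quot_class e x)).
  by move=> Ox; apply: satO Ox _; apply: e_sym; exact: quot_repr_rel.
have cQ x : O x -> cmap c (quot_class e x) = Q x.
  by move=> Ox; apply/Qe => //; [exact: reprO | exact: quot_repr_rel].
have domO x : cdom c (quot_class e x) -> O x.
  by move=> [y Oy /quot_classP /e_sym h]; exact: satO h.
have cinvE x : O x -> cinv c (Q x) = quot_class e x.
  move=> Ox; apply/quot_classP; apply/Qe; rewrite //.
    by case: xgetP => [y _ []|/(_ x)] //; case.
  by case: xgetP => [y _ []|/(_ x)] //; case.
exists c; last by split=> // x Ox; exists x.
split.
- suff -> : cmap c @` cdom c = Q @` O by [].
  apply/seteqP; split=> [_ [_ [x Ox ->] <-]|_ [x Ox <-]].
    by exists x => //; rewrite cQ.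
  by exists (quot_class e x); [exists x | exact: cQ].
- by move=> a; rewrite inE => -[x Ox ->]; rewrite cQ // cinvE.
move=> x /domO Ox z0; have z0E : z0 = Q x by exact: cQ.
split.
- by apply: filterS (opO x Ox) => x' Ox'; exists x'.
- apply: (hol_ext hX _ (hQ x Ox)).
  by apply: filterS (opO x Ox) => x' Ox'; rewrite cQ.
have [s [s1 s2 s3]] := secQ x Ox; rewrite z0E; exists s; split=> //.
have : \forall z \near (Q x : 'rV[C]_m), quot_class e (s z) = cinv c z.
  by apply: filterS s3 => z [Os Qs]; rewrite -cinvE // Qs.
by [].
Qed.

Hypothesis cov : forall a : quotM e m, exists2 c, atlas (quotM e m) c & cdom c a.

(** A transition map from [c] to [c'] is the map [c'] composed with the quotient map, holomorphic on
    X, after a local section belonging to [c]. *)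
Lemma quotM_atlas : holo_atlas (quotM e m).
Proof.
split; [exact: cov | by move=> c [? ? _] |].
have key c c' x : atlas (quotM e m) c -> atlas (quotM e m) c' -> cdom c (quot_class e x) ->
    cdom c' (quot_class e x) ->
    (\forall z \near (cmap c (quot_class e x) : 'rV[C]_m), (cmap c @` (cdom c `&` cdom c')) z) /\
    holo_at (cmap c' \o cinv c) (cmap c (quot_class e x)).
  move=> [oc ck hc] [oc' ck' hc'] cx cx'.
  have [_ _ [s [s0 hs sE]]] := hc x cx; have [n1 h1 _] := hc' x cx'.
  set z0 := cmap c (quot_class e x) in s0 hs sE *.
  rewrite -s0 in n1 h1.
  have n2 := (affM_near z0 _).1 (hol_near_pre (hol_cont hs) n1).
  have n3 : \forall z \near (z0 : 'rV[C]_m), (cmap c @` cdom c) z.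
    by apply: open_nbhs_nbhs; split=> //; exists (quot_class e x).
  split.
    apply: filterS (filterI n2 (filterI n3 sE)) => z [k2 [[a ca ea] k3]].
    exists a => //; split=> //; move: k2; rewrite k3 -ea ck ?inE //.
  have := (hol_affM _ _).1 (hol_comp (affM_atlas _) hX hs h1).
  by apply: holo_ext; apply: filterS sE => z /= ->.
move=> c c' ac ac'; split.
  rewrite openE => _ [a [ca ca'] <-]; rewrite -(quot_reprK a) in ca ca' *.
  exact: (key c c' _ ac ac' ca ca').1.
by move=> a ca ca'; rewrite -(quot_reprK a) in ca ca' *; exact: (key c c' _ ac ac' ca ca').2.
Qed.

Lemma hol_quot_class x : @holomorphic_at R X (quotM e m) (quot_class e) x.
Proof.
have [c ac cx] := cov (quot_class e x); have [oc ck hc] := ac.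
have [n1 h1 _] := hc x cx; have [ax xx] := chart_atP hX x.
apply: (hol_by_chart hX quotM_atlas ax ac xx cx n1).
exact: (h1.2 _ (idchart m) ax).
Qed.

(** Locally [F] is [F \o quot_class e] after a chart followed by a holomorphic section. *)
Lemma hol_quot_desc (Y : premanifold R) (F : quotM e m -> Y) x :
  holomorphic_at (F \o quot_class e) x -> holomorphic_at F (quot_class e x).
Proof.
move=> hF; have [c ac cx] := cov (quot_class e x); have [oc ck hc] := ac.
have [_ _ [s [s0 hs sE]]] := hc x cx.
have hQ := quotM_atlas.
have h1 := hol_cmap hQ ac cx; rewrite -s0 in hF.
have h2 := hol_comp (affM_atlas _) hX hs hF.
have h3 := hol_comp hQ (affM_atlas _) h1 h2.
apply: (hol_ext hQ _ h3).
have n1 := @cmap_near R _ hQ c _ _ ac cx sE.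
apply: filterS2 n1 (cdom_near hQ ac cx) => a /= -> ca.
by rewrite (cinvK hQ ac ca).
Qed.

End Quotients.

(** * Submanifolds, local retractions and tangent spaces *)

Section Submanifolds.
Context {R : realType}.
Local Notation C := (Cx R).
Context {X : premanifold R} (hX : holo_atlas X) {S : set X} (hS : is_submanifold S).

Lemma subM_atlas : holo_atlas (subM S).
Proof. exact: manifold_holo_atlas hS. Qed.

Lemma sub_chart (a : subM S) : exists c, exists D : set X, exists F : X -> affM (sub_dim S),
  [/\ atlas (subM S) c, cdom c a, (forall x, D x -> \forall x' \near x, D x'),
      cdom c = [set b | D (sval b)] & (forall x, D x -> holomorphic_at F x) /\
      (forall b, cdom c b -> cmap c b = F (sval b))].
Proof.
have [cov _ _] := subM_atlas; have [c ac ca] := cov a.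
have [_ _ _ [D [F [opD domD hF cF]]]] := ac.
exists c, D, F; split=> //.
by move=> x Ox; apply: open_nbhs_nbhs.
Qed.

Lemma hol_sub_incl (a : subM S) : holomorphic_at (@sub_incl R X S) a.
Proof.
have [c [D [F [ac ca _ _ _]]]] := sub_chart a.
have [_ _ hc _] := ac; have h1 := hol_cmap subM_atlas ac ca.
have h2 := hol_comp subM_atlas (affM_atlas _) h1 (hc a ca).
apply: (hol_ext subM_atlas _ h2).
apply: filterS (cdom_near subM_atlas ac ca) => b cb /=.
by rewrite (cinvK subM_atlas ac cb).
Qed.

Lemma sub_retraction (a : subM S) : exists J : X -> X,
  [/\ holomorphic_at J (sval a), (\forall x \near sval a, S x -> J x = x) &
      forall v, sub_tangent a (mdiff J (sval a) v)].
Proof.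
have [c [D [F [ac ca opD domD [hF cF]]]]] := sub_chart a.
have Oa : D (sval a) by move: ca; rewrite domD.
have hc := hol_cinv subM_atlas ac ca; rewrite (cF a ca) in hc.
have g0 : cinv c (F (sval a)) = a by rewrite -(cF a ca) (cinvK subM_atlas ac ca).
have hg := hol_comp hX (affM_atlas _) (hF _ Oa) hc.
have hi := hol_sub_incl a; rewrite -[in holomorphic_at _ a]g0 in hi.
have hJ := hol_comp hX subM_atlas hg hi.
exists ((@sub_incl R X S) \o (cinv c \o F)); split=> //.
  apply: filterS (opD _ Oa) => x Ox Sx /=.
  pose b : subM S := exist _ x Sx; have cb : cdom c b by rewrite domD.
  by rewrite -[x in F x]/(sval b) -(cF b cb) (cinvK subM_atlas ac cb).
move=> v; rewrite (mdiff_comp hX subM_atlas hX v hg hi) /= g0.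
by exists (mdiff (cinv c \o F) (sval a) v).
Qed.

(** Near [y] the map is unchanged by the retraction [J], so its differential takes values in the
    image of that of [J]. *)
Lemma sub_tangent_values (Y : premanifold R) (hY : holo_atlas Y) (f : Y -> X) y (a : subM S) v :
  holomorphic_at f y -> f y = sval a -> (\forall y' \near y, S (f y')) ->
  sub_tangent a (mdiff f y v).
Proof.
move=> hf fy nS; have [J [hJ JS Jr]] := sub_retraction a.
rewrite -fy in hJ JS.
have E : {near y, f =1 J \o f}.
  apply: filterS2 nS (hol_near_pre (hol_cont hf) JS) => y' Sy' /(_ Sy') /= -> //.
rewrite (mdiff_ext hY hX v E hf) (mdiff_comp hY hX hX v hf hJ) fy.
exact: Jr.
Qed.

Lemma sub_tangentP (a : subM S) b u v :
  sub_tangent a u -> sub_tangent a v -> sub_tangent a (b *: u + v).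
Proof. by move=> [x _ <-] [y _ <-]; exists (b *: x + y) => //; rewrite mdiffP. Qed.

End Submanifolds.

(** * Principal bundles, Atiyah and adjoint bundles *)

Section PrincipalBundle.
Context {R : realType}.
Local Notation C := (Cx R).
Context (M : premanifold R) (H : lie_data R) (E : bundle_data M H).
Hypotheses (hM : is_complex_manifold M) (hH : is_complex_lie_group H)
  (hE : is_holomorphic_principal_bundle E).

Local Notation p := (@base_proj R M H E).

Lemma base_atlas : holo_atlas M. Proof. exact: manifold_holo_atlas hM. Qed.
Lemma group_atlas : holo_atlas (lieM H).
Proof. by have [h _ _] := hH; exact: manifold_holo_atlas. Qed.
Lemma total_atlas : holo_atlas E.
Proof. by have [h _ _ _ _] := hE; exact: manifold_holo_atlas. Qed.

Local Notation aM := base_atlas.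
Local Notation aH := group_atlas.
Local Notation aE := total_atlas.

Lemma hol_proj (y : E) : holomorphic_at p y.
Proof. by have [_ h _ _ _] := hE. Qed.

Lemma proj_ract (y : E) (h : H) : p (ract y h) = p y.
Proof. by have [_ _ _ h' _] := hE. Qed.

Lemma hol_mul (Z : premanifold R) (aZ : holo_atlas Z) (f g : Z -> lieM H) z :
  holomorphic_at f z -> holomorphic_at g z ->
  @holomorphic_at R Z (lieM H) (fun z => (f z : H) * (g z : H))%g z.
Proof.
move=> hf hg; have [_ hm _] := hH.
exact: (hol_comp aZ (prodM_atlas aH aH) (hol_pair aH aH aZ hf hg) (hm _)).
Qed.

Lemma hol_invg (Z : premanifold R) (aZ : holo_atlas Z) (f : Z -> lieM H) z :
  holomorphic_at f z -> @holomorphic_at R Z (lieM H) (fun z => (f z : H)^-1)%g z.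
Proof. by move=> hf; have [_ _ hi] := hH; exact: (hol_comp aZ aH hf (hi _)). Qed.

Lemma hol_act (Z : premanifold R) (aZ : holo_atlas Z) (f : Z -> E) (g : Z -> lieM H) z :
  holomorphic_at f z -> holomorphic_at g z -> holomorphic_at (fun z => ract (f z) (g z)) z.
Proof.
move=> hf hg; have [_ _ hm _ _] := hE.
exact: (hol_comp aZ (prodM_atlas aE aH) (hol_pair aE aH aZ hf hg) (hm _)).
Qed.

Lemma hol_ract (h : H) (y : E) : holomorphic_at (fun y : E => ract y h) y.
Proof. exact: (hol_act aE (hol_id aE y) (@hol_cst R E (lieM H) aE h y)). Qed.

Lemma hol_orbit (y : E) (h : lieM H) : @holomorphic_at R (lieM H) E (fun h => ract y h) h.
Proof. exact: (hol_act aH (hol_cst aH y h) (hol_id aH h)). Qed.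

Lemma mdiff_ract1 (y : E) v : mdiff (fun y : E => ract y (1%g : H)) y v = v.
Proof.
have -> : (fun y : E => ract y (1%g : H)) = id by apply/funext => z; rewrite act1.
exact: mdiff_id aE y v.
Qed.

Lemma mdiff_ractM (g h : H) (y : E) v :
  mdiff (fun y : E => ract y (g * h)%g) y v =
  mdiff (fun y : E => ract y h) (ract y g) (mdiff (fun y : E => ract y g) y v).
Proof.
have -> : (fun y : E => ract y (g * h)%g) = (fun y => ract y h) \o (fun y => ract y g).
  by apply/funext => z; rewrite actM.
exact: (mdiff_comp aE aE aE v (hol_ract g y) (hol_ract h _)).
Qed.

Lemma at_rel_refl (a : tangentM E) : at_rel a a.
Proof. by case: a => y v; exists 1%g; rewrite /mkT /= act1 mdiff_ract1. Qed.

Lemma at_rel_trans (a b c : tangentM E) : at_rel a b -> at_rel b c -> at_rel a c.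
Proof.
by move=> [g ->] [h ->] /=; exists (g * h)%g; rewrite /= actM mdiff_ractM.
Qed.

Lemma at_rel_sym (a b : tangentM E) : at_rel a b -> at_rel b a.
Proof.
case: a => y v [h ->]; exists h^-1%g; rewrite /= -actM -mdiff_ractM mulgV.
by rewrite act1 mdiff_ract1.
Qed.

Lemma at_class_eq (y y' : E) v v' : at_class y v = at_class y' v' <-> at_rel (mkT y v) (mkT y' v').
Proof. exact: (quot_classP at_rel_refl at_rel_sym at_rel_trans). Qed.

Lemma at_class_ract (y : E) v (h : H) :
  at_class (ract y h) (mdiff (fun y : E => ract y h) y v) = at_class y v.
Proof. by apply/esym/at_class_eq; exists h. Qed.

Lemma at_class_repr (a : atiyahM E) : exists y v, a = at_class y v /\ quot_repr a = mkT y v.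
Proof.
have e := quot_reprK a; case: (quot_repr a) e => y v e.
by exists y, v; rewrite -e.
Qed.

Lemma mdiff_proj_ract (y : E) (h : H) v :
  mdiff p (ract y h) (mdiff (fun y : E => ract y h) y v) = mdiff p y v.
Proof.
have e : p \o (fun y : E => ract y h) = p by apply/funext => z; exact: proj_ract.
apply: etrans (esym (mdiff_comp aE aE aM v (hol_ract h y) (hol_proj _))) _.
by rewrite e.
Qed.

Lemma at_proj_class (y : E) v : at_proj (at_class y v) = mkT (p y) (mdiff p y v).
Proof.
have : at_rel (quot_repr (at_class y v)) (mkT y v).
  exact: (quot_repr_rel at_rel_refl at_rel_sym at_rel_trans).
rewrite /at_proj; case: (quot_repr _) => y' v' [h [-> ->]] /=.
by rewrite proj_ract mdiff_proj_ract.
Qed.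

Lemma ad_rel_refl (a : prodM E (lieM H)) : ad_rel a a.
Proof. by case: a => y z; exists 1%g; rewrite /= act1 conjg1. Qed.

Lemma ad_rel_trans (a b c : prodM E (lieM H)) : ad_rel a b -> ad_rel b c -> ad_rel a c.
Proof. by move=> [g ->] [h ->] /=; exists (g * h)%g; rewrite /= actM conjgM. Qed.

Lemma ad_rel_sym (a b : prodM E (lieM H)) : ad_rel a b -> ad_rel b a.
Proof.
by case: a => y z [h ->]; exists h^-1%g; rewrite /= -actM mulgV act1 -conjgM mulgV conjg1.
Qed.

Lemma ad_proj_class (y : E) (z : H) : ad_proj (ad_class y z) = p y.
Proof.
have : ad_rel (quot_repr (ad_class y z)) (y, z).
  exact: (quot_repr_rel ad_rel_refl ad_rel_sym ad_rel_trans).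
by rewrite /ad_proj; case: (quot_repr _) => y' z' [h [-> _]] /=; rewrite proj_ract.
Qed.

Definition is_triv (U : set M) (s : M -> E) (t : E -> lieM H) : Prop :=
  [/\ (forall x, U x -> \forall x' \near x, U x'),
      (forall x, U x -> holomorphic_at s x /\ p (s x) = x),
      (forall y : E, U (p y) -> holomorphic_at t y),
      (forall y : E, U (p y) -> ract (s (p y)) (t y) = y) &
      (forall x (h : H), U x -> t (ract (s x) h) = h)].

Lemma triv_exists (x : M) : exists U s t, is_triv U s t /\ U x.
Proof.
have [_ _ _ _ h] := hE; have [U [oU Ux [s [t [h1 h2 h3 h4]]]]] := h x.
exists U, s, t; split=> //; split=> // x' Ux'.
exact: (open_nbhs_nbhs (conj oU Ux')).
Qed.

Lemma triv_ract U s t (y : E) (h : H) : is_triv U s t -> U (p y) -> t (ract y h) = ((t y : H) * h)%g.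
Proof.
by move=> [_ _ _ h3 h4] Uy; rewrite -{1}(h3 y Uy) -actM h4.
Qed.

Lemma act_free (y : E) (g h : H) : ract y g = ract y h -> g = h.
Proof.
have [U [s [t [ht Uy]]]] := triv_exists (p y).
move=> e; apply: (@mulgI _ (t y : H)).
by rewrite -(triv_ract g ht Uy) -(triv_ract h ht Uy) e.
Qed.

Lemma act_transitive (y y' : E) : p y = p y' -> exists h : H, y' = ract y h.
Proof.
have [U [s [t [[h0 h1 h2 h3 h4] Uy]]]] := triv_exists (p y).
move=> e; exists ((t y : H)^-1 * (t y' : H))%g.
have Uy' : U (p y') by rewrite -e.
by rewrite -{1}(h3 y Uy) -actM mulVKg e h3.
Qed.

Lemma proj_surj (x : M) : exists y : E, p y = x.
Proof.
have [U [s [t [[h0 h1 h2 h3 h4] Ux]]]] := triv_exists x.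
by exists (s x); exact: (h1 x Ux).2.
Qed.

(** The new coordinate is a given one divided on the left by its value along [s]. In this way
    trivializations can be built on sections that lie in a reduction such as E_N. *)
Lemma triv_of_section (s : M -> E) (x : M) :
  (\forall x' \near x, holomorphic_at s x' /\ p (s x') = x') ->
  exists U t, is_triv U s t /\ U x.
Proof.
move=> ns; have [U0 [s0 [t0 [ht0 Ux]]]] := triv_exists x.
have [h0 h1 h2 h3 h4] := ht0.
(* The conditions on [s] are imposed near the point, which makes [U] open. *)
pose U := [set x' | U0 x' /\ (\forall x'' \near x', holomorphic_at s x'' /\ p (s x'') = x'')].
exists U, (fun y => ((t0 (s (p y)) : H)^-1 * (t0 y : H))%g); split; last by split.
have Us x' : U x' -> U0 x' /\ (holomorphic_at s x' /\ p (s x') = x').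
  by move=> [? h]; split=> //; exact: (nbhs_singleton h).
split.
- move=> x' [Ux' h]; apply: filterI; first exact: h0.
  exact: nbhs_interior h.
- by move=> x' /Us [].
- move=> y /Us [Uy [hs ps]]; apply: (hol_mul aE); last exact: h2.
  apply: (hol_invg aE); apply: (@hol_comp R E E (lieM H) aE aE (fun y => s (p y)) t0).
    exact: (hol_comp aE aM (hol_proj y) hs).
  by apply: h2; rewrite ps.
- move=> y /Us [Uy [hs ps]]; have Us' : U0 (p (s (p y))) by rewrite ps.
  by rewrite -{1}(h3 _ Us') -actM mulVKg ps h3.
move=> x' h /Us [Ux' [hs ps]]; rewrite proj_ract ps.
have Us' : U0 (p (s x')) by rewrite ps.
by rewrite (triv_ract h ht0 Us') mulKg.
Qed.

End PrincipalBundle.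

Section AffineMaps.
Context {R : realType}.
Local Notation C := (Cx R).

Lemma hol_row_mx (Z : premanifold R) (aZ : holo_atlas Z) m d (f : Z -> affM m) (g : Z -> affM d) z :
  holomorphic_at f z -> holomorphic_at g z ->
  @holomorphic_at R Z (affM (m + d)) (fun z => row_mx (f z) (g z)) z.
Proof.
move=> [cf hf] [cg hg]; have [ac cz] := chart_atP aZ z.
apply: (@hol_by_chart R Z (affM (m + d)) aZ (affM_atlas _) _ z (chart_at z) (idchart _) ac erefl cz I).
  exact: mnear_all.
exact: (holo_row_mx (hf _ (idchart _) ac erefl cz I) (hg _ (idchart _) ac erefl cz I)).
Qed.

Lemma hol_linear n m (L : 'rV[C]_n -> 'rV[C]_m) (x : affM n) : linear L ->
  @holomorphic_at R (affM n) (affM m) L x.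
Proof. by move=> lL; apply/hol_affM; exact: holo_linear. Qed.

Lemma linear_iso_dim n k (f : 'rV[C]_n -> 'rV[C]_k) (g : 'rV[C]_k -> 'rV[C]_n) :
  linear f -> linear g -> cancel f g -> cancel g f -> n = k.
Proof.
have key n' k' (f' : 'rV[C]_n' -> 'rV[C]_k') (g' : 'rV[C]_k' -> 'rV[C]_n') :
    linear f' -> linear g' -> cancel f' g' -> (n' <= k')%N.
  move=> lf lg fg; have := @mulmx1_min C n' k' (lin1_mx (linear_pack lf)) (lin1_mx (linear_pack lg)).
  apply; apply/row_matrixP => i; rewrite row_mul !rowE !mul_rV_lin1 /=.
  by rewrite fg mulmx1.
by move=> lf lg fg gf; apply/eqP; rewrite eqn_leq (key _ _ f g) // (key _ _ g f).
Qed.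

End AffineMaps.

(** * Coordinates on a principal bundle *)

Section TrivCoordinates.
Context {R : realType}.
Local Notation C := (Cx R).
Context (M : premanifold R) (H : lie_data R) (E : bundle_data M H).
Hypotheses (hM : is_complex_manifold M) (hH : is_complex_lie_group H)
  (hE : is_holomorphic_principal_bundle E).
Local Notation p := (@base_proj R M H E).
Local Notation m := (mdim M).
Local Notation d := (mdim (lieM H)).
Local Notation aM := (base_atlas hM).
Local Notation aH := (group_atlas hH).
Local Notation aE := (total_atlas hE).

Context (U : set M) (s : M -> E) (t : E -> lieM H) (ht : is_triv U s t).
Context (phi : chart R M m) (aphi : atlas M phi).
Context (gam : chart R (lieM H) d) (agam : atlas (lieM H) gam).

Let V : set M := [set x | U x /\ cdom phi x].

Lemma triv_dom_near x : V x -> \forall x' \near x, V x'.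
Proof.
move=> [Ux px]; have [h0 _ _ _ _] := ht.
by apply: filterI; [exact: h0 | exact: (cdom_near aM aphi px)].
Qed.

(** The group coordinate is taken relative to [y0]: it is 1 at [y0], so one chart of the group at 1
    serves all centers, and it is unchanged when both points are moved by the same group element. *)
Definition triv_coord (y0 y : E) : affM (m + d) :=
  row_mx (cmap phi (p y)) (cmap gam ((t y : H) * (t y0 : H)^-1)%g).

Definition triv_param (w : affM (m + d)) : E :=
  ract (s (cinv phi (lsubmx w))) (cinv gam (rsubmx w)).

Lemma hol_triv_coord2 (y0 y1 : E) : V (p y0) -> V (p y1) ->
  cdom gam ((t y0 : H) * (t y1 : H)^-1)%g ->
  @holomorphic_at R (prodM E E) (affM (m + d)) (fun q => triv_coord q.2 q.1) (y0, y1).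
Proof.
move=> [Uy py] [Uy1 py1] g1; have [_ _ h2 _ _] := ht; have aP := prodM_atlas aE aE.
apply: (hol_row_mx aP).
  apply: (@hol_comp _ _ _ (affM m) aP aM (fun q : prodM E E => p q.1) (cmap phi)).
    exact: (hol_comp aP aE (hol_fst aE aE _) (hol_proj hE _)).
  exact: (hol_cmap aM aphi).
apply: (@hol_comp _ _ _ (affM d) aP aH (fun q : prodM E E => ((t q.1 : H) * (t q.2 : H)^-1)%g : lieM H) (cmap gam)).
  apply: (hol_mul hH aP).
    by apply: (hol_comp aP aE (hol_fst aE aE _)); exact: h2.
  apply: (hol_invg hH aP).
  by apply: (hol_comp aP aE (hol_snd aE aE _)); exact: h2.
exact: (hol_cmap aH agam).
Qed.

Lemma hol_triv_coord (y0 y1 : E) : V (p y0) -> V (p y1) -> cdom gam ((t y1 : H) * (t y0 : H)^-1)%g ->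
  holomorphic_at (triv_coord y0) y1.
Proof.
move=> h0 h1 g1.
have hp : @holomorphic_at R E (prodM E E) (fun y => (y, y0)) y1.
  by apply: (hol_pair aE aE aE); [exact: (hol_id aE) | exact: (hol_cst aE)].
exact: (hol_comp aE (prodM_atlas aE aE) hp (hol_triv_coord2 h1 h0 g1)).
Qed.

Lemma hol_triv_param (x : M) (h : lieM H) : V x -> cdom gam h ->
  holomorphic_at triv_param (row_mx (cmap phi x) (cmap gam h)).
Proof.
move=> [Ux px] gh; have [_ h1 _ _ _] := ht; have aA := affM_atlas (R := R) (m + d).
apply: (hol_act hH hE aA).
  apply: (@hol_comp _ _ M _ aA aM (fun w : affM (m + d) => cinv phi (lsubmx w)) s).
    apply: (@hol_comp _ _ (affM m) _ aA (affM_atlas m) (@lsubmx C 1 m d) (cinv phi)).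
      by apply: hol_linear; exact: linear_lsubmx.
    by rewrite row_mxKl; exact: (hol_cinv aM aphi).
  by rewrite row_mxKl (cinvK aM aphi px); exact: (h1 x Ux).1.
apply: (@hol_comp _ _ (affM d) _ aA (affM_atlas d) (@rsubmx C 1 m d) (cinv gam)).
  by apply: hol_linear; exact: linear_rsubmx.
by rewrite row_mxKr; exact: (hol_cinv aH agam).
Qed.

Lemma triv_paramK (y0 y : E) : V (p y) -> cdom gam ((t y : H) * (t y0 : H)^-1)%g ->
  ract (triv_param (triv_coord y0 y)) (t y0) = y.
Proof.
move=> [Uy py] gy; have [_ _ _ h3 _] := ht.
rewrite /triv_param /triv_coord row_mxKl row_mxKr (cinvK aM aphi py) (cinvK aH agam gy).
by rewrite -actM mulgVK h3.
Qed.

Lemma triv_coordK (y0 : E) (x : M) (h : lieM H) : V x -> cdom gam h ->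
  triv_coord y0 (ract (triv_param (row_mx (cmap phi x) (cmap gam h))) (t y0)) =
  row_mx (cmap phi x) (cmap gam h).
Proof.
move=> [Ux px] gh; have [_ h1 _ _ h4] := ht.
rewrite /triv_param /triv_coord row_mxKl row_mxKr (cinvK aM aphi px) (cinvK aH agam gh).
by rewrite -actM h4 // (proj_ract hE) (h1 x Ux).2 mulgK.
Qed.

Lemma triv_image_near (x : M) (h : lieM H) : V x -> cdom gam h ->
  \forall w \near (row_mx (cmap phi x) (cmap gam h) : 'rV[C]_(m + d)),
    exists x' h', [/\ V x', cdom gam h' & w = row_mx (cmap phi x') (cmap gam h')].
Proof.
move=> [Ux px] gh.
have cl w : {for w, continuous (@lsubmx C 1 m d)}.
  by apply: holo_continuous; apply: holo_linear; exact: linear_lsubmx.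
have cr w : {for w, continuous (@rsubmx C 1 m d)}.
  by apply: holo_continuous; apply: holo_linear; exact: linear_rsubmx.
have n1 : \forall a \near (cmap phi x : 'rV[C]_m), exists2 x', V x' & a = cmap phi x'.
  have := @cinv_cont _ M aM phi x V aphi px (triv_dom_near (conj Ux px)).
  apply: filterS2 (cinv_near aM aphi px) => a [ca ea] Va.
  by exists (cinv phi a); rewrite ?ea.
have n2 : \forall a \near (cmap gam h : 'rV[C]_d), exists2 h', cdom gam h' & a = cmap gam h'.
  by apply: filterS (chart_image_near aH agam gh) => _ [h' ? <-]; exists h'.
pose w0 : 'rV[C]_(m + d) := row_mx (cmap phi x) (cmap gam h).
have l0 : lsubmx w0 = cmap phi x by rewrite row_mxKl.
have r0 : rsubmx w0 = cmap gam h by rewrite row_mxKr.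
rewrite -l0 in n1; rewrite -r0 in n2.
apply: filterS2 (cont_near (cl w0) n1) (cont_near (cr w0) n2) => w [x' Vx' ex] [h' gh' eh].
by exists x', h'; split=> //; rewrite -ex -eh hsubmxK.
Qed.

Hypothesis gam1 : cdom gam (1%g : H).

Lemma mdiff_coord_param (y0 y : E) v : V (p y) -> cdom gam ((t y : H) * (t y0 : H)^-1)%g -> V (p y0) ->
  mdiff (fun w => ract (triv_param w) (t y0)) (triv_coord y0 y) (mdiff (triv_coord y0) y v) = v.
Proof.
move=> Vy gy Vy0.
have h1 := hol_triv_coord Vy0 Vy gy.
have h2 : holomorphic_at (fun w => ract (triv_param w) (t y0)) (triv_coord y0 y).
  exact: (hol_comp (affM_atlas _) aE (hol_triv_param Vy gy) (hol_ract hH hE _ _)).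
apply: etrans (esym (mdiff_comp aE (affM_atlas _) aE v h1 h2)) _.
rewrite -[RHS](mdiff_id aE y v); apply: (mdiff_ext aE aE).
  have cb := hol_near_pre (hol_cont (hol_proj hE y)) (triv_dom_near Vy).
  have [_ _ ht2 _ _] := ht.
  have hmul : @holomorphic_at R E (lieM H) (fun y => (t y : H) * (t y0 : H)^-1)%g y.
    apply: (hol_mul hH aE); first exact: ht2 Vy.1.
    exact: (@hol_cst R E (lieM H) aE (t y0 : H)^-1%g y).
  have cg := hol_near_pre (hol_cont hmul) (cdom_near aH agam gy).
  by apply: filterS2 cb cg => y' Vy' gy'; exact: triv_paramK.
exact: (hol_comp aE (affM_atlas _) h1 h2).
Qed.

Lemma mdiff_param_coord (y0 : E) (x : M) (h : lieM H) (v : 'rV[C]_(m + d)) : V x -> cdom gam h -> V (p y0) ->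
  mdiff (triv_coord y0) (ract (triv_param (row_mx (cmap phi x) (cmap gam h))) (t y0))
    (mdiff (fun w => ract (triv_param w) (t y0)) (row_mx (cmap phi x) (cmap gam h)) v) = v.
Proof.
move=> Vx gh Vy0; set w0 := row_mx _ _.
have h2 : holomorphic_at (fun w => ract (triv_param w) (t y0)) w0.
  exact: (hol_comp (affM_atlas _) aE (hol_triv_param Vx gh) (hol_ract hH hE _ _)).
have [_ k1 _ _ k4] := ht.
have yE : ract (triv_param w0) (t y0) = ract (s x) ((h : H) * (t y0 : H))%g.
  by rewrite /triv_param /w0 row_mxKl row_mxKr (cinvK aM aphi Vx.2) (cinvK aH agam gh) actM.
have h1 : holomorphic_at (triv_coord y0) (ract (triv_param w0) (t y0)).
  rewrite yE; apply: hol_triv_coord => //.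
    by rewrite (proj_ract hE) (k1 x Vx.1).2.
  by rewrite k4 ?mulgK //; exact: Vx.1.
apply: etrans (esym (mdiff_comp (affM_atlas _) aE (affM_atlas _) v h2 h1)) _.
rewrite -[RHS](mdiff_id (affM_atlas (m + d)) w0 v); apply: (mdiff_ext (affM_atlas _) (affM_atlas _)).
  apply/affM_near; apply: filterS (triv_image_near Vx gh) => w [x' [h' [Vx' gh' ->]]].
  exact: triv_coordK.
exact: (hol_comp (affM_atlas _) aE h2 h1).
Qed.

Lemma triv_coord_base (y : E) : triv_coord y y = row_mx (cmap phi (p y)) (cmap gam (1%g : H)).
Proof. by rewrite /triv_coord mulgV. Qed.

(** The differentials of the coordinates and of their inverse are mutually inverse linear maps. *)
Lemma bundle_dim (x : M) : V x -> mdim E = (m + d)%N.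
Proof.
have [_ k1 _ _ _] := ht => Vx; pose y := s x; have py : p y = x := (k1 x Vx.1).2.
have Vy : V (p y) by rewrite py.
have gy : cdom gam ((t y : H) * (t y : H)^-1)%g by rewrite mulgV.
have yE : ract (triv_param (triv_coord y y)) (t y) = y by exact: triv_paramK.
apply: (@linear_iso_dim R _ _ (mdiff (triv_coord y) y)
   (mdiff (fun w => ract (triv_param w) (t y)) (triv_coord y y))).
- by move=> a u v; exact: mdiffP.
- by move=> a u v; exact: mdiffP.
- by move=> v; exact: mdiff_coord_param.
move=> v; have := @mdiff_param_coord y (p y) (1%g : H) v Vy gam1 Vy.
by rewrite -triv_coord_base yE.
Qed.

End TrivCoordinates.

(** * The Atiyah bundle as a manifold *)

Section AtiyahManifold.
Context {R : realType}.
Local Notation C := (Cx R).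
Context (M : premanifold R) (H : lie_data R) (E : bundle_data M H).
Hypotheses (hM : is_complex_manifold M) (hH : is_complex_lie_group H)
  (hE : is_holomorphic_principal_bundle E).
Local Notation p := (@base_proj R M H E).
Local Notation m := (mdim M).
Local Notation d := (mdim (lieM H)).
Local Notation aM := (base_atlas hM).
Local Notation aH := (group_atlas hH).
Local Notation aE := (total_atlas hE).

Section Chart.
Context (U : set M) (s : M -> E) (t : E -> lieM H) (ht : is_triv U s t).
Context (phi : chart R M m) (aphi : atlas M phi).
Context (gam : chart R (lieM H) d) (agam : atlas (lieM H) gam).
Hypothesis gam1 : cdom gam (1%g : H).
Local Notation V := [set x | U x /\ cdom phi x].

(** Base point, and components of the vector in the coordinates centered at [yv.1]. Translation
    moves center and vector together, so the value depends on the orbit only. *)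
Definition at_coord (yv : tangentM E) : affM (m + (m + d)) :=
  row_mx (cmap phi (p yv.1)) (mdiff (triv_coord t phi gam yv.1) yv.1 yv.2).

(** A section of the quotient map through points with group coordinate [h]; since the coordinates
    are centered, the group component of [q] is the chart value of 1. *)
Definition at_param (h : H) (w : affM (m + (m + d))) : tangentM E :=
  let q : affM (m + d) := row_mx (lsubmx w) (cmap gam (1%g : H)) in
  mkT (ract (triv_param s phi gam q) h)
    (mdiff (fun w' => ract (triv_param s phi gam w') h) q (rsubmx w)).

Lemma hol_at_coord (yv : tangentM E) : V (p yv.1) -> holomorphic_at at_coord yv.
Proof.
case: yv => y v /= Vy; have aT := tangentM_atlas aE.
apply: (hol_row_mx aT).
  apply: (@hol_comp _ _ _ (affM m) aT aM (fun yv : tangentM E => p yv.1) (cmap phi)).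
    exact: (hol_comp aT aE (hol_T_base aE _) (hol_proj hE _)).
  exact: (hol_cmap aM aphi Vy.2).
apply: (@hol_T_diagonal R E aE (m + d) (fun q => triv_coord t phi gam q.2 q.1) y v).
by apply: (hol_triv_coord2 hM hH hE ht aphi agam Vy Vy); rewrite mulgV.
Qed.

Lemma hol_at_param (h : H) (x : M) (r : 'rV[C]_(m + d)) : V x ->
  holomorphic_at (at_param h) (row_mx (cmap phi x) r).
Proof.
move=> Vx; pose psi w' := ract (triv_param s phi gam w') h.
have hpsi : holomorphic_at psi (row_mx (cmap phi x) (cmap gam (1%g : H))).
  exact: (hol_comp (affM_atlas _) aE (hol_triv_param hM hH hE ht aphi agam Vx gam1)
            (hol_ract hH hE _ _)).
have aA n := affM_atlas (R := R) n.
pose w0 : affM (m + (m + d)) := row_mx (cmap phi x) r.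
have h1 : @holomorphic_at R (affM (m + (m + d))) (affM ((m + d) + (m + d)))
    (fun w => row_mx (row_mx (lsubmx w) (cmap gam (1%g : H))) (rsubmx w)) w0.
  apply: (hol_row_mx (aA _)).
    apply: (hol_row_mx (aA _)).
      by apply: hol_linear; exact: linear_lsubmx.
    exact: (@hol_cst R (affM (m + (m + d))) (affM d) (aA _) (cmap gam (1%g : H)) w0).
  by apply: hol_linear; exact: linear_rsubmx.
have h2 := hol_T_in aE r hpsi.
rewrite -[X in row_mx (row_mx X _) _ ](row_mxKl (cmap phi x) r) in h2.
rewrite -[X in row_mx (row_mx (lsubmx _) _) X](row_mxKr (cmap phi x) r) in h2.
have h3 := hol_comp (aA _) (aA _) h1 h2.
apply: (hol_ext (aA _) _ h3); apply: mnear_all => w /=.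
by rewrite row_mxKl row_mxKr.
Qed.

Lemma at_paramK (y : E) v : V (p y) -> at_param (t y) (at_coord (mkT y v)) = mkT y v.
Proof.
move=> Vy; rewrite /at_param /at_coord row_mxKl row_mxKr /=.
rewrite -(triv_coord_base t phi gam y).
rewrite (triv_paramK hM hH ht aphi agam) ?mulgV //.
by rewrite (mdiff_coord_param hM hH hE ht aphi agam) ?mulgV.
Qed.

Lemma at_coordK (h : H) (x : M) (r : 'rV[C]_(m + d)) : V x ->
  V (p (at_param h (row_mx (cmap phi x) r)).1) /\
  at_coord (at_param h (row_mx (cmap phi x) r)) = row_mx (cmap phi x) r.
Proof.
move=> Vx; have [_ h1 _ _ h4] := ht.
rewrite /at_param /at_coord row_mxKl row_mxKr /=.
set q := row_mx _ _; set y := ract _ h.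
have yE : y = ract (s x) h.
  by rewrite /y /triv_param /q row_mxKl row_mxKr (cinvK aM aphi Vx.2) (cinvK aH agam gam1) act1.
have py : p y = x by rewrite yE (proj_ract hE) (h1 x Vx.1).2.
have ty : t y = h by rewrite yE h4 //; exact: Vx.1.
have Vy : V (p y) by rewrite py.
split=> //; rewrite py; congr row_mx.
have := @mdiff_param_coord R M H E hM hH hE U s t ht phi aphi gam agam y x (1%g : H) r Vx gam1 Vy.
by rewrite -/q ty -/y.
Qed.

(** Invariance is [key]. Conversely, equal base coordinates put both points on one orbit, and after
    a translation equal components give equal vectors, the differential of the coordinates being
    injective. *)
Lemma at_coord_rel (y y' : E) v v' : V (p y) -> V (p y') ->
  at_coord (mkT y v) = at_coord (mkT y' v') <-> at_rel (mkT y v) (mkT y' v').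
Proof.
move=> Vy Vy'.
have key (h : H) w : mdiff (triv_coord t phi gam (ract y h)) (ract y h)
    (mdiff (fun y : E => ract y h) y w) = mdiff (triv_coord t phi gam y) y w.
  have Vyh : V (p (ract y h)) by rewrite (proj_ract hE).
  have gy1 : cdom gam ((t y : H) * (t y : H)^-1)%g by rewrite mulgV.
  have gy2 : cdom gam ((t (ract y h) : H) * (t (ract y h) : H)^-1)%g by rewrite mulgV.
  have k1 := hol_triv_coord hM hH hE ht aphi agam Vyh Vyh gy2.
  apply: etrans (esym (mdiff_comp aE aE (affM_atlas _) w (hol_ract hH hE h y) k1)) _.
  apply: (mdiff_ext aE (affM_atlas _)); last first.
    exact: (hol_comp aE aE (hol_ract hH hE h y) k1).
  apply: filterS (hol_near_pre (hol_cont (hol_proj hE y)) (triv_dom_near hM ht aphi Vy)).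
  move=> y1 Vy1; rewrite /triv_coord /= (proj_ract hE).
  rewrite (triv_ract h ht Vy1.1) (triv_ract h ht Vy.1) invgM.
  by rewrite mulgA mulgK.
split=> [|[h [-> ->]]]; last first.
  by rewrite /at_coord /= (proj_ract hE) key.
move=> /eq_row_mx[/= e1 e2].
have epy : p y = p y' by rewrite -(cinvK aM aphi Vy.2) e1 (cinvK aM aphi Vy'.2).
have [h yh] := act_transitive hE epy; exists h; rewrite /= yh; congr mkT.
rewrite yh in e2 Vy'.
rewrite -(@mdiff_coord_param R M H E hM hH hE U s t ht phi aphi gam agam _ _ v' Vy' _ Vy') ?mulgV //.
rewrite -e2 -(key h) (@mdiff_coord_param R M H E hM hH hE U s t ht phi aphi gam agam _ _ _ Vy' _ Vy') ?mulgV //.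
Qed.

Lemma at_chart : V !=set0 ->
  exists2 c, atlas (quotM (@at_rel R M H E) (m + (m + d))) c &
    forall yv : tangentM E, V (p yv.1) -> cdom c (quot_class (@at_rel R M H E) yv).
Proof.
move=> [x Vx].
have aT := tangentM_atlas aE.
have [c ac [dc _]] : exists2 c, atlas (quotM (@at_rel R M H E) (m + (m + d))) c &
    (forall yv : tangentM E, V (p yv.1) -> cdom c (quot_class (@at_rel R M H E) yv)) /\
    (forall yv : tangentM E, V (p yv.1) -> cmap c (quot_class (@at_rel R M H E) yv) = at_coord yv).
  apply: (@quot_chart R (tangentM E) aT (@at_rel R M H E) (m + (m + d))
     (at_rel_refl hE) (at_rel_sym hH hE) (at_rel_trans hH hE) [set yv | V (p yv.1)] at_coord).
  - move=> yv Vy; apply: (@hol_near_pre R (tangentM E) M (fun yv => p yv.1) yv V).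
      exact: (hol_cont (hol_comp aT aE (hol_T_base aE yv) (hol_proj hE _))).
    exact: (triv_dom_near hM ht aphi Vy).
  - by move=> [y v] _ Vy [h ->]; rewrite /= (proj_ract hE).
  - by move=> [y v] [y' v'] Vy Vy'; exact: at_coord_rel.
  - by move=> yv Vy; exact: hol_at_coord.
  - move=> [y v] Vy; exists (at_param (t y)); split.
    + exact: at_paramK.
    + exact: hol_at_param.
    have Vn : \forall a \near (cmap phi (p y) : 'rV[C]_m), exists2 x', V x' & a = cmap phi x'.
      have := @cinv_cont _ M aM phi _ V aphi Vy.2 (triv_dom_near hM ht aphi Vy).
      apply: filterS2 (cinv_near aM aphi Vy.2) => a [ca ea] Va.
      by exists (cinv phi a); rewrite ?ea.
    have cl w : {for w, continuous (@lsubmx C 1 m (m + d))}.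
      by apply: holo_continuous; apply: holo_linear; exact: linear_lsubmx.
    rewrite -(row_mxKl (cmap phi (p y)) (mdiff (triv_coord t phi gam y) y v)) in Vn.
    apply: filterS (cont_near (cl _) Vn) => w [x' Vx' ex].
    by rewrite -(hsubmxK w) ex; exact: at_coordK.
  have [_ h1 _ _ _] := ht.
  by exists (mkT (s x) 0); rewrite /= (h1 x Vx.1).2.
by exists c.
Qed.

End Chart.

Lemma chart_one_exists : exists gam, atlas (lieM H) gam /\ cdom gam (1%g : H).
Proof. by have [cov _ _] := aH; have [gam ag g1] := cov (1%g : H); exists gam. Qed.

Lemma bundle_dimE (y : E) : mdim E = (m + d)%N.
Proof.
have [U [s [t [ht Uy]]]] := triv_exists hE (p y).
have [cov _ _] := aM; have [phi aphi py] := cov (p y).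
have [gam [agam g1]] := chart_one_exists.
exact: (@bundle_dim R M H E hM hH hE U s t ht phi aphi gam agam g1 (p y) (conj Uy py)).
Qed.

Lemma at_cov (a : atiyahM E) : exists2 c, atlas (atiyahM E) c & cdom c a.
Proof.
have [y [v [-> _]]] := at_class_repr a.
have [U [s [t [ht Uy]]]] := triv_exists hE (p y).
have [cov _ _] := aM; have [phi aphi py] := cov (p y).
have [gam [agam g1]] := chart_one_exists.
rewrite /at_class /atiyahM.
(* The subtraction of natural numbers is meaningful here because [mdim E] is m + d. *)
have -> : (mdim (tangentM E) - lie_dim H = m + (m + d))%N.
  by rewrite /= (bundle_dimE y) /=; lia.
have [c ac dc] := @at_chart U s t ht phi aphi gam agam g1 (ex_intro _ _ (conj Uy py)).
by exists c => //; exact: (dc (mkT y v) (conj Uy py)).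
Qed.

Lemma atiyah_atlas : holo_atlas (atiyahM E).
Proof. exact: (quotM_atlas (tangentM_atlas aE) at_cov). Qed.

Lemma hol_at_class (yv : tangentM E) :
  @holomorphic_at R (tangentM E) (atiyahM E) (fun yv => at_class yv.1 yv.2) yv.
Proof.
have h := hol_quot_class (tangentM_atlas aE) at_cov yv.
by apply: (hol_ext (tangentM_atlas aE) _ h); apply: mnear_all => -[].
Qed.

Lemma hol_at_desc (Y : premanifold R) (F : atiyahM E -> Y) (y : E) v :
  @holomorphic_at R (tangentM E) Y (fun yv => F (at_class yv.1 yv.2)) (y, v) ->
  holomorphic_at F (at_class y v).
Proof.
move=> h; apply: (hol_quot_desc (tangentM_atlas aE) at_cov).
by apply: (hol_ext (tangentM_atlas aE) _ h); apply: mnear_all => -[].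
Qed.

End AtiyahManifold.

(** * The adjoint bundle as a manifold *)

Section AdjointManifold.
Context {R : realType}.
Local Notation C := (Cx R).
Context (M : premanifold R) (H : lie_data R) (E : bundle_data M H).
Hypotheses (hM : is_complex_manifold M) (hH : is_complex_lie_group H)
  (hE : is_holomorphic_principal_bundle E).
Local Notation p := (@base_proj R M H E).
Local Notation m := (mdim M).
Local Notation d := (mdim (lieM H)).
Local Notation aM := (base_atlas hM).
Local Notation aH := (group_atlas hH).
Local Notation aE := (total_atlas hE).
Local Notation aEH := (prodM_atlas aE aH).

(** Constant on the classes of [ad_rel]: this is the fiber coordinate of Ad(E) in the
    trivialization. *)
Definition ad_fiber (t : E -> lieM H) (yz : prodM E (lieM H)) : lieM H :=
  ((t yz.1 : H) * yz.2 * (t yz.1 : H)^-1)%g.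

Section Chart.
Context (U : set M) (s : M -> E) (t : E -> lieM H) (ht : is_triv U s t).

Lemma hol_ad_fiber (yz : prodM E (lieM H)) : U (p yz.1) -> holomorphic_at (ad_fiber t) yz.
Proof.
move=> Uy; have [_ _ h2 _ _] := ht.
have h1 : holomorphic_at (fun yz : prodM E (lieM H) => t yz.1) yz.
  exact: (hol_comp aEH aE (hol_fst aE aH yz) (h2 _ Uy)).
exact: (hol_mul hH aEH (hol_mul hH aEH h1 (hol_snd aE aH yz)) (hol_invg hH aEH h1)).
Qed.

Lemma ad_fiber_rel (yz yz' : prodM E (lieM H)) : U (p yz.1) ->
  (p yz.1 = p yz'.1 /\ ad_fiber t yz = ad_fiber t yz') <-> ad_rel yz yz'.
Proof.
case: yz yz' => y z [y' z'] /= Uy; split=> [[epy]|[h [-> ->]]]; last first.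
  rewrite (proj_ract hE) /ad_fiber /= (triv_ract h ht Uy) /conjg invgM; split=> //.
  by rewrite !mulgA mulgK mulgK.
have [h ->] := act_transitive hE epy; rewrite /ad_fiber /= (triv_ract h ht Uy) invgM => e.
exists h; rewrite /=; congr pair; rewrite /conjg.
have : ((t y : H)^-1 * (t y * z * (t y)^-1) * t y = 
        (t y : H)^-1 * (t y * h * z' * (h^-1 * (t y)^-1)) * t y)%g by rewrite e.
rewrite !mulgA mulgVK mulVg !mul1g mulgVK => ->.
by rewrite !mulgA mulVg mul1g mulgVK.
Qed.

Context (phi : chart R M m) (aphi : atlas M phi).
Context (gam : chart R (lieM H) d) (agam : atlas (lieM H) gam).
Local Notation V := [set x | U x /\ cdom phi x].

Lemma ad_chart (y0 : E) (z0 : H) : V (p y0) -> cdom gam (ad_fiber t (y0, z0)) ->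
  exists2 c, atlas (quotM (@ad_rel R M H E) (m + d)) c &
    cdom c (quot_class (@ad_rel R M H E) (y0, z0)).
Proof.
move=> Vy0 gy0; have [_ k1 _ _ k4] := ht.
pose D : set (prodM E (lieM H)) := [set yz | V (p yz.1) /\ cdom gam (ad_fiber t yz)].
pose Q (yz : prodM E (lieM H)) : affM (m + d) := row_mx (cmap phi (p yz.1)) (cmap gam (ad_fiber t yz)).
have hpf (yz : prodM E (lieM H)) : holomorphic_at (fun yz : prodM E (lieM H) => p yz.1) yz.
  exact: (hol_comp aEH aE (hol_fst aE aH yz) (hol_proj hE _)).
have [c ac [dc _]] : exists2 c, atlas (quotM (@ad_rel R M H E) (m + d)) c &
    (forall yz, D yz -> cdom c (quot_class (@ad_rel R M H E) yz)) /\
    (forall yz, D yz -> cmap c (quot_class (@ad_rel R M H E) yz) = Q yz).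
  apply: (@quot_chart R (prodM E (lieM H)) aEH (@ad_rel R M H E) (m + d)
    (@ad_rel_refl _ _ _ _) (@ad_rel_sym _ _ _ _) (@ad_rel_trans _ _ _ _) D Q).
  - move=> yz [Vy gz]; apply: filterI.
      exact: (hol_near_pre (hol_cont (hpf yz)) (triv_dom_near hM ht aphi Vy)).
    exact: (hol_near_pre (hol_cont (hol_ad_fiber Vy.1)) (cdom_near aH agam gz)).
  - by move=> yz yz' [Vy gz] /(ad_fiber_rel yz' Vy.1)[e1 e2]; rewrite /D /= -e1 -e2.
  - move=> yz yz' [Vy gz] [Vy' gz']; split=> [/eq_row_mx[e1 e2]|/(ad_fiber_rel yz' Vy.1)[e1 e2]].
      apply/(ad_fiber_rel yz' Vy.1); split.
        by rewrite -(cinvK aM aphi Vy.2) e1 (cinvK aM aphi Vy'.2).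
      by rewrite -(cinvK aH agam gz) e2 (cinvK aH agam gz').
    by rewrite /Q e1 e2.
  - move=> yz [Vy gz]; apply: (hol_row_mx aEH).
      exact: (@hol_comp _ _ _ (affM m) aEH aM _ _ _ (hpf yz) (hol_cmap aM aphi Vy.2)).
    exact: (@hol_comp _ _ _ (affM d) aEH aH _ _ _ (hol_ad_fiber Vy.1) (hol_cmap aH agam gz)).
  - move=> [y z] [Vy gz]; have aA n := affM_atlas (R := R) n.
    pose h : H := t y.
    (* The section keeps the group coordinate [h] of [y], so that it passes through (y, z). *)
    exists (fun w => (ract (s (cinv phi (lsubmx w))) h, h^-1 * cinv gam (rsubmx w) * h)%g); split.
    + rewrite /Q row_mxKl row_mxKr (cinvK aM aphi Vy.2) (cinvK aH agam gz) /ad_fiber /=.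
      have [_ _ _ k3 _] := ht; rewrite (k3 y Vy.1); congr pair.
      by rewrite -/h !mulgA mulgVK mulVg mul1g.
    + have hl : @holomorphic_at R (affM (m + d)) M (fun w => cinv phi (lsubmx w)) (Q (y, z)).
        apply: (@hol_comp _ _ (affM m) _ (aA _) (aA _) (@lsubmx C 1 m d) (cinv phi)).
          by apply: hol_linear; exact: linear_lsubmx.
        by rewrite row_mxKl; exact: (hol_cinv aM aphi Vy.2).
      have hr : @holomorphic_at R (affM (m + d)) (lieM H) (fun w => cinv gam (rsubmx w)) (Q (y, z)).
        apply: (@hol_comp _ _ (affM d) _ (aA _) (aA _) (@rsubmx C 1 m d) (cinv gam)).
          by apply: hol_linear; exact: linear_rsubmx.
        by rewrite row_mxKr; exact: (hol_cinv aH agam gz).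
      have hc (g : lieM H) : @holomorphic_at R (affM (m + d)) (lieM H) (fun=> g) (Q (y, z)).
        exact: (@hol_cst R (affM (m + d)) (lieM H) (aA _) g (Q (y, z))).
      apply: (hol_pair aE aH (aA _)).
        apply: (hol_act hH hE (aA _)) (hc h).
        apply: (hol_comp (aA _) aM hl); rewrite /Q row_mxKl (cinvK aM aphi Vy.2).
        exact: (k1 _ Vy.1).1.
      exact: (hol_mul hH (aA _) (hol_mul hH (aA _) (hc h^-1%g) hr) (hc h)).
    apply: filterS (triv_image_near hM hH ht aphi agam Vy gz) => w [x' [h' [Vx' gh' ->]]].
    rewrite row_mxKl row_mxKr (cinvK aM aphi Vx'.2) (cinvK aH agam gh').
    have e1 : p (ract (s x') h) = x' by rewrite (proj_ract hE) (k1 x' Vx'.1).2.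
    have e2 : ad_fiber t (ract (s x') h, h^-1 * h' * h)%g = h'.
      rewrite /ad_fiber /= k4; last exact: Vx'.1.
      by rewrite !mulgA mulgV mul1g mulgK.
    by rewrite /D /Q /= e1 e2.
  by exists (y0, z0).
by exists c => //; exact: (dc (y0, z0)).
Qed.

End Chart.

Lemma ad_cov (a : AdM E) : exists2 c, atlas (AdM E) c & cdom c a.
Proof.
rewrite -(quot_reprK a); case: (quot_repr a) => y z.
have [U [s [t [ht Uy]]]] := triv_exists hE (p y).
have [cov _ _] := aM; have [phi aphi py] := cov (p y).
have [covH _ _] := aH; have [gam agam gz] := covH (ad_fiber t (y, z)).
rewrite /AdM; have -> := bundle_dimE hM hH hE y.
exact: (@ad_chart U s t ht phi aphi gam agam y z (conj Uy py) gz).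
Qed.

Lemma ad_atlas : holo_atlas (AdM E).
Proof. exact: (quotM_atlas aEH ad_cov). Qed.

Lemma hol_ad_class (yz : prodM E (lieM H)) :
  @holomorphic_at R (prodM E (lieM H)) (AdM E) (fun yz => ad_class yz.1 yz.2) yz.
Proof.
have h := hol_quot_class aEH ad_cov yz.
by apply: (hol_ext aEH _ h); apply: mnear_all => -[].
Qed.

Lemma hol_ad_desc (Y : premanifold R) (F : AdM E -> Y) (y : E) (z : H) :
  @holomorphic_at R (prodM E (lieM H)) Y (fun yz => F (ad_class yz.1 yz.2)) (y, z) ->
  holomorphic_at F (ad_class y z).
Proof.
move=> h; apply: (hol_quot_desc aEH ad_cov).
by apply: (hol_ext aEH _ h); apply: mnear_all => -[].
Qed.

Lemma hol_ad_proj (a : AdM E) : holomorphic_at (@ad_proj R M H E) a.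
Proof.
rewrite -(quot_reprK a); case: (quot_repr a) => y z.
apply: hol_ad_desc.
have h : holomorphic_at (fun yz : prodM E (lieM H) => p yz.1) (y, z).
  exact: (hol_comp aEH aE (hol_fst aE aH (y, z)) (hol_proj hE _)).
by apply: (hol_ext aEH _ h); apply: mnear_all => -[y' z']; rewrite /= ad_proj_class.
Qed.

Definition ad_triv (t : E -> lieM H) (a : AdM E) : lieM H := ad_fiber t (quot_repr a).

Lemma ad_trivE (U : set M) (s : M -> E) (t : E -> lieM H) (y : E) (z : H) :
  is_triv U s t -> U (p y) -> ad_triv t (ad_class y z) = ((t y : H) * z * (t y : H)^-1)%g.
Proof.
move=> ht Uy; rewrite /ad_triv /ad_class.
have h := quot_repr_rel (@ad_rel_refl _ _ _ E) (@ad_rel_sym _ _ _ E) (@ad_rel_trans _ _ _ E) (y, z).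
have [_ <-] := (@ad_fiber_rel U s t ht (y, z) _ Uy).2 (ad_rel_sym h).
by [].
Qed.

Lemma hol_ad_triv (U : set M) (s : M -> E) (t : E -> lieM H) (y : E) (z : H) :
  is_triv U s t -> U (p y) -> holomorphic_at (ad_triv t) (ad_class y z).
Proof.
move=> ht Uy; apply: hol_ad_desc; have [h0 _ _ _ _] := ht.
have h1 := @hol_ad_fiber U s t ht (y, z) Uy; apply: (hol_ext aEH _ h1).
have h2 : holomorphic_at (fun yz : prodM E (lieM H) => p yz.1) (y, z).
  exact: (hol_comp aEH aE (hol_fst aE aH (y, z)) (hol_proj hE _)).
apply: filterS (hol_near_pre (hol_cont h2) (h0 _ Uy)) => -[y' z'] /= Uy'.
by rewrite (ad_trivE _ ht Uy').
Qed.

End AdjointManifold.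

(** * Algebraic tori *)

Section TorusAlgebra.
Context {R : realType}.
Local Notation C := (Cx R).

Lemma polynomial_sub n (f g : 'rV[C]_n -> C) :
  polynomial_fun f -> polynomial_fun g -> polynomial_fun (fun z => f z - g z).
Proof.
move=> hf hg; have -> : (fun z => f z - g z) = (fun z => f z + (fun=> -1) z * g z).
  by apply/funext => z; rewrite mulN1r.
apply: (Poly_add hf); apply: (fun h => Poly_mul h hg); exact: Poly_const.
Qed.

Lemma polynomial_comp n m (f : 'rV[C]_m -> C) (g : 'rV[C]_n -> 'rV[C]_m) :
  polynomial_fun f -> polynomial_map g -> polynomial_fun (f \o g).
Proof.
move=> hf hg; elim: hf => [a|i|f1 f2 _ h1 _ h2|f1 f2 _ h1 _ h2].
- exact: Poly_const.
- exact: hg.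
- exact: Poly_add h1 h2.
exact: Poly_mul h1 h2.
Qed.

Lemma polynomial_map_comp n m k (f : 'rV[C]_m -> 'rV[C]_k) (g : 'rV[C]_n -> 'rV[C]_m) :
  polynomial_map f -> polynomial_map g -> polynomial_map (f \o g).
Proof. by move=> hf hg j; exact: polynomial_comp (hf j) hg. Qed.

Lemma polynomial_row_mx n m k (f : 'rV[C]_n -> 'rV[C]_m) (g : 'rV[C]_n -> 'rV[C]_k) :
  polynomial_map f -> polynomial_map g -> polynomial_map (fun z => row_mx (f z) (g z)).
Proof.
move=> hf hg j; rewrite -(splitK j); case: (fintype.split j) => i /=.
  by have -> : (fun z => row_mx (f z) (g z) 0 (lshift k i)) = (fun z => f z 0 i)
    by apply/funext => z; rewrite row_mxEl.
by have -> : (fun z => row_mx (f z) (g z) 0 (rshift m i)) = (fun z => g z 0 i)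
  by apply/funext => z; rewrite row_mxEr.
Qed.

Lemma polynomial_lsubmx n m : polynomial_map (@lsubmx C 1 n m).
Proof.
move=> j; have -> : (fun z : 'rV[C]_(n + m) => lsubmx z 0 j) = (fun z => z 0 (lshift m j)).
  by apply/funext => z; rewrite mxE.
exact: Poly_coord.
Qed.

Lemma polynomial_rsubmx n m : polynomial_map (@rsubmx C 1 n m).
Proof.
move=> j; have -> : (fun z : 'rV[C]_(n + m) => rsubmx z 0 j) = (fun z => z 0 (rshift n j)).
  by apply/funext => z; rewrite mxE.
exact: Poly_coord.
Qed.

(** On nonzero arguments, [h] is a Laurent polynomial with exponents between -D and D. *)
Definition laurent (D : nat) (h : C -> C) : Prop :=
  exists2 q : {poly C}, (size q <= D.*2.+1)%N & forall u, u != 0 -> u ^+ D * h u = q.[u].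

Lemma laurent_cst D a : laurent D (fun=> a).
Proof.
exists (a *: 'X^D); last by move=> u _; rewrite !hornerE mulrC.
by apply: leq_trans (size_scale_leq _ _) _; rewrite size_polyXn; lia.
Qed.

Lemma laurent_id : laurent 1 id.
Proof. by exists 'X^2; [rewrite size_polyXn | move=> u _; rewrite !hornerE]. Qed.

Lemma laurent_inv : laurent 1 (fun u => u^-1).
Proof.
by exists 1; [rewrite size_poly1 | move=> u u0; rewrite !hornerE divff].
Qed.

Lemma laurent_add D h1 h2 : laurent D h1 -> laurent D h2 -> laurent D (fun u => h1 u + h2 u).
Proof.
move=> [q1 s1 e1] [q2 s2 e2]; exists (q1 + q2).
  by apply: leq_trans (size_polyD _ _) _; rewrite geq_max s1.
by move=> u u0; rewrite mulrDr e1 // e2 // hornerD.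
Qed.

Lemma laurent_mul D1 D2 h1 h2 : laurent D1 h1 -> laurent D2 h2 ->
  laurent (D1 + D2) (fun u => h1 u * h2 u).
Proof.
move=> [q1 s1 e1] [q2 s2 e2]; exists (q1 * q2).
  by apply: leq_trans (size_polyMleq _ _) _; lia.
by move=> u u0; rewrite hornerM -e1 // -e2 // exprD; ring.
Qed.

Lemma laurent_le D1 D2 h : (D1 <= D2)%N -> laurent D1 h -> laurent D2 h.
Proof.
move=> le12 [q s e]; exists ('X^(D2 - D1) * q).
  by apply: leq_trans (size_polyMleq _ _) _; rewrite size_polyXn; lia.
by move=> u u0; rewrite hornerM hornerXn -e // mulrA -exprD subnK.
Qed.

(** The bound depends on [q] only, not on the curve [W], whose entries will be u, 1/u or
    constants. *)
Lemma laurent_polynomial N (q : 'rV[C]_N -> C) : polynomial_fun q ->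
  exists D, forall W : C -> 'rV[C]_N, (forall i, laurent 1 (fun u => W u 0 i)) ->
    laurent D (fun u => q (W u)).
Proof.
elim=> [a|i|f1 f2 _ [D1 h1] _ [D2 h2]|f1 f2 _ [D1 h1] _ [D2 h2]].
- by exists 0%N => W _; exact: laurent_cst.
- by exists 1%N => W; exact.
- exists (D1 + D2)%N => W hW; apply: laurent_add.
    by apply: (@laurent_le D1); [exact: leq_addr | exact: h1].
  by apply: (@laurent_le D2); [exact: leq_addl | exact: h2].
by exists (D1 + D2)%N => W hW; apply: laurent_mul; [exact: h1 | exact: h2].
Qed.

Lemma laurent_eq0 D h (rs : seq C) : laurent D h -> uniq rs -> (D.*2 < size rs)%N ->
  (forall u, u \in rs -> u != 0 /\ h u = 0) -> forall u, u != 0 -> h u = 0.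
Proof.
move=> [q sq e] urs srs hrs u u0.
have q0 : q = 0.
  apply/eqP; apply: contraT => q0.
  suff rq : all (root q) rs.
    have sz := max_poly_roots q0 rq urs; have := leq_trans (leq_ltn_trans srs sz) sq.
    by rewrite ltnn.
  by apply/allP => v /hrs[v0 hv]; rewrite /root -e // hv mulr0.
by apply/eqP; have := e u u0; rewrite q0 horner0 => /eqP; rewrite mulf_eq0 expf_eq0 (negPf u0) andbF.
Qed.

(** Zariski density of large grids, with a size that does not depend on the parameter [c].
    Coordinates are released from the grid one at a time, by counting zeros of a Laurent polynomial
    in one variable. *)
Lemma torus_density k e (q : 'rV[C]_((k + k) + e) -> C) : polynomial_fun q ->
  exists D, forall (rs : seq C) (c : 'rV[C]_e), uniq rs -> (D < size rs)%N -> 0 \notin rs ->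
    (forall z : 'rV[C]_k, (forall i, z 0 i \in rs) -> q (row_mx (row_mx z (Gm_inv z)) c) = 0) ->
    forall z : 'rV[C]_k, Gm z -> q (row_mx (row_mx z (Gm_inv z)) c) = 0.
Proof.
move=> /laurent_polynomial[D hD]; exists D.*2 => rs c urs srs rs0 h0.
have rsN u : u \in rs -> u != 0 by move=> hu; apply: contraNneq rs0 => <-.
pose upd (z : 'rV[C]_k) i u : 'rV[C]_k := \row_j (if j == i then u else z 0 j).
(* The first [j] coordinates are free, the others lie in the grid. *)
suff key j : (j <= k)%N -> forall z : 'rV[C]_k, Gm z ->
    (forall i : 'I_k, (j <= i)%N -> z 0 i \in rs) -> q (row_mx (row_mx z (Gm_inv z)) c) = 0.
  by move=> z hz; apply: (key k) => // i; rewrite leqNgt ltn_ord.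
elim: j => [_ z hz hi|j IH jk z hz hi]; first by apply: h0 => i; exact: hi.
pose i0 := Ordinal jk.
have zE : z = upd z i0 (z 0 i0) by apply/rowP => i; rewrite mxE; case: eqP => [->|].
rewrite zE.
apply: (@laurent_eq0 D (fun u => q (row_mx (row_mx (upd z i0 u) (Gm_inv (upd z i0 u))) c)) rs) => //; last first.
- move=> u hu; split; first exact: rsN.
  apply: IH; first exact: ltnW.
    by move=> i; rewrite mxE; case: (i =P i0) => _; [exact: rsN | exact: hz].
  move=> i ji; rewrite mxE; case: (i =P i0) => // ii0; apply: hi.
  by rewrite ltn_neqAle ji andbT; apply/eqP => ij; apply: ii0; exact: val_inj.
apply: hD => i; rewrite -(splitK i); case: (fintype.split i) => [i1|i1] /=; last first.
  have -> : (fun u => row_mx (row_mx (upd z i0 u) (Gm_inv (upd z i0 u))) c 0 (rshift _ i1)) = fun=> c 0 i1.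
    by apply/funext => u; rewrite row_mxEr.
  exact: laurent_cst.
rewrite -(splitK i1); case: (fintype.split i1) => [i2|i2] /=.
  have -> : (fun u => row_mx (row_mx (upd z i0 u) (Gm_inv (upd z i0 u))) c 0 (lshift _ (lshift _ i2))) =
      fun u => if i2 == i0 then u else z 0 i2.
    by apply/funext => u; rewrite !row_mxEl mxE.
  by case: eqP => _; [exact: laurent_id | exact: laurent_cst].
have -> : (fun u => row_mx (row_mx (upd z i0 u) (Gm_inv (upd z i0 u))) c 0 (lshift _ (rshift _ i2))) =
    fun u => if i2 == i0 then u^-1 else (z 0 i2)^-1.
  by apply/funext => u; rewrite row_mxEl row_mxEr !mxE; case: eqP.
by case: eqP => _; [exact: laurent_inv | exact: laurent_cst].
Qed.

Lemma unity_roots (n : nat) : exists rs : seq C,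
  [/\ uniq rs, size rs = n.+1 & forall u, (u \in rs) = (u ^+ n.+1 == 1)].
Proof.
have n0 : (n.+1%:R : R[i]) != 0 by rewrite pnatr_eq0.
have [rs E] := closed_field_poly_normal ('X^(n.+1) - 1 : {poly R[i]})%R.
have mon : ('X^(n.+1) - 1 : {poly R[i]})%R \is monic by exact: monicXnsubC.
rewrite (monicP mon) scale1r in E.
exists (rs : seq R[i]); split.
- by rewrite -separable_prod_XsubC -E separable_Xn_sub_1.
- by have := @size_Xn_sub_1 R[i] n.+1 isT; rewrite E size_prod_XsubC => -[].
move=> u; rewrite -root_prod_XsubC -E /root !hornerE ?hornerXn subr_eq0 //.
Qed.

End TorusAlgebra.

(** * Points of finite order in algebraic tori *)

Section AlgebraicTori.
Context {R : realType}.
Local Notation C := (Cx R).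
Context (G : alggroup_data R) (hG : is_affine_algebraic_group G).
Context (T : set G) (hT : is_algebraic_torus T).
Local Open Scope group_scope.

(* [A n] is the finite group of elements of order dividing n+1; these groups are
   Zariski dense in T, with an n which is uniform in the parameters c. *)
Lemma torus_finite_subgroups : exists A : nat -> seq G,
  [/\ (forall n, 1 \in A n),
      (forall n a b, a \in A n -> b \in A n -> a * b \in A n),
      (forall n a, (a \in A n) <-> T a /\ a ^+ n.+1 = 1) &
      forall e N (q : 'rV[C]_(emb_dim G + e) -> 'rV[C]_N), polynomial_map q ->
        exists n, forall c : 'rV[C]_e,
          (forall a, a \in A n -> q (row_mx (emb a) c) = 0%R) ->
          forall t, T t -> q (row_mx (emb t) c) = 0%R].
Proof.
have [_ [k [phi [psi [h1 h2 h3 [P polP hP] _]]]]] := hT.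
have Gm1 : Gm (const_mx 1%R : 'rV[C]_k) by move=> i; rewrite mxE oner_neq0.
have phi1 : phi (const_mx 1%R) = 1.
  apply: (@mulIg _ (phi (const_mx 1%R))); rewrite mul1g -h3 //.
  by congr phi; apply/rowP => i; rewrite !mxE mul1r.
have GmX (z : 'rV[C]_k) n : Gm z -> Gm (\row_i (z 0 i ^+ n)%R : 'rV[C]_k).
  by move=> hz i; rewrite mxE expf_neq0 //; exact: hz.
have phiX (z : 'rV[C]_k) n : Gm z -> phi (\row_i (z 0 i ^+ n)%R) = phi z ^+ n.
  move=> hz; elim: n => [|n IH].
    by rewrite expg0 -phi1; congr phi; apply/rowP => i; rewrite !mxE expr0.
  rewrite expgS -IH -h3 //; last exact: GmX.
  by congr phi; apply/rowP => i; rewrite !mxE exprS.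
have phi_inj (z w : 'rV[C]_k) : Gm z -> Gm w -> phi z = phi w -> z = w.
  by move=> hz hw e; rewrite -(h1 z hz).2 e (h1 w hw).2.
have [rs hrs] := choice (@unity_roots R).
have rs0 n : 0%R \notin rs n.
  by have [_ _ ->] := hrs n; rewrite expr0n eq_sym oner_neq0.
(* Images of the grids of roots of unity of order dividing n + 1. *)
pose A n := [seq phi (\row_i ssval (f i)) | f : {ffun 'I_k -> seq_sub (rs n)}].
have memA n a : a \in A n <-> exists2 z : 'rV[C]_k, (forall i, z 0 i \in rs n) & a = phi z.
  split=> [/mapP[f _ ->]|[z hz ->]].
    by exists (\row_i ssval (f i)) => // i; rewrite mxE; exact: ssvalP.
  apply/mapP; exists [ffun i => SeqSub (hz i)]; first by rewrite mem_enum.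
  by congr phi; apply/rowP => i; rewrite mxE ffunE.
have rsGm n (z : 'rV[C]_k) : (forall i, z 0 i \in rs n) -> Gm z.
  by move=> hz i; apply: contraNneq (rs0 n) => <-.
have hA n a : (a \in A n) <-> T a /\ a ^+ n.+1 = 1.
  have [_ _ mrs] := hrs n; split=> [/memA[z hz ->]|[Ta an]].
    split; first exact: (h1 z (rsGm n z hz)).1.
    rewrite -(phiX z n.+1 (rsGm n z hz)) -[RHS]phi1; congr phi; apply/rowP => i; rewrite !mxE.
    by apply/eqP; rewrite -mrs.
  have [gz ez] := h2 a Ta; apply/memA; exists (psi a); last by rewrite ez.
  move=> i; rewrite mrs; apply/eqP.
  have : \row_i (psi a 0 i ^+ n.+1)%R = const_mx 1%R :> 'rV[C]_k.
    by apply: phi_inj => //; [exact: GmX | rewrite phiX // ez an phi1].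
  by move=> /rowP/(_ i); rewrite !mxE.
exists A; split=> //.
- move=> n; apply/hA; split; last by rewrite expg1n.
  by rewrite -phi1; exact: (h1 _ Gm1).1.
- move=> n a b /memA[z hz ->] /memA[w hw ->]; apply/memA; have [_ _ mrs] := hrs n.
  exists (Gm_mul z w); last by rewrite h3 //; exact: rsGm.
  move=> i; rewrite mxE mrs exprMn.
  by move: (hz i) (hw i); rewrite !mrs => /eqP-> /eqP->; rewrite mulr1.
move=> e N q polq.
(* Substituting the expression of [phi] makes [q] a polynomial in the torus coordinates, their
   inverses and the parameters. *)
pose sub (v : 'rV[C]_((k + k) + e)) : 'rV[C]_(emb_dim G + e) := row_mx (P (lsubmx v)) (rsubmx v).
have pols : polynomial_map (q \o sub).
  apply: polynomial_map_comp polq _; apply: polynomial_row_mx.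
    exact: polynomial_map_comp polP (@polynomial_lsubmx _ _ _).
  exact: polynomial_rsubmx.
have [D hD] := choice (fun j => torus_density (pols j)).
(* There are n + 1 roots, more than the bound of each of the [N] coordinates. *)
pose n := \max_j D j; exists n => c hc t Tt.
have [_ srs _] := hrs n.
have qE (z : 'rV[C]_k) : Gm z -> (q \o sub) (row_mx (row_mx z (Gm_inv z)) c) = q (row_mx (emb (phi z)) c).
  by move=> hz; rewrite /sub /= row_mxKl row_mxKr hP.
have [gz ez] := h2 t Tt; rewrite -ez -qE //.
apply/rowP => j; rewrite [RHS]mxE.
apply: (hD j (rs n) c _ _ (rs0 n) _ _ gz).
- by have [] := hrs n.
- by rewrite srs ltnS /n; exact: (leq_bigmax (F := D) j).
move=> z hz; have gz' := rsGm n z hz.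
by rewrite qE // hc ?mxE //; apply/memA; exists z.
Qed.

(** Commuting with [g] is a polynomial condition on [a] with the coordinates of [g] as parameters;
    uniformity in the parameters gives one finite group for all [g]. *)
Lemma torus_finite_centralizer : exists A : seq G,
  [/\ 1 \in A, (forall a b, a \in A -> b \in A -> a * b \in A),
      (forall a, a \in A -> T a) &
      forall g, (forall a, a \in A -> g * a = a * g) -> forall t, T t -> g * t = t * g].
Proof.
have [A [A1 AM AT hA]] := torus_finite_subgroups.
have [_ [emb_inj _] [mu polmu hmu] _ _] := hG.
pose q (v : 'rV[C]_(emb_dim G + emb_dim G)) : 'rV[C]_(emb_dim G) :=
  (mu (row_mx (rsubmx v) (lsubmx v)) - mu v)%R.
have polq : polynomial_map q.
  move=> j; have -> : (fun z => q z 0 j) = (fun z => (mu (row_mx (rsubmx z) (lsubmx z)) 0 j - mu z 0 j)%R).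
    by apply/funext => z; rewrite !mxE.
  apply: polynomial_sub (polmu j); apply: (polynomial_comp (polmu j)).
  by apply: polynomial_row_mx; [exact: polynomial_rsubmx | exact: polynomial_lsubmx].
have [n hn] := hA _ _ q polq; exists (A n); split=> //.
- exact: AM.
- by move=> a /AT[].
move=> g hg t Tt; apply: emb_inj; rewrite !hmu; apply/eqP; rewrite -subr_eq0; apply/eqP.
have qE a : q (row_mx (emb a) (emb g)) = (mu (row_mx (emb g) (emb a)) - mu (row_mx (emb a) (emb g)))%R.
  by rewrite /q row_mxKl row_mxKr.
rewrite -qE; apply: hn => // a aA; rewrite qE -!hmu hg //; exact: subrr.
Qed.

(** Conjugation by [g] maps each finite group [A n] injectively into itself, hence onto itself, so
    its inverse does too; density carries this over to T. *)
Lemma torus_conj_sub (g : G) : (forall t, T t -> T (t ^ g)) -> forall t, T t -> T (t ^ g^-1).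
Proof.
move=> hg; have [A [A1 AM AT hA]] := torus_finite_subgroups.
have Ag n a : a \in A n -> a ^ g \in A n.
  by move=> /AT[Ta an]; apply/AT; split; [exact: hg | rewrite -conjXg an conj1g].
have Agi n a : a \in A n -> a ^ g^-1 \in A n.
  move=> aA; pose B := undup (A n).
  have uB : uniq [seq x ^ g | x <- B] by rewrite map_inj_uniq ?undup_uniq //; exact: conjg_inj.
  have sB : {subset [seq x ^ g | x <- B] <= B}.
    by move=> _ /mapP[x xB ->]; rewrite mem_undup; apply: Ag; rewrite -mem_undup.
  have szB : leq (size B) (size [seq x ^ g | x <- B]) by rewrite size_map.
  have [_ eB] := uniq_min_size uB sB szB.
  have : a \in B by rewrite mem_undup.
  by rewrite -eB => /mapP[x xB ->]; rewrite conjgK -mem_undup.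
have [[_ [I [regI TE]]] _] := hT; have [_ _ [mu polmu hmu] _ _] := hG.
move=> t Tt; rewrite TE => f If; have [Q polQ hQ] := regI f If.
(* An equation of T at the conjugate of a point, as a polynomial in the point with the coordinates
   of [g^-1] and [g] as parameters. *)
pose q (v : 'rV[C]_(emb_dim G + (emb_dim G + emb_dim G))) : 'rV[C]_1 :=
  const_mx (Q (mu (row_mx (mu (row_mx (rsubmx (rsubmx v)) (lsubmx v))) (lsubmx (rsubmx v))))).
have polq : polynomial_map q.
  move=> j; pose w (v : 'rV[C]_(emb_dim G + (emb_dim G + emb_dim G))) :=
    mu (row_mx (mu (row_mx (rsubmx (rsubmx v)) (lsubmx v))) (lsubmx (rsubmx v))).
  have -> : (fun z => q z 0 j) = Q \o w by apply/funext => z; rewrite mxE.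
  apply: polynomial_comp polQ _; apply: (polynomial_map_comp polmu).
  have pr := @polynomial_rsubmx R (emb_dim G) (emb_dim G + emb_dim G).
  apply: polynomial_row_mx.
    apply: (@polynomial_map_comp _ _ _ _ mu
      (fun z : 'rV[C]_(emb_dim G + (emb_dim G + emb_dim G)) => row_mx (rsubmx (rsubmx z)) (lsubmx z)) polmu).
    apply: polynomial_row_mx.
      exact: polynomial_map_comp (@polynomial_rsubmx _ _ _) pr.
    exact: polynomial_lsubmx.
  exact: polynomial_map_comp (@polynomial_lsubmx _ _ _) pr.
have qE a : q (row_mx (emb a) (row_mx (emb g^-1) (emb g))) = const_mx (f (a ^ g^-1)).
  by rewrite /q !row_mxKl !row_mxKr !row_mxKl -!hmu -hQ /conjg invgK mulgA.
have [n hn] := hA _ _ q polq.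
have : q (row_mx (emb t) (row_mx (emb g^-1) (emb g))) = 0%R.
  apply: hn Tt => a aA; rewrite qE.
  suff -> : f (a ^ g^-1) = 0%R by apply/rowP => i; rewrite !mxE.
  by have /AT[] := Agi n a aA; rewrite TE => + _; exact.
by rewrite qE => /rowP/(_ 0%R); rewrite !mxE.
Qed.

End AlgebraicTori.

(** * Tangent vectors fixed by a finite group *)

Section FixedPoints.
Context {R : realType}.
Local Notation C := (Cx R).

(** Nested intervals: v k - 2c/2^k increases and v k + 2c/2^k decreases. *)
Lemma geometric_limit_real (v : nat -> R) (c : R) :
  (forall k, `|v k.+1 - v k| <= c * 2^-1 ^+ k) ->
  exists x, forall k, `|x - v k| <= 2 * c * 2^-1 ^+ k.
Proof.
move=> hv; pose q k : R := 2^-1 ^+ k.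
have qS k : q k.+1 = q k / 2 by rewrite /q exprS mulrC.
pose w k := v k - 2 * c * q k; pose u k := v k + 2 * c * q k.
have wS k : w k <= w k.+1.
  have := hv k; rewrite ler_norml -/(q k) => /andP[h1 h2]; rewrite /w qS.
  by move: h1 h2; move: (q k) (v k) (v k.+1) => a b b'; lra.
have uS k : u k.+1 <= u k.
  have := hv k; rewrite ler_norml -/(q k) => /andP[h1 h2]; rewrite /u qS.
  by move: h1 h2; move: (q k) (v k) (v k.+1) => a b b'; lra.
have c0 : 0 <= c by have := hv 0%N; rewrite expr0 mulr1; apply: le_trans.
have q0 k : 0 <= q k by rewrite exprn_ge0 // invr_ge0.
have wle j k : (j <= k)%N -> w j <= w k.
  by move=> jk; rewrite -(subnKC jk); elim: (k - j)%N => [|i IH]; rewrite ?addn0 // addnS (le_trans IH).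
have ule j k : (j <= k)%N -> u k <= u j.
  by move=> jk; rewrite -(subnKC jk); elim: (k - j)%N => [|i IH]; rewrite ?addn0 // addnS (le_trans _ IH).
have wu j k : w j <= u k.
  apply: le_trans (wle j _ (leq_maxl j k)) _; apply: le_trans (ule k _ (leq_maxr j k)).
  by rewrite /w /u lerD2l ge0_cp // !mulr_ge0.
exists (sup (range w)) => k.
have h1 : w k <= sup (range w).
  by apply: ub_le_sup; [exists (u 0%N) => _ [j _ <-] | exists k].
have h2 : sup (range w) <= u k.
  by apply: ge_sup; [exists (w 0%N), 0%N | move=> _ [j _ <-]].
rewrite ler_norml -/(q k); move: h1 h2; rewrite /w /u => h1 h2; apply/andP; split; lra.
Qed.

Lemma geometric_limit n (u : nat -> 'rV[C]_n) (c : R) : 0 <= c ->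
  (forall k, nr (u k.+1 - u k) <= c * 2^-1 ^+ k) ->
  exists x, forall k, nr (x - u k) <= 4 * c * 2^-1 ^+ k.
Proof.
move=> c0 hu.
have ReB (a b : C) : complex.Re (a - b : R[i]) = complex.Re (a : R[i]) - complex.Re (b : R[i]).
  by case: a b => ? ? [].
have ImB (a b : C) : complex.Im (a - b : R[i]) = complex.Im (a : R[i]) - complex.Im (b : R[i]).
  by case: a b => ? ? [].
have hc j k : nr (u k.+1 0 j - u k 0 j) <= c * 2^-1 ^+ k.
  by apply: le_trans (hu k); have := nr_coord (u k.+1 - u k) j; rewrite !mxE.
have [a ha] := choice (fun j => @geometric_limit_real (fun k => complex.Re (u k 0 j : R[i])) c
  (fun k => le_trans (eq_ind _ (fun x => `|x| <= _) (Re_le_nr _) _ (ReB _ _)) (hc j k))).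
have [b hb] := choice (fun j => @geometric_limit_real (fun k => complex.Im (u k 0 j : R[i])) c
  (fun k => le_trans (eq_ind _ (fun x => `|x| <= _) (Im_le_nr _) _ (ImB _ _)) (hc j k))).
exists (\row_j mkC (a j) (b j)) => k.
have q0 : 0 <= (2^-1 : R) ^+ k by rewrite exprn_ge0 // invr_ge0.
apply/nr_rV => [|j]; first by rewrite !mulr_ge0.
rewrite !mxE [u k 0 j]mkC_ReIm.
have -> : mkC (a j) (b j) - mkC (complex.Re (u k 0 j : R[i])) (complex.Im (u k 0 j : R[i])) =
    mkC (a j - complex.Re (u k 0 j : R[i])) (b j - complex.Im (u k 0 j : R[i])) by [].
apply: le_trans (nr_mkC_le _ _) _; have := ha j k; have := hb j k.
by move: (2^-1 ^+ k) => q; lra.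
Qed.

(** Iteration from 0 halves the steps and stays in the ball. The factor 4 is that of
    [geometric_limit], where real and imaginary parts contribute 2 each. *)
Lemma contraction_fixpoint n (f : 'rV[C]_n -> 'rV[C]_n) (r : R) :
  (forall x y, nr x <= r -> nr y <= r -> nr (f x - f y) <= 2^-1 * nr (x - y)) ->
  4 * nr (f 0) <= r -> exists2 x, nr x <= 4 * nr (f 0) & f x = x.
Proof.
move=> hf r0; pose u k := iter k f 0; pose c := nr (f 0).
have c0 : 0 <= c by exact: nr_ge0.
have q0 k : 0 <= (2^-1 : R) ^+ k by rewrite exprn_ge0 // invr_ge0.
have key k : nr (u k) <= 2 * c * (1 - 2^-1 ^+ k) /\ nr (u k.+1 - u k) <= c * 2^-1 ^+ k.
  elim: k => [|k [h1 h2]].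
    by rewrite /u /= expr0 subrr mulr0 nr0 subr0 mulr1.
  have h3 : nr (u k.+1) <= 2 * c * (1 - 2^-1 ^+ k.+1).
    have -> : u k.+1 = u k + (u k.+1 - u k) by rewrite addrC subrK.
    apply: le_trans (nrD _ _) _; rewrite exprS; apply: le_trans (lerD h1 h2) _.
    by move: (2^-1 ^+ k) => q; lra.
  split=> //; have b1 : nr (u k) <= r.
    apply: le_trans h1 _; apply: le_trans r0; have := q0 k; rewrite -/c.
    by move: (2^-1 ^+ k) => q; nra.
  have b2 : nr (u k.+1) <= r.
    apply: le_trans h3 _; apply: le_trans r0; have := q0 k.+1; rewrite -/c.
    by move: (2^-1 ^+ k.+1) => q; nra.
  have := hf _ _ b2 b1; rewrite -/(u k.+2) => h; apply: le_trans h _.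
  by rewrite exprS; move: h2; move: (2^-1 ^+ k) (nr _) => q a; lra.
have [x hx] := geometric_limit c0 (fun k => (key k).2).
have x4 : nr x <= 4 * c by have := hx 0%N; rewrite expr0 mulr1 /u /= subr0.
have xr : nr x <= r by exact: le_trans x4 r0.
exists x => //; apply/eqP; rewrite -subr_eq0; apply/eqP; apply: (@nr_le_eps0 R _ _ (8 * c)) => e e0.
have [k hk] : exists k, (2^-1 : R) ^+ k <= e.
  have h := @cvg_geometric R 1 2^-1; have h2 : `|2^-1 : R| < 1 by rewrite ger0_norm; lra.
  have /cvgrPdist_le /(_ e e0) [N _ hN] := h h2; exists N.
  by have := hN N (leqnn N); rewrite /geometric /= mul1r sub0r normrN ger0_norm.
have ur : nr (u k) <= r.
  apply: le_trans (key k).1 _; apply: le_trans r0; have := q0 k; rewrite -/c.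
  by move: (2^-1 ^+ k) => q; nra.
have -> : f x - x = (f x - f (u k)) + (u k.+1 - x) by rewrite /u /= addrA subrK.
apply: le_trans (nrD _ _) _.
have h1 := hf _ _ xr ur; have h2 := hx k; have h3 := hx k.+1; rewrite nrBC in h3.
have h4 : nr (u k.+1 - x) <= 2 * c * 2^-1 ^+ k by move: h3; rewrite exprS; move: (2^-1 ^+ k) => q; lra.
have h5 : nr (f x - f (u k)) <= 2 * c * 2^-1 ^+ k by move: h1 h2; move: (2^-1 ^+ k) (nr (x - _)) => q a; lra.
apply: le_trans (lerD h5 h4) _; move: hk; move: (2^-1 ^+ k) => q; nra.
Qed.

(** The differential is kept at [x0] while both points vary: the quadratic remainder at [y] is added
    to the variation of the differential between [x0] and [y]. *)
Lemma strict_differential n k (F : 'rV[C]_n -> 'rV[C]_k) x0 :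
  (\forall y \near x0, differentiable F y) ->
  exists K rho : R, [/\ 0 <= K, 0 < rho & forall y h, nr (y - x0) < rho -> nr h < rho ->
    nr (F (y + h) - F y - 'd F x0 h) <= K * (nr h + nr (y - x0)) * nr h].
Proof.
move=> dF; have dj j : \forall y \near x0, differentiable (fun y => F y 0 j) y.
  by apply: filterS dF => y dy; exact: (diff_coordinate j dy).1.
have dF0 := nbhs_singleton dF.
suff [K [rho [K0 rho0 h]]] : exists K rho : R, [/\ 0 <= K, 0 < rho & forall j y h,
    nr (y - x0) < rho -> nr h < rho ->
    nr (F (y + h) 0 j - F y 0 j - 'd (fun y => F y 0 j) x0 h) <= K * (nr h + nr (y - x0)) * nr h].
  exists K, rho; split=> // y v hy hv; apply/nr_rV => [|j].
    by rewrite !mulr_ge0 ?addr_ge0 ?nr_ge0.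
  by have := h j y v hy hv; rewrite (diff_coordinate j dF0).2 !mxE.
have hex j : exists Kr : R * R, [/\ 0 <= Kr.1, 0 < Kr.2 & forall y h,
    nr (y - x0) < Kr.2 -> nr h < Kr.2 ->
    nr (F (y + h) 0 j - F y 0 j - 'd (fun y => F y 0 j) x0 h) <= Kr.1 * (nr h + nr (y - x0)) * nr h].
  have [K [rho [K0 rho0 _ h1 h2]]] := second_order (dj j); exists (K, rho); split=> //= y h hy hh.
  have a1 := h2 y h hy hh.
  have a2 := h1 x0 (y - x0) h; rewrite subrr nr0 [x0 + _]addrC subrK in a2; have {}a2 := a2 rho0 hy.
  rewrite -[X in nr X](subrKA ('d (fun y0 : 'rV[C]_n => F y0 0 j : C) (y : 'rV[C]_n) h)).
  apply: le_trans (nrD _ _) _; apply: le_trans (lerD a1 a2) _.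
  by rewrite expr2 mulrDr mulrDl !mulrA.
have [Kr hKr] := choice hex.
exists (\sum_j (Kr j).1), (\big[Num.min/1]_j (Kr j).2); split.
- by apply: sumr_ge0 => j _; have [] := hKr j.
- by apply: (big_ind (fun x => 0 < x)) => // [x y x0' y0'|j _]; [rewrite lt_min x0' | have [] := hKr j].
move=> j y h hy hh; have [_ _ H] := hKr j.
have rj : \big[Num.min/1]_j (Kr j).2 <= (Kr j).2 by exact: bigmin_le_cond.
apply: le_trans (H y h (lt_le_trans hy rj) (lt_le_trans hh rj)) _.
rewrite -!mulrA ler_wpM2r ?mulr_ge0 ?addr_ge0 ?nr_ge0 //.
rewrite (bigD1 j) //= lerDl; apply: sumr_ge0 => i _; by have [] := hKr i.
Qed.

End FixedPoints.

Section Directions.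
Context {R : realType}.
Local Notation C := (Cx R).

(** Near [x0] the map is a translation up to an error with small Lipschitz constant: this gives
    injectivity, and lets a contraction solve the equation along the ray directed by [th]. *)
Lemma local_inverse n (F : 'rV[C]_n -> 'rV[C]_n) x0 (th : 'rV[C]_n) :
  (\forall y \near x0, differentiable F y) -> (forall v, 'd F x0 v = v) ->
  (exists2 r : R, 0 < r & forall x y, nr (x - x0) < r -> nr (y - x0) < r -> F x = F y -> x = y) /\
  (forall e : R, 0 < e -> exists s : R, [/\ 0 < s, s < e & exists2 x,
     nr (x - x0 - CofR s *: th) <= e * s & F x = F x0 + CofR s *: th]).
Proof.
move=> dF Fid; have [K [rho [K0 rho0 hK]]] := strict_differential dF.
(* With this radius the Lipschitz constant of the error is at most 3/8 in the injectivity part and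
   1/4 in the contraction. *)
pose r := Num.min (rho / 3) (8 * (K + 1))^-1.
have r0 : 0 < r by rewrite lt_min divr_gt0 //= invr_gt0; nra.
have rrho : 3 * r <= rho by have : r <= rho / 3 by [rewrite ge_min lexx]; lra.
have Kr : K * r <= 8^-1.
  have h : r <= (8 * (K + 1))^-1 by rewrite ge_min lexx orbT.
  have K1 : 0 < 8 * (K + 1) by nra.
  have : (8 * (K + 1)) * r <= 1 by rewrite mulrC -ler_pdivlMr // div1r.
  by move: r0; move: (r) => q; nra.
have est y h : nr (y - x0) < rho -> nr h < rho ->
    nr (F (y + h) - F y - h) <= K * (nr h + nr (y - x0)) * nr h.
  by move=> hy hh; have := hK y h hy hh; rewrite Fid.
split.
  exists r => // x y hx hy e; apply/eqP; rewrite -subr_eq0; apply/eqP; apply: nr_eq0.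
  have hh : nr (x - y) < r + r.
    have -> : x - y = (x - x0) - (y - x0) by rewrite opprB addrA subrK.
    by apply: le_lt_trans (nrB _ _) _; exact: ltrD.
  have e1 : y + (x - y) = x by rewrite addrC subrK.
  have hy' : nr (y - x0) < rho by lra.
  have hh' : nr (x - y) < rho by lra.
  have := est y (x - y) hy' hh'; rewrite e1 e subrr sub0r nrN => h.
  have n0 := nr_ge0 (x - y); have n1 := nr_ge0 (y - x0).
  move: h hh hy n0 n1; move: (nr (x - y)) (nr (y - x0)) => a b h1 h2 h3 h4 h5.
  have h6 : K * (a + b) <= 3 * (K * r) by nra.
  by nra.
move=> e e0; pose N := nr th; have N0 : 0 <= N by exact: nr_ge0.
(* The second bound keeps x0 + s th in the ball of radius r / 2; the third makes the quadratic error
   at most [e * s]. *)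
pose s := Num.min (e / 2) (Num.min (r / (2 * (N + 1))) (e / (4 * K * N ^+ 2 + 1))).
have D0 : 0 < 4 * K * N ^+ 2 + 1 by have := sqr_ge0 N; nra.
have s0 : 0 < s by rewrite !lt_min !divr_gt0 //; nra.
have s1 : s <= e / 2 by rewrite ge_min lexx.
have s2 : s * N <= r / 2.
  have h : s <= r / (2 * (N + 1)) by rewrite !ge_min lexx orbT.
  have h1 : s * (2 * (N + 1)) <= r by rewrite -ler_pdivlMr //; nra.
  by nra.
have s3 : s * (4 * K * N ^+ 2 + 1) <= e.
  by rewrite -ler_pdivlMr // !ge_min lexx !orbT.
have ns : nr (CofR s *: th) = s * N by rewrite nrZ nrR gtr0_norm.
pose a := x0 + CofR s *: th.
have na : nr (a - x0) = s * N by rewrite /a [x0 + _]addrC addrK.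
(* Newton's map with the differential replaced by the identity; a fixed point [eta] makes [a + eta]
   a solution. *)
pose Phi eta := eta - (F (a + eta) - F x0 - CofR s *: th).
have P0 : nr (Phi 0) <= K * (s * N) ^+ 2.
  rewrite /Phi sub0r nrN addr0.
  have := est x0 (CofR s *: th); rewrite subrr nr0 ns addr0 expr2 mulrA.
  by rewrite !mulrA; apply; [exact: rho0 | lra].
have sN0 : 0 <= s * N by rewrite mulr_ge0 // ltW.
have [||eta heta fe] := @contraction_fixpoint R n Phi (r / 2).
- move=> x y hx hy.
  have -> : Phi x - Phi y = - (F ((a + y) + (x - y)) - F (a + y) - (x - y)).
    have e1 : y + (x - y) = x by rewrite addrC subrK.
    rewrite -[a + y + _]addrA e1 /Phi.
    by apply/rowP => i; rewrite !mxE; ring.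
  have nb : nr (a + y - x0) <= s * N + r / 2.
    have -> : a + y - x0 = (a - x0) + y by rewrite addrAC.
    by apply: le_trans (nrD _ _) _; rewrite na lerD2l.
  have nh : nr (x - y) <= r by apply: le_trans (nrB _ _) _; lra.
  rewrite nrN; apply: le_trans (est _ _ _ _) _; [lra | lra |].
  apply: ler_wpM2r; first exact: nr_ge0.
  have n1 := nr_ge0 (x - y); have n2 := nr_ge0 (a + y - x0).
  move: nb nh n1 n2; move: (nr (a + y - x0)) (nr (x - y)) => b c h1 h2 h3 h4.
  have : K * (c + b) <= 2 * (K * r) by nra.
  by lra.
- apply: le_trans (ler_wpM2l _ P0) _ => //.
  have h1 : K * (s * N) <= 16^-1 by apply: le_trans (ler_wpM2l K0 s2) _; lra.
  have h2 := ler_wpM2r sN0 h1; rewrite expr2 mulrA; lra.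
exists s; split=> //; first by lra.
exists (a + eta).
  have -> : a + eta - x0 - CofR s *: th = eta by rewrite /a; apply/rowP => i; rewrite !mxE; ring.
  apply: le_trans heta _; apply: le_trans (ler_wpM2l _ P0) _ => //.
  have -> : 4 * (K * (s * N) ^+ 2) = s * (s * (4 * K * N ^+ 2)) by rewrite !expr2; ring.
  by rewrite mulrC ler_wpM2r //; [exact: ltW | nra].
apply/eqP; rewrite -subr_eq0 opprD addrA; apply/eqP.
have -> : F (a + eta) - F x0 - CofR s *: th = eta - Phi eta by rewrite /Phi subKr.
by rewrite fe subrr.
Qed.

(** At points x = x0 + s th + o(s), the equation J x = x reads s (dJ th - th) = o(s). Fixed points
    for arbitrarily small s suffice. *)
Lemma fixed_direction n (J : 'rV[C]_n -> 'rV[C]_n) x0 (th : 'rV[C]_n) :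
  differentiable J x0 -> J x0 = x0 ->
  (forall e : R, 0 < e -> exists s : R, [/\ 0 < s, s < e & exists2 x,
     nr (x - x0 - CofR s *: th) <= e * s & J x = x]) ->
  'd J x0 th = th.
Proof.
move=> dJ J0 hx; pose L : 'rV[C]_n -> 'rV[C]_n := 'd J x0.
have [B B0 hB] := linear_rV_bounded ('d J x0).
pose N := nr th; have N0 : 0 <= N by exact: nr_ge0.
apply/eqP; rewrite -subr_eq0; apply/eqP.
apply: (@nr_le_eps0 R _ _ (B + N + 2)) => e e0.
have [d d0 hd] := diff_has_diff dJ e0.
pose e' := Num.min (Num.min e 1) (d / (N + 2)).
have e'0 : 0 < e' by rewrite !lt_min e0 ltr01 divr_gt0 //; lra.
have e'e : e' <= e by rewrite !ge_min lexx.
have e'1 : e' <= 1 by rewrite !ge_min lexx !orbT.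
have e'd : e' * (N + 2) <= d by rewrite -ler_pdivlMr; [rewrite ge_min lexx orbT | lra].
have [s [s0 se [x hxs Jx]]] := hx e' e'0.
pose h := x - x0; pose b := h - CofR s *: th.
have nb : nr b <= e' * s by [].
have ns : nr (CofR s *: th) = s * N by rewrite nrZ nrR gtr0_norm.
have nh : nr h <= s * (N + 1).
  have -> : h = b + CofR s *: th by rewrite subrK.
  by apply: le_trans (nrD _ _) _; rewrite ns; nra.
have hdd : nr h < d by nra.
have := hd h hdd; rewrite J0 /h [x0 + _]addrC subrK Jx -/h => h1.
(* One part comes from the deviation [b] from the ray; the other is the first-order remainder of [J]
   between two of its fixed points. *)
have lE : CofR s *: (L th - th) = (b - L b) - (h - L h).
  have -> : L b = L h - CofR s *: L th.
    apply: etrans (raddfB ('d J x0) h (CofR s *: th)) _; congr (_ - _).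
    exact: (linearZ_LR ('d J x0) (CofR s) th).
  by rewrite /b; apply/rowP => i; rewrite !mxE; ring.
have : s * nr (L th - th) <= s * (e * (B + N + 2)).
  have -> : s * nr (L th - th) = nr (CofR s *: (L th - th)) by rewrite nrZ nrR gtr0_norm.
  rewrite lE; apply: le_trans (nrB _ _) _; apply: le_trans (lerD (nrB _ _) h1) _.
  have h2 := hB b; have h3 : nr (L b) <= B * (e' * s) by apply: le_trans h2 _; exact: (ler_wpM2l (ltW B0) nb).
  have h4 : B * (e' * s) <= B * (e * s) by apply: (ler_wpM2l (ltW B0)); apply: (ler_wpM2r (ltW s0)).
  have h5 : e' * s <= e * s by apply: (ler_wpM2r (ltW s0)).
  have h6 : e * nr h <= e * (s * (N + 1)) by apply: (ler_wpM2l (ltW e0)).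
  by move: nb h3 h4 h5 h6; move: (nr b) (nr (L b)) (nr h) => b1 b2 b3; lra.
by rewrite ler_pM2l.
Qed.

End Directions.

(** * Averaging over a finite subgroup *)

Section Averaging.
Context {R : realType}.
Local Notation C := (Cx R).

Lemma near_seq (T : topologicalType) (I : eqType) (s : seq I) (x : T) (P : I -> T -> Prop) :
  (forall a, a \in s -> \forall y \near x, P a y) ->
  \forall y \near x, forall a, a \in s -> P a y.
Proof.
elim: s => [|a s IH] h; first exact: filterE.
have h1 := h a (mem_head a s).
have h2 : \forall y \near x, forall b, b \in s -> P b y.
  by apply: IH => b bs; apply: h; rewrite inE bs orbT.
apply: filterS2 h1 h2 => y Pa Ps b; rewrite inE => /orP[/eqP->|] //; exact: Ps.
Qed.

Lemma holo_sum n m (I : eqType) (s : seq I) (f : I -> 'rV[C]_n -> 'rV[C]_m) x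
    (l : I -> 'rV[C]_n -> 'rV[C]_m) :
  (forall a, a \in s -> holo_at (f a) x /\ forall v, 'd (f a) x v = l a v) ->
  holo_at (fun w => \sum_(a <- s) f a w) x /\
  forall v, 'd (fun w => \sum_(a <- s) f a w) x v = \sum_(a <- s) l a v.
Proof.
elim: s => [|a s IH] h.
  have -> : (fun w => \sum_(a <- [::]) f a w) = fun=> 0 by apply/funext => w; rewrite big_nil.
  split=> [|v]; first exact: holo_cst.
  by rewrite big_nil; exact: (diff_cst_near v (near_all x (fun=> erefl))).
have [h1 d1] := h a (mem_head a s).
have [h2 d2] := IH (fun b (bs : b \in s) => h b (mem_behead (s := a :: s) bs)).
have -> : (fun w => \sum_(b <- a :: s) f b w) = (f a \+ (fun w => \sum_(b <- s) f b w)).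
  by apply/funext => w; rewrite big_cons.
split=> [|v]; first by apply: filterS2 h1 h2 => y dy1 dy2; exact: differentiableD.
by rewrite (diffD (holo_diff_at h1) (holo_diff_at h2)) big_cons -d1 -d2.
Qed.

Context (H : lie_data R) (hH : is_complex_lie_group H).
Local Notation aH := (group_atlas hH).
Local Notation d := (mdim (lieM H)).

(** A left action, unlike [conjg], so that [Ad] is multiplicative. *)
Definition conj_by (a : H) (g : lieM H) : lieM H := (a * (g : H) * a^-1)%g.

Lemma hol_conj_by a g : holomorphic_at (conj_by a) g.
Proof.
have hc (h : lieM H) : @holomorphic_at R (lieM H) (lieM H) (fun=> h) g by exact: hol_cst aH h g.
exact: (hol_mul hH aH (hol_mul hH aH (hc a) (hol_id aH g)) (hc a^-1%g)).
Qed.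

Lemma conj_by1 a : conj_by a 1%g = 1%g.
Proof. by rewrite /conj_by mulg1 mulgV. Qed.

Lemma conj_byM a b g : conj_by a (conj_by b g) = conj_by (a * b)%g g.
Proof. by rewrite /conj_by invgM !mulgA. Qed.

Definition Ad (a : H) : 'rV[C]_d -> 'rV[C]_d := mdiff (conj_by a) 1%g.

Lemma Ad_mul a b v : Ad a (Ad b v) = Ad (a * b)%g v.
Proof.
have e := mdiff_comp aH aH aH v (hol_conj_by b 1%g) (hol_conj_by a (conj_by b 1%g)).
have E : conj_by a \o conj_by b = conj_by (a * b)%g by apply/funext => g; exact: conj_byM.
rewrite (conj_by1 b) in e.
rewrite /Ad.
rewrite -E.
exact: esym e.
Qed.

Lemma Ad1 v : Ad 1%g v = v.
Proof.
have E : conj_by 1%g = id by apply/funext => g; rewrite /conj_by mul1g invg1 mulg1.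
by rewrite /Ad E; exact: (mdiff_id aH (1%g : lieM H) v).
Qed.

Context (S : set (lieM H)) (hS : is_submanifold S) (e1 : subM S) (e1E : sval e1 = 1%g).
Context (A : seq H) (uA : uniq A) (A1 : (1 : H)%g \in A)
  (AM : forall a b, a \in A -> b \in A -> (a * b)%g \in A).
Context (AS : forall g : H, (forall a, a \in A -> (g * a = a * g)%g) -> S g).

Lemma mul_perm b : b \in A -> perm_eq [seq (a * b)%g | a <- A] A.
Proof.
move=> bA; apply: uniq_perm => //.
  by rewrite map_inj_uniq //; exact: mulIg.
have u : uniq [seq (a * b)%g | a <- A] by rewrite map_inj_uniq //; exact: mulIg.
have sub : {subset [seq (a * b)%g | a <- A] <= A} by move=> _ /mapP[a aA ->]; exact: AM.
have sz : leq (size A) (size [seq (a * b)%g | a <- A]) by rewrite size_map.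
by have [_ e] := uniq_min_size u sub sz.
Qed.

Lemma size_neq0 : (size A)%:R != 0 :> C.
Proof. by rewrite pnatr_eq0; case: (A) A1. Qed.

(* Linearization of a finite group action near a fixed point: the averaged
   chart F conjugates the action of A to the linear action Ad, so that the
   F-preimages of the multiples of an Ad(A)-fixed vector are fixed by A. *)
Lemma fixed_vector_tangent (th : 'rV[C]_d) : (forall a, a \in A -> Ad a th = th) ->
  sub_tangent e1 th.
Proof.
move=> hth; pose c := chart_at (1%g : lieM H); have [ac c1] := chart_atP aH (1%g : lieM H).
pose x0 := cmap c (1%g : H); pose Ca a := cmap c \o conj_by a \o cinv c.
have hCa a : holo_at (Ca a) x0.
  have [_ h] := hol_conj_by a 1%g; apply: (h c c ac ac c1).
  by rewrite conj_by1.
have dCa a v : 'd (Ca a) x0 v = Ad a v by rewrite /Ad /mdiff conj_by1.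
have Ca0 a : Ca a x0 = x0 by rewrite /Ca /x0 /= (cinvK aH ac c1) conj_by1.
pose n0 : C := (size A)%:R^-1.
have linAd a : linear (Ad a) by move=> k u v; exact: mdiffP.
have AdZ a k v : Ad a (k *: v) = k *: Ad a v by exact: mdiffZ.
have linN a : linear (fun v => n0 *: Ad a v).
  by move=> k u v; rewrite linAd scalerDr !scalerA mulrC.
(* Ad(a^-1) undoes the differential of conjugation by [a], so each summand has differential [n0]
   times the identity at [x0], and the sum has the identity. *)
pose Fa a w := n0 *: Ad (a^-1)%g (Ca a w).
pose F w := \sum_(a <- A) Fa a w.
have [hF dF] : holo_at F x0 /\ forall v, 'd F x0 v = \sum_(a <- A) n0 *: v.
  apply: holo_sum => a _; split.
    apply: (@holo_comp R _ _ _ (Ca a) (fun v => n0 *: Ad a^-1%g v) x0 (hCa a)).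
    exact: holo_linear.
  move=> v; have [dl el] := linear_rV_diff (linN a^-1%g) (Ca a x0).
  apply: etrans ((has_diff_comp (holo_diff_at (hCa a)) dl).2 v) _.
  by rewrite el dCa Ad_mul mulVg Ad1.
have dFid v : 'd F x0 v = v.
  rewrite dF big_const_seq count_predT iter_addr_0 -scaler_nat scalerA /n0.
  by rewrite divff ?scale1r //; exact: size_neq0.
have near_cinv a : \forall w \near x0, cdom c (conj_by a (cinv c w)).
  apply: (@cinv_cont _ _ aH c 1%g (fun g => cdom c (conj_by a g)) ac c1).
  apply: (@hol_near_pre _ _ _ (conj_by a) 1%g (cdom c)).
    exact: (hol_cont (hol_conj_by a 1%g)).
  by rewrite conj_by1; exact: (cdom_near aH ac c1).
have CaM a b w : cdom c (conj_by b (cinv c w)) -> Ca a (Ca b w) = Ca (a * b)%g w.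
  by move=> cw; rewrite /Ca /= (cinvK aH ac cw) conj_byM.
(* Reindexing by a |-> ab turns conjugation by [b] inside into Ad(b) outside, as long as the
   conjugated point stays in the chart. *)
have FC b w : b \in A -> cdom c (conj_by b (cinv c w)) -> F (Ca b w) = Ad b (F w).
  move=> bA cw.
  have AdS (s : seq H) f : Ad b (\sum_(a <- s) f a) = \sum_(a <- s) Ad b (f a).
    elim: s => [|a s IH]; first by rewrite !big_nil /Ad mdiff0.
    by rewrite !big_cons -IH; exact: mdiffD.
  rewrite /F AdS -[RHS](perm_big _ (mul_perm bA)) /= big_map; apply: eq_bigr => a _.
  rewrite /Fa (CaM _ _ _ cw) AdZ Ad_mul.
  have -> : (b * (a * b)^-1)%g = (a^-1)%g by rewrite invgM mulgA mulgV mul1g.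
  by [].
have [[r r0 inj] ex] := local_inverse th hF dFid.
have [J [hJ JS Jt]] := sub_retraction aH hS e1; rewrite e1E in hJ JS.
have J1 : J 1%g = 1%g by apply: (nbhs_singleton JS); rewrite -e1E; exact: (svalP e1).
pose Jc := cmap c \o J \o cinv c.
have hJc : holo_at Jc x0.
  have [_ h] := hJ; apply: (h c c ac ac c1); by rewrite J1.
have dJc v : 'd Jc x0 v = mdiff J 1%g v.
  rewrite /mdiff J1.
  reflexivity.
(* The differential of the retraction has tangent values, so a vector that it fixes is tangent. *)
suff <- : mdiff J 1%g th = th by have := Jt th; rewrite e1E.
rewrite -dJc; apply: fixed_direction (holo_diff_at hJc) _ _.
  by rewrite /Jc /x0 /= (cinvK aH ac c1) J1.
have near_r : \forall w \near x0, nr (w - x0) < r.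
  by apply: (nbhs_nrP x0 (fun w => nr (w - x0) < r)).2; exists r.
have n1 : \forall w \near x0, forall a, a \in A -> cdom c (conj_by a (cinv c w)).
  by apply: near_seq => a _; exact: near_cinv.
have n2 : \forall w \near x0, forall a, a \in A -> nr (Ca a w - x0) < r.
  apply: near_seq => a _.
  apply: (@cont_near _ _ _ (Ca a) x0 (fun w => nr (w - x0) < r) (holo_continuous (hCa a))).
  by rewrite Ca0.
have n3 : \forall w \near x0, S (cinv c w) -> J (cinv c w) = cinv c w.
  exact: (@cinv_cont _ _ aH c 1%g (fun g => S g -> J g = g) ac c1 JS).
have n4 := cinv_near aH ac c1.
have [dl dl0 hdl] := (nbhs_nrP _ _).1 (filterI (filterI near_r n1) (filterI n2 (filterI n3 n4))).
move=> e e0; pose N := nr th; have N0 : 0 <= N by exact: nr_ge0.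
pose e' := Num.min e (Num.min 1 (dl / (N + 1))).
have e'0 : 0 < e' by rewrite !lt_min e0 ltr01 divr_gt0 //; lra.
have e'e : e' <= e by rewrite ge_min lexx.
have e'1 : e' <= 1 by rewrite !ge_min lexx !orbT.
have e'd : e' * (N + 1) <= dl by rewrite -ler_pdivlMr; [rewrite !ge_min lexx !orbT | lra].
have [s [s0 se [x hx Fx]]] := ex e' e'0.
exists s; split=> //; first exact: lt_le_trans se e'e.
exists x; first by apply: le_trans hx _; exact: (ler_wpM2r (ltW s0) e'e).
have xd : nr (x - x0) < dl.
  have -> : x - x0 = (x - x0 - CofR s *: th) + CofR s *: th by rewrite subrK.
  apply: le_lt_trans (nrD _ _) _; rewrite nrZ nrR gtr0_norm // -/N.
  apply: lt_le_trans e'd; have h1 : s * N <= e' * N by apply: ler_wpM2r => //; exact: ltW.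
  have h2 : e' * s < e' by rewrite -[ltRHS]mulr1 ltr_pM2l //; exact: lt_le_trans se e'1.
  by move: hx h1 h2; lra.
have [[xr x1] [x2 [x3 [cx ex']]]] := hdl x xd.
rewrite /Jc /= x3 //; apply: AS => a aA.
(* F takes the same value at both points, because Ad(a) fixes F x0 and [th]; injectivity of F near
   x0 concludes. *)
have Cx : Ca a x = x.
  apply: inj => //; first exact: x2.
  rewrite (FC a x aA (x1 a aA)) Fx /Ad mdiffD mdiffZ -/(Ad a) hth // ; congr (_ + _).
  rewrite -[in RHS](Ca0 a) FC // /x0 (cinvK aH ac c1) conj_by1 //.
have : conj_by a (cinv c x) = cinv c x.
  by rewrite -[LHS](cinvK aH ac (x1 a aA)) -[in RHS]Cx.
by rewrite /conj_by => h; rewrite -[in LHS]h mulgVK.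
Qed.

(** [th] is the mean of the differences [th - Ad a th], tangent by hypothesis, plus the mean of the
    [Ad a th], which is fixed by Ad(A). *)
Lemma averaged_tangent (th : 'rV[C]_d) :
  (forall a, a \in A -> sub_tangent e1 (th - Ad a th)) -> sub_tangent e1 th.
Proof.
move=> hth; pose n0 : C := (size A)%:R^-1; pose th0 := n0 *: \sum_(a <- A) Ad a th.
have sub0 : sub_tangent e1 0 by exists 0 => //; exact: mdiff0.
have nA : n0 *: \sum_(a <- A) th = th.
  rewrite big_const_seq count_predT iter_addr_0 -scaler_nat scalerA /n0.
  by rewrite mulVf ?scale1r //; exact: size_neq0.
have fixed : sub_tangent e1 th0.
  apply: fixed_vector_tangent => b bA; rewrite /th0.
  have AdS (s : seq H) f : Ad b (\sum_(a <- s) f a) = \sum_(a <- s) Ad b (f a).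
    elim: s => [|a s IH]; first by rewrite !big_nil /Ad mdiff0.
    by rewrite !big_cons -IH; exact: mdiffD.
  rewrite /Ad mdiffZ -/(Ad b) AdS; congr (_ *: _).
  have pb : perm_eq [seq (b * a)%g | a <- A] A.
    apply: uniq_perm => //; first by rewrite map_inj_uniq //; exact: mulgI.
    have u : uniq [seq (b * a)%g | a <- A] by rewrite map_inj_uniq //; exact: mulgI.
    have sub : {subset [seq (b * a)%g | a <- A] <= A} by move=> _ /mapP[a aA ->]; exact: AM.
    have sz : leq (size A) (size [seq (b * a)%g | a <- A]) by rewrite size_map.
    by have [_ e] := uniq_min_size u sub sz.
  rewrite -[RHS](perm_big _ pb) /= big_map; apply: eq_bigr => a _; exact: Ad_mul.
have sumt (s : seq H) : {subset s <= A} -> sub_tangent e1 (\sum_(a <- s) (th - Ad a th)).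
  elim: s => [|a s IH] sA; first by rewrite big_nil.
  have h1 : sub_tangent e1 (th - Ad a th) by apply: hth; apply: sA; rewrite inE eqxx.
  have h2 : sub_tangent e1 (\sum_(b <- s) (th - Ad b th)).
    by apply: IH => b bs; apply: sA; rewrite inE bs orbT.
  by rewrite big_cons; have := sub_tangentP 1 h1 h2; rewrite scale1r.
have E : th = n0 *: \sum_(a <- A) (th - Ad a th) + th0.
  by rewrite sumrB scalerBr nA subrK.
rewrite E; exact: (sub_tangentP n0 (sumt A (fun _ h => h)) fixed).
Qed.

End Averaging.

(** * Connections and reductions *)

Section AtiyahNormalization.
Context {R : realType}.
Local Notation C := (Cx R).
Context (M : premanifold R) (H : lie_data R) (E : bundle_data M H).
Hypotheses (hM : is_complex_manifold M) (hH : is_complex_lie_group H)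
  (hE : is_holomorphic_principal_bundle E).
Local Notation p := (@base_proj R M H E).
Local Notation aM := (base_atlas hM).
Local Notation aH := (group_atlas hH).
Local Notation aE := (total_atlas hE).

Lemma at_class_inj (y : E) v v' : at_class y v = at_class y v' -> v = v'.
Proof.
move=> /(at_class_eq hH hE)[h [e1 ->]].
have h1 : h = 1%g by apply: (act_free hE (y := y)); rewrite act1 -e1.
by rewrite h1 (mdiff_ract1 hE).
Qed.

(** The representative based on the section where t = 1: a local section of the quotient map onto
    At(E). *)
Definition at_norm (t : E -> lieM H) (a : atiyahM E) : tangentM E :=
  let yv := quot_repr a in
  let h : H := ((t yv.1 : H)^-1)%g in
  mkT (ract yv.1 h) (mdiff (fun y : E => ract y h) yv.1 yv.2).

Context (U : set M) (s : M -> E) (t : E -> lieM H) (ht : is_triv U s t).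

Lemma triv_section_one x : U x -> t (s x) = 1%g.
Proof. by have [_ _ _ _ h4] := ht => Ux; rewrite -[s x]act1 h4. Qed.

Lemma triv_normalize (y : E) : U (p y) -> ract y ((t y : H)^-1)%g = s (p y).
Proof.
by have [_ _ _ h3 _] := ht => Uy; rewrite -{1}(h3 y Uy) -actM mulgV act1.
Qed.

Lemma at_normE (y : E) v : U (p y) ->
  at_norm t (at_class y v) = mkT (s (p y)) (mdiff (fun y' : E => ract y' (t y : H)^-1%g) y v).
Proof.
move=> Uy; have [y' [v' [e e']]] := at_class_repr (at_class y v).
have py : p y' = p y by have := congr1 (fun a => (at_proj a).1) e; rewrite !(at_proj_class hM hH hE).
have Uy' : U (p y') by rewrite py.
rewrite /at_norm e' /= triv_normalize // py; congr mkT; apply: (@at_class_inj (s (p y))).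
rewrite -[in LHS]py -(triv_normalize Uy') (at_class_ract hH hE) -e.
by rewrite -(triv_normalize Uy) (at_class_ract hH hE).
Qed.

Lemma at_norm_section (x : M) v : U x -> at_norm t (at_class (s x) v) = mkT (s x) v.
Proof.
move=> Ux; have [_ h1 _ _ _] := ht; have [_ px] := h1 x Ux.
rewrite at_normE ?px // triv_section_one //; congr mkT.
by rewrite invg1 (mdiff_ract1 hE).
Qed.

(** On representatives, normalizing is [at_param] with group coordinate 1 after [at_coord]. *)
Lemma hol_at_norm (y : E) v : U (p y) -> holomorphic_at (at_norm t) (at_class y v).
Proof.
move=> Uy; apply: (hol_at_desc hM hH hE); have aT := tangentM_atlas aE.
have [cov _ _] := aM; have [phi aphi py] := cov (p y).
have [gam [agam g1]] := chart_one_exists hH.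
pose V := [set x | U x /\ cdom phi x].
have Vy : V (p y) by [].
have h1 := @hol_at_coord R M H E hM hH hE U s t ht phi aphi gam agam g1 (y, v) Vy.
have h2 := @hol_at_param R M H E hM hH hE U s t ht phi aphi gam agam g1 1%g (p y)
  (mdiff (triv_coord t phi gam y) y v) Vy.
have h3 := hol_comp aT (affM_atlas _) h1 h2.
apply: (hol_ext aT _ h3).
have n1 : \forall yv \near ((y, v) : tangentM E), V (p yv.1).
  apply: (@hol_near_pre R (tangentM E) M (fun yv => p yv.1) (y, v) V).
    exact: (hol_cont (hol_comp aT aE (hol_T_base aE (y, v)) (hol_proj hE _))).
  exact: (triv_dom_near hM ht aphi Vy).
apply: filterS n1 => -[y' v'] /= Vy'; rewrite (at_normE v' Vy'.1).
have [_ k1 _ _ _] := ht; have [_ ps] := k1 _ Vy'.1.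
set y1 := s (p y'); set v1 := mdiff _ _ _.
have Vy1 : V (p y1) by rewrite ps.
have -> : at_coord t phi gam (y', v') = at_coord t phi gam (mkT y1 v1).
  apply/(at_coord_rel hM hH hE ht aphi agam g1 v' v1 Vy' Vy1).
  by exists ((t y' : H)^-1)%g; rewrite /= triv_normalize //; exact: Vy'.1.
have := at_paramK hM hH hE ht aphi agam g1 v1 Vy1.
by rewrite triv_section_one //; exact: Vy'.1.
Qed.

End AtiyahNormalization.

(** * The Atiyah bundle of a reduction *)

Section Reductions.
Context {R : realType}.
Local Notation C := (Cx R).
Context (M : premanifold R) (G : lie_data R) (E : bundle_data M G).
Context (S : set G) (hS : is_subgroup S) (F : set E).
Context (hF : forall (y : E) (n : G), F y -> S n -> F (ract y n)).
Hypotheses (hM : is_complex_manifold M) (hG : is_complex_lie_group G)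
  (hE : is_holomorphic_principal_bundle E) (hR : is_holomorphic_reduction hS hF).
Local Notation EF := (reduction hS hF).
Local Notation HS := (sub_lie hS).
Local Notation incl := (@red_incl R M G E S hS F hF).
Local Notation aM := (base_atlas hM).
Local Notation aE := (total_atlas hE).
Local Notation hS' := (proj1 hR).
Local Notation hEF := (proj2 hR).
Local Notation aF := (total_atlas hEF).
Local Notation p := (@base_proj R M G E).
Local Notation q := (@base_proj R M HS EF).

Lemma reduction_submanifold : is_submanifold F.
Proof. by have [h _ _ _ _] := hEF; exact: h. Qed.

Lemma subgroup_submanifold : @is_submanifold R (lieM G) S.
Proof. by have [h _ _] := hS'; exact: h. Qed.

Lemma hol_incl (b : EF) : holomorphic_at incl b.
Proof. exact: (hol_sub_incl reduction_submanifold b). Qed.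

Lemma mdiff_incl_ract (b : EF) (n : HS) l :
  mdiff incl (ract b n) (mdiff (fun b : EF => ract b n) b l) =
  mdiff (fun y : E => ract y (sval n)) (incl b) (mdiff incl b l).
Proof.
have e1 := mdiff_comp aF aF aE l (hol_ract hS' hEF n b) (hol_incl (ract b n)).
have e2 := mdiff_comp aF aE aE l (hol_incl b) (hol_ract hG hE (sval n) (incl b)).
rewrite -e1 -e2; reflexivity.
Qed.

(** [at_map] uses a chosen representative; equivariance of the inclusion makes the choice
    harmless. *)
Lemma at_map_class (b : EF) l : at_map incl (at_class b l) = at_class (incl b) (mdiff incl b l).
Proof.
have [b' [l' [e e']]] := at_class_repr (at_class b l).
rewrite /at_map e' /=; move/(at_class_eq hS' hEF): e => [n [e1 e2]].
have -> : incl b' = ract (incl b) (sval n) by rewrite e1.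
rewrite e1 e2 mdiff_incl_ract; exact: (at_class_ract hG hE).
Qed.

Lemma hol_at_map (b : EF) l : holomorphic_at (at_map incl) (at_class b l).
Proof.
apply: (hol_at_desc hM hS' hEF).
have h1 := hol_T_map aF aE l (hol_incl b).
have h2 := hol_comp (tangentM_atlas aF) (tangentM_atlas aE) h1 (hol_at_class hM hG hE _).
apply: (hol_ext (tangentM_atlas aF) _ h2); apply: mnear_all => -[b' l'] /=.
by rewrite at_map_class.
Qed.

Lemma local_retraction (b : EF) : exists g : E -> EF,
  holomorphic_at g (incl b) /\ \forall b' \near b, g (incl b') = b'.
Proof.
have hs := reduction_submanifold.
have [c [D [f [ac cb opD domD [hf cf]]]]] := sub_chart hs b.
have Db : D (sval b) by move: cb; rewrite domD.
exists (cinv c \o f); split.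
  have hc := hol_cinv aF ac cb; rewrite (cf b cb) in hc.
  exact: (hol_comp aE (affM_atlas _) (hf _ Db) hc).
apply: filterS (cdom_near aF ac cb) => b' cb' /=.
by rewrite -(cf b' cb') (cinvK aF ac cb').
Qed.

(** A class of At(E) is normalized to a vector along a section that lies in the reduction, and a
    local retraction of E onto the reduction carries this vector back. *)
Lemma at_map_section (x0 : M) : exists r : atiyahM E -> atiyahM EF,
  (forall (b : EF) l, q b = x0 -> holomorphic_at r (at_map incl (at_class b l))) /\
  \forall x \near x0, forall a : atiyahM EF, (at_proj a).1 = x -> r (at_map incl a) = a.
Proof.
have [U [sN [tN [htN Ux0]]]] := triv_exists hEF x0.
have [k0 k1 k2 k3 k4] := htN.
pose s := incl \o sN.
have ns : \forall x \near x0, holomorphic_at s x /\ p (s x) = x.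
  apply: filterS (k0 x0 Ux0) => x Ux; have [h ps] := k1 x Ux; split; last exact: ps.
  exact: (hol_comp aM aF h (hol_incl _)).
have [U' [t [ht U'x0]]] := triv_of_section hM hG hE ns.
have [g [hg gK]] := local_retraction (sN x0).
have [k0' _ _ _ _] := ht.
pose Tg (yv : tangentM E) : tangentM EF := mkT (g yv.1) (mdiff g yv.1 yv.2).
exists (fun a => at_class (Tg (at_norm t a)).1 (Tg (at_norm t a)).2); split.
  move=> b l qb; rewrite at_map_class.
  have Ub : U' (p (incl b)) by rewrite [p _]qb.
  have h1 := hol_at_norm hM hG hE ht (mdiff incl b l) Ub.
  have e := at_normE hM hG hE ht (mdiff incl b l) Ub; rewrite [p _]qb in e.
  have aA := atiyah_atlas hM hG hE.
  have h2 := hol_T_map aE aF (mdiff (fun y' : E => ract y' (t (incl b) : G)^-1%g) (incl b) (mdiff incl b l)) hg.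
  have h2' : holomorphic_at Tg (at_norm t (at_class (incl b) (mdiff incl b l))) by rewrite e.
  have h3 := hol_comp aA (tangentM_atlas aE) h1 h2'.
  exact: (hol_comp aA (tangentM_atlas aF) h3 (hol_at_class hM hS' hEF _)).
have n1 : \forall x \near x0, \forall b \near sN x, g (incl b) = b.
  have := hol_near_pre (hol_cont (k1 x0 Ux0).1) (nbhs_interior gK).
  by [].
have n2 : \forall x \near x0, holomorphic_at g (incl (sN x)).
  have hs0 := hol_comp aM aF (k1 x0 Ux0).1 (hol_incl (sN x0)).
  exact: (@hol_near_pre R M E s x0 (fun y => holomorphic_at g y) (hol_cont hs0) (hol_near aE aF hg)).
apply: filterS (filterI (filterI n1 n2) (filterI (k0 x0 Ux0) (k0' x0 U'x0))).
move=> x [[gx hgx] [Ux U'x]] a ax.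
have [hsx psx] := k1 x Ux.
have [v ->] : exists v, a = at_class (sN x) v.
  have [b [l [e _]]] := at_class_repr a.
  have {}ax : q b = x by rewrite -ax e (at_proj_class hM hS' hEF).
  have Ub : U (q b) by rewrite ax.
  exists (mdiff (fun b' : EF => ract b' ((tN b : HS)^-1)%g) b l).
  by rewrite -ax -(triv_normalize htN Ub) (at_class_ract hS' hEF) -e.
rewrite at_map_class -/(s x) (at_norm_section hM hG hE ht _ U'x) /Tg /=.
have gs : g (s x) = sN x by exact: (nbhs_singleton gx).
have e1 := mdiff_comp aF aE aF v (hol_incl (sN x)) hgx.
have e2 := mdiff_ext aF aF v gx (hol_comp aF aE (hol_incl (sN x)) hgx).
have key : mdiff g (s x) (mdiff incl (sN x) v) = v.
  apply: etrans (esym e1) _; apply: etrans e2 _; exact: mdiff_id aF (sN x) v.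
by rewrite gs key.
Qed.

End Reductions.

Section ReductionConnections.
Context {R : realType}.
Local Notation C := (Cx R).
Context (M : premanifold R) (G : lie_data R) (E : bundle_data M G).
Context (S : set G) (hS : is_subgroup S) (F : set E).
Context (hF : forall (y : E) (n : G), F y -> S n -> F (ract y n)).
Hypotheses (hM : is_complex_manifold M) (hG : is_complex_lie_group G)
  (hE : is_holomorphic_principal_bundle E) (hR : is_holomorphic_reduction hS hF).
Local Notation EF := (reduction hS hF).
Local Notation HS := (sub_lie hS).
Local Notation incl := (@red_incl R M G E S hS F hF).
Local Notation aM := (base_atlas hM).
Local Notation aE := (total_atlas hE).
Local Notation hS' := (proj1 hR).
Local Notation hEF := (proj2 hR).
Local Notation aF := (total_atlas hEF).
Local Notation p := (@base_proj R M G E).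
Local Notation q := (@base_proj R M HS EF).

Lemma at_proj_map (a : atiyahM EF) : at_proj (at_map incl a) = at_proj a.
Proof.
have [b [l [-> _]]] := at_class_repr a.
rewrite (at_map_class hG hE hR) (at_proj_class hM hG hE) (at_proj_class hM hS' hEF).
have e := mdiff_comp aF aE aM l (hol_incl hR b) (hol_proj hE (incl b)).
by congr mkT; exact: esym e.
Qed.

Lemma at_map_inj : injective (at_map incl).
Proof.
move=> a a' e; have [r [_ hr]] := at_map_section hM hG hE hR (at_proj a).1.
have {}hr := nbhs_singleton hr.
by rewrite -(hr a) // -[RHS](hr a') ?e // -(at_proj_map a') -e at_proj_map.
Qed.

Lemma mdiff_incl_left (b : EF) : exists2 g : 'rV[C]_(mdim E) -> 'rV[C]_(mdim EF),
  linear g & forall l, g (mdiff incl b l) = l.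
Proof.
have [g [hg gK]] := local_retraction hE hR b.
exists (mdiff g (incl b)) => [k u v|l]; first exact: mdiffP.
apply: etrans (esym (mdiff_comp aF aE aF l (hol_incl hR b) hg)) _.
apply: etrans (mdiff_ext aF aF l gK (hol_comp aF aE (hol_incl hR b) hg)) _.
exact: mdiff_id aF b l.
Qed.

Section Transfer.
Context (D0 : tangentM M -> atiyahM E) (DF : tangentM M -> atiyahM EF).
Hypotheses (hD : forall xv, D0 xv = at_map incl (DF xv))
  (pD : forall xv, at_proj (DF xv) = xv).

(** Near each point [DF] is thus a holomorphic map after [D0], and inherits its regularity. *)
Lemma transfer_section (xv : tangentM M) : exists2 r : atiyahM E -> atiyahM EF,
  holomorphic_at r (D0 xv) & \forall xv' \near xv, r (D0 xv') = DF xv'.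
Proof.
have [r [r1 r2]] := at_map_section hM hG hE hR xv.1; exists r.
  have [b [l [e _]]] := at_class_repr (DF xv); rewrite hD e; apply: r1.
  by have := pD xv; rewrite e (at_proj_class hM hS' hEF) => <-.
have n1 := hol_near_pre (hol_cont (hol_T_base aM xv)) r2.
by apply: filterS n1 => xv' h; rewrite hD; apply: h; rewrite pD.
Qed.

Lemma transfer_smooth : smooth D0 -> smooth DF.
Proof.
move=> s0 xv; have [r hr E'] := transfer_section xv; have aT := tangentM_atlas aM.
apply: (smooth_ext aT E').
exact: (smooth_hol_comp aT (atiyah_atlas hM hG hE) (s0 xv) hr).
Qed.

Lemma transfer_holomorphic : holomorphic D0 <-> holomorphic DF.
Proof.
have aT := tangentM_atlas aM; split=> h xv.
  have [r hr E'] := transfer_section xv; apply: (hol_ext aT E').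
  exact: (hol_comp aT (atiyah_atlas hM hG hE) (h xv) hr).
have [b [l [e _]]] := at_class_repr (DF xv).
have h2 : holomorphic_at (at_map incl) (DF xv).
  by rewrite e; exact: (hol_at_map hM hG hE hR).
have h3 := hol_comp aT (atiyah_atlas hM hS' hEF) (h xv) h2.
by apply: (hol_ext aT _ h3); apply: mnear_all => xv'; rewrite /= hD.
Qed.

End Transfer.

(** Over a point of the reduction, the value of [D0] is the class of a horizontal vector there; its
    tangency provides the lift, which is linear thanks to a linear left inverse of the differential
    of the inclusion. *)
Lemma induced_connection (D0 : tangentM M -> atiyahM E) :
  is_complex_connection D0 ->
  (forall (b : EF) w, horizontal D0 (incl b) w -> exists l, w = mdiff incl b l) ->
  exists DF : tangentM M -> atiyahM EF, is_complex_connection DF /\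
    forall xv, D0 xv = at_map incl (DF xv).
Proof.
move=> [sD lD pD] hor.
have lift (b : EF) : exists L : {linear 'rV[C]_(mdim M) -> 'rV[C]_(mdim EF)},
    forall v, D0 (mkT (q b) v) = at_map incl (at_class b (L v)).
  have [L0 hL0] := lD (incl b); have [g lg gK] := mdiff_incl_left b.
  have lL : linear (fun v => g (L0 v)) by move=> k u v; rewrite linearP lg.
  exists (linear_pack lL) => v; rewrite (at_map_class hG hE hR) /=.
  have [l el] : exists l, L0 v = mdiff incl b l.
    apply: hor; rewrite /horizontal /= -hL0; congr (D0 (mkT _ _)).
    have := pD (mkT (p (incl b)) v); rewrite hL0 (at_proj_class hM hG hE).
    by move=> /(congr1 snd).
  by rewrite el gK -el; exact: hL0.
have ex (xv : tangentM M) : exists a : atiyahM EF, D0 xv = at_map incl a.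
  case: xv => x v; have [b qb] := proj_surj hEF x; have [L hL] := lift b.
  by exists (at_class b (L v)); rewrite -hL qb.
have [DF hDF] := choice ex; exists DF; split=> //.
have pF xv : at_proj (DF xv) = xv by rewrite -at_proj_map -hDF pD.
split=> //; first exact: (transfer_smooth hDF pF sD).
move=> b; have [L hL] := lift b; exists L => v.
by apply: at_map_inj; rewrite -hDF hL.
Qed.

End ReductionConnections.

Lemma subgroup_sub_normalizer (G : groupType) (S : set G) (k : G) :
  is_subgroup S -> S k -> group_normalizer S k.
Proof.
move=> hS Sk t; have SkV := subV hS Sk; split=> St.
  by apply: (subM2 hS) SkV; exact: (subM2 hS).
have -> : t = (k^-1 * (k * t * k^-1) * k)%g by rewrite !mulgA mulVg mul1g mulgVK.
by apply: (subM2 hS) Sk; exact: (subM2 hS).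
Qed.

Lemma centralizer_sub_normalizer (G : groupType) (S : set G) (g : G) :
  (forall t, S t -> (g * t = t * g)%g) -> group_normalizer S g.
Proof.
move=> hg t; split=> St; first by rewrite hg // mulgK.
have -> : t = (g^-1 * (g * t * g^-1 * g))%g by rewrite mulgVK mulKg.
by rewrite -(hg _ St) mulKg.
Qed.

Lemma ad_class_surj (R : realType) (M : premanifold R) (H : lie_data R) (E : bundle_data M H)
  (a : AdM E) : exists (y : E) (z : H), a = ad_class y z.
Proof.
have := quot_reprK a; case: (quot_repr a) => y z e.
by exists y, z; rewrite -e.
Qed.

(** * Connections and the torus subbundle *)

Section TorusReduction.
Context {R : realType}.
Local Notation C := (Cx R).
Context (M : premanifold R) (G : alggroup_data R) (EG : bundle_data M G).
Context (T : set G) (TT : set (AdM EG)).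
Hypotheses (hM : is_complex_manifold M) (hG : is_affine_algebraic_group G)
  (hE : is_holomorphic_principal_bundle EG) (hT : is_algebraic_torus T)
  (hTT : is_submanifold TT) (hTc : fibers_conjugate_to TT T)
  (hR : is_holomorphic_reduction (group_normalizer_subgroup T) (@EN_act _ _ _ EG TT T)).
Local Notation N := (group_normalizer T).
Local Notation EF := (EN TT T).
Local Notation HS := (sub_lie (group_normalizer_subgroup T)).
Local Notation incl := (@EN_incl R M G EG TT T).
Local Notation p := (@base_proj R M G EG).
Local Notation q := (@base_proj R M HS EF).

Let hL : is_complex_lie_group G.
Proof. by have [h _ _ _ _] := hG. Qed.

Local Notation hS' := (proj1 hR).
Local Notation hEF := (proj2 hR).
Local Notation aM := (base_atlas hM).
Local Notation aG := (group_atlas hL).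
Local Notation aE := (total_atlas hE).
Local Notation aF := (total_atlas hEF).
Local Notation aA := (ad_atlas hM hL hE).
Local Notation aTT := (subM_atlas hTT).

(** Membership in E_N says only that the fiber, a conjugate of T, contains T; by [torus_conj_sub]
    such an inclusion is an equality. *)
Lemma torus_fiber (y : EG) (z : G) : EN_set TT T y -> TT (ad_class y z) <-> T z.
Proof.
move=> hy; have [g hg] := hTc y.
have Tg : forall t, T t -> T (t ^ g)%g.
  have h := @torus_conj_sub R G hG T hT g^-1%g.
  move=> t Tt; rewrite -[g]invgK; apply: h Tt => t' /hy.
  have -> : TT (ad_class y t') = [set z | TT (ad_class y z)] t' by [].
  by rewrite hg => -[t0 Tt0 <-]; rewrite conjgK.
split; last exact: hy.
have -> : TT (ad_class y z) = [set z | TT (ad_class y z)] z by [].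
by rewrite hg => -[t Tt <-]; exact: Tg.
Qed.

Lemma hol_ad_orbit (y : EG) (z : G) : holomorphic_at (fun y : EG => ad_class y z) y.
Proof.
have h1 := hol_pair aE aG aE (hol_id aE y) (@hol_cst R EG (lieM G) aE z y).
exact: (hol_comp aE (prodM_atlas aE aG) h1 (hol_ad_class hM hL hE _)).
Qed.

Lemma ad_orbit_tangent (b : EF) (z : G) l (a : subM TT) : T z ->
  sval a = ad_class (incl b) z ->
  sub_tangent a (mdiff (fun y : EG => ad_class y z) (incl b) (mdiff incl b l)).
Proof.
move=> Tz ea.
have h := hol_comp aF aE (hol_incl hR b) (hol_ad_orbit (incl b) z).
have e := mdiff_comp aF aE aA l (hol_incl hR b) (hol_ad_orbit (incl b) z).
rewrite -e; apply: (sub_tangent_values aA hTT aF l h (esym ea)).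
by apply: mnear_all => b'; exact: (svalP b' z Tz).
Qed.

(** [y, z] = [yh, z^h] with yh in E_N, where the horizontal vectors of an induced connection are
    tangent to E_N; moving the point inside E_N keeps the class in [TT]. *)
Lemma induced_preserves (D0 : tangentM M -> atiyahM EG) (DN : tangentM M -> atiyahM EF) :
  is_complex_connection DN -> (forall xv, D0 xv = at_map incl (DN xv)) ->
  preserves (induced_ad_connection D0) TT.
Proof.
move=> [_ lN _] hD a u [y [z [ea [w hw ->]]]].
have [b qb] := proj_surj hEF (p y).
have [h yh] : exists h : G, incl b = ract y h by apply: (act_transitive hE); exact: esym qb.
have [L hL'] := lN b; have := hw; rewrite /horizontal /= hD -qb hL'.
rewrite (at_map_class hL hE hR) -(at_class_ract hL hE y w h) -yh.
move=> /(at_class_inj hL hE) ew.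
have E : (fun y' : EG => ad_class y' z) = (fun y' : EG => ad_class y' (z ^ h)%g) \o (fun y' : EG => ract y' h).
  by apply/funext => y' /=; rewrite ad_class_act /conjg !mulgA mulgV mul1g mulgK.
have e := mdiff_comp aE aE aA w (hol_ract hL hE h y) (hol_ad_orbit (ract y h) (z ^ h)%g).
have ea' : sval a = ad_class (incl b) (z ^ h)%g.
  by rewrite yh ad_class_act /conjg !mulgA mulgV mul1g mulgK; exact: ea.
have Tz : T (z ^ h)%g by apply/(torus_fiber _ (svalP b)); have := svalP a; rewrite ea'.
by rewrite E e -yh -ew; exact: ad_orbit_tangent Tz ea'.
Qed.

(* In the trivialization [y, z] |-> t(y) z t(y)^-1 given by a local section of
   E_N, TT is constant equal to T, and the horizontal lift of w at [y, a] is
   theta - Ad(a) theta, where theta = dt(w); w is tangent to E_N iff theta is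
   tangent to N. *)
Lemma preserves_horizontal (D0 : tangentM M -> atiyahM EG) (b : EF) w :
  preserves (induced_ad_connection D0) TT ->
  horizontal D0 (incl b) w -> exists l, w = mdiff incl b l.
Proof.
move=> pres hw; have [U [sN0 [tN [htN Ux0]]]] := triv_exists hEF (q b).
have [k0 k1 k2 k3 k4] := htN; pose x0 := q b.
(* Translation by the constant [tN b] makes the section pass through [b], so that the coordinate [t]
   is 1 at [y]. *)
pose sN x : EF := ract (sN0 x) (tN b); pose s := incl \o sN.
have sNx0 : sN x0 = b by exact: k3.
have hsN x : U x -> holomorphic_at sN x.
  move=> Ux; apply: (hol_act hS' hEF aM (k1 x Ux).1).
  exact: (@hol_cst R M (lieM HS) aM (tN b) x).
have ns : \forall x \near x0, holomorphic_at s x /\ p (s x) = x.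
  apply: filterS (k0 x0 Ux0) => x Ux; split.
    exact: (hol_comp aM aF (hsN x Ux) (hol_incl hR _)).
  by rewrite -[RHS](k1 x Ux).2; exact: (proj_ract hEF (sN0 x) (tN b)).
have [U' [t [ht U'x0]]] := triv_of_section hM hL hE ns.
have [j0 j1 j2 j3 j4] := ht.
pose y := incl b; have py : p y = x0 by [].
have sx0 : s x0 = y by exact: (congr1 incl sNx0).
have ty : t y = 1%g by rewrite -sx0; exact: (triv_section_one ht U'x0).
have U'y : U' (p y) by [].
have htY := j2 y U'y.
pose th := mdiff t y w.
pose e1 : subM (X := lieM G) N := (1%g : HS).
have e1E : sval e1 = 1%g by [].
have near_p : \forall y' \near y, U' (p y').
  exact: (hol_near_pre (hol_cont (hol_proj hE y)) (j0 _ U'y)).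
have tangent a : T a -> sub_tangent e1 (th - Ad a th).
  move=> Ta; have TTa : TT (ad_class y a) by exact: (svalP b a Ta).
  pose aa : subM TT := exist _ (ad_class y a) TTa.
  have [v _ ev] : sub_tangent aa (mdiff (fun y' : EG => ad_class y' a) y w).
    by apply: pres; exists y, a; split=> //; exists w.
  (* The fiber coordinate divided by [a] sends [y, a] to 1 and, near it, [TT] into T, hence into N;
     so its differential sends vectors tangent to [TT] to vectors tangent to N. *)
  pose kap (c : AdM EG) : lieM G := ((ad_triv t c : G) * a^-1)%g.
  have hkap : holomorphic_at kap (ad_class y a).
    apply: (hol_mul hL aA (hol_ad_triv hM hL hE a ht U'y)).
    exact: (@hol_cst R (AdM EG) (lieM G) aA (a^-1)%g _).
  have kap1 : kap (ad_class y a) = 1%g.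
    by rewrite /kap (ad_trivE hE a ht U'y) ty mul1g invg1 mulg1 mulgV.
  have hincl := hol_sub_incl hTT aa.
  have tan1 : sub_tangent e1 (mdiff (kap \o @sub_incl R (AdM EG) TT) aa v).
    apply: (sub_tangent_values aG (subgroup_submanifold hR) aTT v (hol_comp aTT aA hincl hkap)).
      by rewrite /= kap1.
    have hp := hol_comp aTT aA hincl (hol_ad_proj hM hL hE _).
    have n1 : \forall c \near aa, U' (ad_proj (sub_incl c)).
      apply: (hol_near_pre (hol_cont hp)); rewrite /= /sub_incl /= (ad_proj_class hE).
      exact: j0.
    apply: filterS n1 => c Uc; have [y' [z' ec]] := ad_class_surj (sub_incl c).
    have Uy' : U' (p y') by move: Uc; rewrite ec (ad_proj_class hE).
    have Tz : T ((t y' : G) * z' * (t y' : G)^-1)%g.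
      apply/(torus_fiber _ (svalP (sN (p y')))).
      have := svalP c; rewrite [sval c]ec -{1}(j3 y' Uy') ad_class_act.
      by [].
    rewrite /kap /= ec (ad_trivE hE z' ht Uy').
    have [gT _] := hT.1.
    have Tk : T ((t y' : G) * z' * (t y' : G)^-1 * a^-1)%g by apply: (subM2 gT) => //; exact: (subV gT).
    exact: (subgroup_sub_normalizer gT Tk).
  have eq1 := mdiff_comp aTT aA aG v hincl hkap.
  have hor1 := hol_ad_orbit y a.
  have eq2 := mdiff_comp aE aA aG w hor1 hkap.
  rewrite eq1 ev -eq2 in tan1.
  (* [kap] along y' |-> [y', a]. Since t = k . (a t a^-1) with both factors 1 at y, the Leibniz rule
     gives theta = dk(w) + Ad(a) theta. *)
  pose k (y' : EG) : lieM G := ((t y' : G) * a * (t y' : G)^-1 * a^-1)%g.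
  have kE : {near y, kap \o (fun y' : EG => ad_class y' a) =1 k}.
    by apply: filterS near_p => y' Uy' /=; rewrite /kap (ad_trivE hE a ht Uy').
  have hk0 := hol_comp aE aA hor1 hkap.
  have eq3 := mdiff_ext aE aG w kE hk0.
  have hk := hol_ext aE kE hk0.
  rewrite eq3 in tan1.
  suff -> : th - Ad a th = mdiff k y w by [].
  have ky : k y = 1%g by rewrite /k ty mul1g invg1 mulg1 mulgV.
  have hct : holomorphic_at (conj_by a \o t) y by exact: (hol_comp aE aG htY (hol_conj_by hL a _)).
  have tE : t = (fun y' => ((k y' : G) * (conj_by a (t y') : G))%g).
    by apply/funext => y'; rewrite /k /conj_by !mulgA mulgVK mulgVK mulgK.
  have [_ hmul _] := hL.
  have leib := mdiff_prod aG aG aG aE w hk hct (hmul (k y, conj_by a (t y))).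
  have ct1 : conj_by a (t y) = 1%g by rewrite ty conj_by1.
  have m1 : (fun x : lieM G => ((x : G) * (conj_by a (t y) : G))%g) = id.
    by apply/funext => x; rewrite ct1 mulg1.
  have m2 : (fun x : lieM G => ((k y : G) * (x : G))%g) = id.
    by apply/funext => x; rewrite ky mul1g.
  have leib' : th = mdiff k y w + mdiff (conj_by a \o t) y w.
    apply: etrans (congr1 (fun f => mdiff f y w) tE) _.
    apply: etrans leib _; rewrite /= m1 m2.
    by congr (_ + _); exact: (mdiff_id aG).
  have eAd : mdiff (conj_by a \o t) y w = Ad a th.
    have := mdiff_comp aE aG aG w htY (hol_conj_by hL a (t y)).
    by rewrite ty.
  rewrite eAd in leib'; exact: (canLR (addrK (Ad a th)) leib').
have [A [A1 AM AT AC]] := torus_finite_centralizer hG hT.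
have th_tan : sub_tangent e1 th.
  apply: (@averaged_tangent R G hL N (subgroup_submanifold hR) e1 e1E (undup A) (undup_uniq A)).
  - by rewrite mem_undup.
  - by move=> a a'; rewrite !mem_undup; exact: AM.
  - move=> g hg; apply: centralizer_sub_normalizer => t0 Tt0.
    by apply: (AC g _ t0 Tt0) => a aA'; apply: hg; rewrite mem_undup.
  by move=> a; rewrite mem_undup => /AT; exact: tangent.
have [n _ en] := th_tan.
have hsy : holomorphic_at (s \o p) y.
  exact: (hol_comp aE aM (hol_proj hE y) (nbhs_singleton ns).1).
have yE : {near y, (fun y' : EG => y') =1 (fun y' => ract (s (p y')) (t y'))}.
  by apply: filterS near_p => y' Uy'; rewrite j3.
have [_ _ hact _ _] := hE.
have leib := mdiff_prod aE aG aE aE w hsy htY (hact (s (p y), t y)).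
have m1 : (fun x : EG => ract x (t y : G)) = id by apply/funext => x; rewrite ty act1.
(* The Leibniz rule for y' = s(p y') . t(y'): a part along the section and a vertical part. Both
   come from E_N, since the section runs in it and [th] is the image of a vector tangent to N, which
   acts on E_N. *)
have dec : w = mdiff (s \o p) y w + mdiff (fun h : lieM G => ract y (h : G)) (1%g : lieM G) th.
  have eid := mdiff_ext aE aE w yE (hol_id aE y).
  have t1 : mdiff (fun x : EG => ract x (t y : G)) ((s \o p) y) (mdiff (s \o p) y w) = mdiff (s \o p) y w.
    by rewrite m1; exact: (mdiff_id aE (s (p y))).
  have spy : (s \o p) y = y by exact: sx0.
  have t2 : mdiff (fun h : lieM G => ract ((s \o p) y) (h : G)) (t y) (mdiff t y w) =
      mdiff (fun h : lieM G => ract y (h : G)) (1%g : lieM G) th by rewrite spy ty.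
  rewrite (mdiff_id aE y w) in eid; apply: etrans eid _; apply: etrans leib _.
  exact: (congr2 +%R t1 t2).
have d1 : mdiff (s \o p) y w = mdiff incl b (mdiff (sN \o p) y w).
  have hp : holomorphic_at (sN \o p) y by exact: (hol_comp aE aM (hol_proj hE y) (hsN x0 Ux0)).
  have := mdiff_comp aE aF aE w hp (hol_incl hR _).
  by rewrite /= [sN (p y)]sNx0.
have d2 : mdiff (fun h : lieM G => ract y (h : G)) (1%g : lieM G) th =
    mdiff incl b (mdiff (fun h : lieM HS => ract b (h : HS)) (1%g : lieM HS) n).
  have hob := hol_orbit hS' hEF b (1%g : HS).
  have r1 := mdiff_comp (group_atlas hS') aF aE n hob (hol_incl hR _).
  have r2 := mdiff_comp (group_atlas hS') aG aE n (hol_sub_incl (subgroup_submanifold hR) e1) (hol_orbit hL hE y _).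
  rewrite -en; apply: etrans (esym r2) _; apply: etrans r1 _.
  by rewrite act1.
by exists (mdiff (sN \o p) y w + mdiff (fun h : lieM HS => ract b (h : HS)) (1%g : lieM HS) n); rewrite mdiffD -d1 -d2.
Qed.

End TorusReduction.

Theorem theorem1p2 (R : realType) (M : premanifold R) (G : alggroup_data R)
    (EG : bundle_data M G) (T : set G) (TT : set (AdM EG))
    (D0 : tangentM M -> atiyahM EG)
    (hM : is_complex_manifold M)
    (hMcompact : compact [set: M])
    (hMconnected : connected [set: M])
    (hG : is_affine_algebraic_group G)
    (hGconnected : @connected (lieM G) [set: lieM G])
    (hGreductive : is_reductive G)
    (hEG : is_holomorphic_principal_bundle EG)
    (hT : is_algebraic_torus T)
    (hTZ : Z0 G `<=` T)
    (hTT : is_torus_subbundle TT)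
    (hTTconj : fibers_conjugate_to TT T)
    (hEN : is_holomorphic_reduction (group_normalizer_subgroup T) (@EN_act _ _ _ EG TT T))
    (hD0 : is_complex_connection D0) :
  ((exists DN : tangentM M -> atiyahM (EN TT T),
      is_complex_connection DN /\
      forall xv, D0 xv = at_map (@EN_incl _ _ _ EG TT T) (DN xv)) <->
   preserves (induced_ad_connection D0) TT) /\
  (preserves (induced_ad_connection D0) TT ->
   forall DN : tangentM M -> atiyahM (EN TT T),
     is_complex_connection DN ->
     (forall xv, D0 xv = at_map (@EN_incl _ _ _ EG TT T) (DN xv)) ->
     (is_holomorphic_connection D0 <-> is_holomorphic_connection DN)).
Proof.
have [hTs _ _ _] := hTT; have [hL _ _ _ _] := hG.
split; last first.
  move=> _ DN hDN hD; have [_ _ pD] := hDN.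
  have tr := transfer_holomorphic hM hL hEG hEN hD pD.
  by split=> -[_ h]; split=> //; apply/tr.
split=> [[DN [hDN hD]]|pres].
  exact: (induced_preserves hM hG hEG hT hTs hTTconj hEN hDN hD).
apply: (induced_connection hM hL hEG hEN hD0) => b w.
exact: (preserves_horizontal hM hG hEG hT hTs hTTconj hEN pres).
Qed.
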